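(* Let $n\ge 2$, let $k_1,\dots,k_n$ be nonnegative integers, $\lambda=\sum_{i=1}^nk_i\lambda_i$ and $|\lambda|=\sum_{i=1}^nk_i$. Let $V_n(\lambda)=\overline{M}\subset\mathcal{C}_n$ be the polynomial realization of the irreducible $\mathfrak{sl}(n+1)$-module of highest weight $\lambda$ described in the context, and for each $0\le r\le|\lambda|$ let $\mathcal{B}(\lambda)_r\subset(S_n(\lambda))_r$ be a set of representatives of the equivalence classes of $(S_n(\lambda))_r$ under the relation $u\sim v\iff\mathrm{lexdeg}(u)=\mathrm{lexdeg}(v)$. Then $\mathcal{B}(\lambda)=\bigcup_r\mathcal{B}(\lambda)_r$ is a basis of $V_n(\lambda)$. Moreover, there is a bijection between $\mathcal{B}(\lambda)$ and the Gelfand–Tsetlin basis of the irreducible module with highest weight $\lambda$ (i.e. with the set of Gelfand–Tsetlin patterns of shape $\lambda$).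
   Context: $E_{i,j}$ denotes the matrix unit with $1$ in position $(i,j)$; the base field is $\mathbb{C}$; $\mathbb{N}=\{0,1,2,\dots\}$. The Cartan subalgebra of $\mathfrak{sl}(n+1)$ is spanned by $h_i=E_{n+2-i,n+2-i}-E_{n+1-i,n+1-i}$ ($1\le i\le n$), the positive root vectors are $E_{i,j}$ with $j<i$, and $\lambda_i(h_r)=\delta_{i,r}$ defines the fundamental weights. Construction. For $1\le m\le n$ let $\mathcal{C}_m=\mathbb{C}[x_{i,j}\mid 1\le j\le i\le m]$ and $c_m=-\frac{1}{m+1}\sum_{i=0}^{m-1}(m-i)k_{n-m+1+i}$. $\mathfrak{sl}(m+1)$ acts on $\mathcal{C}_m$ inductively. For $m=1$: $E_{1,2}=x_{1,1}^2\partial_{x_{1,1}}-k_nx_{1,1}$, $E_{2,1}=-\partial_{x_{1,1}}$, $E_{1,1}-E_{2,2}=2x_{1,1}\partial_{x_{1,1}}-k_n$. For $2\le m\le n$: make $\mathcal{C}_{m-1}$ a $\mathfrak{gl}(m)$-module by letting $\sum_{i=1}^mE_{i,i}$ act as the scalar $c_m$; view differential operators on $\mathcal{C}_{m-1}$ as operators on $\mathcal{C}_m$; put $\mathcal{D}_m=\sum_{s=1}^mx_{m,s}\partial_{x_{m,s}}$; and for $i\ne j$ in $\{1,\dots,m\}$ let $E_{i,j}|_{\mathcal{C}_m}=x_{m,i}\partial_{x_{m,j}}+E_{i,j}|_{\mathcal{C}_{m-1}}$, $(E_{i,i}-E_{j,j})|_{\mathcal{C}_m}=x_{m,i}\partial_{x_{m,i}}-x_{m,j}\partial_{x_{m,j}}+(E_{i,i}-E_{j,j})|_{\mathcal{C}_{m-1}}$,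 $E_{i,m+1}|_{\mathcal{C}_m}=x_{m,i}\mathcal{D}_m+c_mx_{m,i}+\sum_{r=1}^mx_{m,r}E_{i,r}|_{\mathcal{C}_{m-1}}$, $E_{m+1,i}|_{\mathcal{C}_m}=-\partial_{x_{m,i}}$, $(E_{m,m}-E_{m+1,m+1})|_{\mathcal{C}_m}=\mathcal{D}_m+x_{m,m}\partial_{x_{m,m}}+c_m+E_{m,m}|_{\mathcal{C}_{m-1}}$. Put $V^{(1)}=\mathrm{Span}\{x_{1,1}^i\mid 0\le i\le k_n\}\subset\mathcal{C}_1$ and $V^{(m)}=U(\mathfrak{sl}(m+1))\,(1\otimes V^{(m-1)})\subset\mathcal{C}_m=\mathbb{C}[x_{m,1},\dots,x_{m,m}]\otimes\mathcal{C}_{m-1}$ for $2\le m\le n$. Then $V_n(\lambda)=\overline{M}=V^{(n)}\subset\mathcal{C}_n$, the irreducible $\mathfrak{sl}(n+1)$-module with highest weight $\lambda$. The sets $S_n(\lambda)$. Convention: $x_{i,j}$ is a variable if $1\le j\le i$, $x_{i,i+1}=-1$, and $x_{i,j}=0$ otherwise. For $1\le j\le i\le n$ and $\Theta=(\theta_1,\dots,\theta_{i-j+1})$, $d_{i,j}(\Theta)$ is the determinant of the matrix with rows $(x_{l,\theta_1},\dots,x_{l,\theta_{i-j+1}})$, $l=j,\dots,i$. Let $\mathbb{J}_{i,j}$ be the set of $\Theta=(\theta_1,\dots,\theta_{i-j+1})$ with all $\theta_r\in\{1,\dots,n\}$ and $d_{i,j}(\Theta)\ne 0$. Then $$S_n(\lambda)=\Big\{\prod_{1\le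 j\le i\le n}\prod_{\Theta\in\mathbb{J}_{i,j}}d_{i,j}(\Theta)^{\alpha_{i,j}(\Theta)}\ \Big|\ \alpha_{i,j}(\Theta)\in\mathbb{N};\ \sum_{i=j}^n\sum_{\Theta\in\mathbb{J}_{i,j}}\alpha_{i,j}(\Theta)\le k_{n-j+1}\text{ for }1\le j\le n\Big\},$$ and $(S_n(\lambda))_r$ is the subset of products with $\sum_{j=1}^n\sum_{\Theta\in\mathbb{J}_{n,j}}\alpha_{n,j}(\Theta)=r$. Lexicographic degree. For a monomial $X^\alpha=\prod_{1\le j\le i\le n}x_{i,j}^{\alpha_{i,j}}$, $\mathrm{lexdeg}(X^\alpha)=(\alpha_{1,1},\alpha_{2,1},\alpha_{2,2},\dots,\alpha_{n,1},\dots,\alpha_{n,n})$, and these are compared lexicographically: order indices by $(1,1)<(2,1)<(2,2)<\cdots<(n,1)<\cdots<(n,n)$; then $\mathrm{lexdeg}(X^\alpha)>\mathrm{lexdeg}(X^{\alpha'})$ if there is $(s,t)$ with $\alpha_{i,j}=\alpha'_{i,j}$ for all $(i,j)<(s,t)$ and $\alpha_{s,t}>\alpha'_{s,t}$. For a nonzero polynomial $f$, $\mathrm{lexdeg}(f)$ is the maximal lexdeg of a monomial appearing in $f$. Gelfand–Tsetlin patterns of shape $\lambda$: extend $\lambda$ to a $\mathfrak{gl}(n+1)$-weight $(\tau_{n+1,1},\dots,\tau_{n+1,n+1})$ with $\tau_{n+1,i}-\tau_{n+1,i+1}=k_i$; a pattern is a triangular array $(\tau_{i,j})_{1\le j\le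 i\le n+1}$ with this top row such that $\tau_{i+1,j}-\tau_{i,j}$ and $\tau_{i,j}-\tau_{i+1,j+1}$ are nonnegative integers for $1\le j\le i\le n$. The Gelfand–Tsetlin basis is indexed by these patterns. *)

(* Defs.v *)
From HB Require Import structures.
From mathcomp Require Import all_boot all_order all_algebra.
From mathcomp Require Import boolp classical_sets functions reals.
From mathcomp Require Import complex mpoly.

Set Implicit Arguments.
Unset Strict Implicit.
Unset Printing Implicit Defensive.

Import Order.TTheory GRing.Theory Num.Theory.

Local Open Scope classical_set_scope.
Local Open Scope ring_scope.

Section LinearAlgebra.
Context {K : fieldType} {V : lmodType K}.

Definition lin_span (S : set V) : set V :=
  [set f | exists (s : seq V) (c : V -> K),
     (forall u, u \in s -> S u) /\ f = \sum_(u <- s) c u *: u].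

Definition lin_indep (S : set V) : Prop :=
  forall (s : seq V) (c : V -> K), uniq s -> (forall u, u \in s -> S u) ->
    \sum_(u <- s) c u *: u = 0 -> forall u, u \in s -> c u = 0.

Definition is_basis (B W : set V) : Prop :=
  [/\ B `<=` W, lin_indep B & W `<=` lin_span B].

(* The set U(g) W, where the Lie algebra g is spanned by the operators in G:
   the linear span of all the words in G applied to elements of W. *)
Inductive submodule_gen (G : set (V -> V)) (W : set V) : V -> Prop :=
| SubmoduleIn f : W f -> submodule_gen G W f
| SubmoduleAct T f : G T -> submodule_gen G W f -> submodule_gen G W (T f)
| Submodule0 : submodule_gen G W 0
| SubmoduleD f g : submodule_gen G W f -> submodule_gen G W g ->
    submodule_gen G W (f + g)
| SubmoduleZ a f : submodule_gen G W f -> submodule_gen G W (a *: f).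

End LinearAlgebra.

(* The n(n+1)/2 variables x_{i,j}, 1 <= j <= i <= n, are numbered along
   (1,1) < (2,1) < (2,2) < ... < (n,1) < ... < (n,n), starting from 0.  Thus the
   exponent vector of a monomial, read as a tuple, is its lexdeg. *)
Definition nvars (n : nat) : nat := 'C(n.+1, 2).

Definition var_index (n i j : nat) : option 'I_(nvars n) :=
  if (1 <= j <= i)%N then insub ('C(i, 2) + j.-1)%N else None.

Lemma var_indexP (n i j : nat) : (1 <= j <= i)%N -> (i <= n)%N ->
  exists2 p : 'I_(nvars n), var_index n i j = Some p & p = ('C(i, 2) + j.-1)%N :> nat.
Proof.
move=> /[dup] hji /andP[j1 ji] lein.
have lt : ('C(i, 2) + j.-1 < nvars n)%N.
  apply: (@leq_trans 'C(i.+1, 2)); last by rewrite /nvars leq_bin2l.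
  by rewrite binS bin1 ltn_add2l; case: j j1 ji {hji}.
by exists (Ordinal lt); rewrite // /var_index hji insubT.
Qed.

Section Realization.
Context (R : realType) (n : nat).
(* Only the values k 1, ..., k n are used. *)
Variable k : nat -> nat.

Local Notation C := (R[i])%C.

(* The algebra C_n; for m <= n the algebra C_m is its subalgebra generated by
   the x_{i,j} with i <= m, and 1 (x) f is identified with f. *)
Local Notation P := {mpoly C[nvars n]}.

(* Includes the convention x_{i,i+1} = -1 and x_{i,j} = 0 for j = 0 or
   j > i + 1. *)
Definition xvar (i j : nat) : P :=
  if var_index n i j is Some p then 'X_p else if j == i.+1 then -1 else 0.

Definition dvar (i j : nat) (f : P) : P :=
  if var_index n i j is Some p then f^`M(p) else 0.

Definition euler (m : nat) (f : P) : P :=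
  \sum_(1 <= s < m.+1) xvar m s * dvar m s f.

Definition cst (m : nat) : C :=
  - (m.+1%:R)^-1 * (\sum_(0 <= i < m) (m - i) * k (n - m + 1 + i))%N%:R.

(* An action of sl(m+1): opE i j is the operator E_{i,j} (i <> j) and opH i j is
   the operator E_{i,i} - E_{j,j}, for 1 <= i, j <= m+1. *)
Record sl_action := SlAction {
  opE : nat -> nat -> P -> P;
  opH : nat -> nat -> P -> P }.

(* The gl(m)-module obtained from an sl(m)-module by letting the sum of the
   E_{i,i} act as cst m: E_{i,i} acts through
   m E_{i,i} = sum_l E_{l,l} + sum_l (E_{i,i} - E_{l,l}). *)
Definition gl_ext (m : nat) (A : sl_action) (i j : nat) (f : P) : P :=
  if i == j then (m%:R)^-1 *: (cst m *: f + \sum_(1 <= l < m.+1) opH A i l f)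
  else opE A i j f.

(* Linear extension to all the E_{i,i} - E_{j,j}, 1 <= i, j <= m+1, from those
   with i, j <= m and from Hlast = E_{m,m} - E_{m+1,m+1}. *)
Definition cartan_ext (m : nat) (H : nat -> nat -> P -> P) (Hlast : P -> P)
    (i j : nat) (f : P) : P :=
  match (i <= m)%N, (j <= m)%N with
  | true, true => H i j f
  | true, false => H i m f + Hlast f
  | false, true => - (H j m f + Hlast f)
  | false, false => 0
  end.

Definition sl_action1 : sl_action := {|
  opE := fun i j f =>
    if (i == 1%N) && (j == 2%N)
    then xvar 1 1 ^+ 2 * dvar 1 1 f - (k n)%:R *: (xvar 1 1 * f)
    else - dvar 1 1 f;
  opH := cartan_ext 1 (fun _ _ _ => 0)
    (fun f => 2%:R *: (xvar 1 1 * dvar 1 1 f) - (k n)%:R *: f) |}.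

(* From the sl(m)-action A on C_{m-1} to the sl(m+1)-action on C_m. *)
Definition sl_action_step (m : nat) (A : sl_action) : sl_action := {|
  opE := fun i j f =>
    if (i <= m)%N && (j <= m)%N then xvar m i * dvar m j f + opE A i j f
    else if (i <= m)%N then
      xvar m i * euler m f + cst m *: (xvar m i * f)
      + \sum_(1 <= r < m.+1) xvar m r * gl_ext m A i r f
    else - dvar m j f;
  opH := cartan_ext m
    (fun i j f => xvar m i * dvar m i f - xvar m j * dvar m j f + opH A i j f)
    (fun f => euler m f + xvar m m * dvar m m f + cst m *: f + gl_ext m A m m f) |}.

(* The action of sl(m+1) on C_m for 1 <= m <= n (the value at 0 is a dummy). *)
Fixpoint sl_act (m : nat) : sl_action :=
  match m with
  | 0 | 1 => sl_action1
  | m'.+1 => sl_action_step m (sl_act m')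
  end.

(* A spanning set of sl(m+1), acting on C_m. *)
Definition sl_ops (m : nat) : set (P -> P) :=
  [set T | exists i j : nat,
     [/\ (1 <= i <= m.+1)%N, (1 <= j <= m.+1)%N, i != j
       & T = opE (sl_act m) i j \/ T = opH (sl_act m) i j]].

(* V^(m) for 1 <= m <= n (the value at 0 is a dummy). *)
Fixpoint Vm (m : nat) : set P :=
  match m with
  | 0 | 1 => lin_span [set xvar 1 1 ^+ i | i in [set i | (i <= k n)%N]]
  | m'.+1 => submodule_gen (sl_ops m) (Vm m')
  end.

Definition Vn : set P := Vm n.

(* Theta has i - j + 1 entries; an entry t : 'I_n stands for theta = t + 1. *)
Definition dmin (i j : nat) (Theta : (i - j).+1.-tuple 'I_n) : P :=
  \det (\matrix_(a < (i - j).+1, b < (i - j).+1) xvar (j + a) (tnth Theta b).+1).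
Arguments dmin : clear implicits.

Definition JJ (i j : nat) : {pred (i - j).+1.-tuple 'I_n} :=
  [pred Theta | dmin i j Theta != 0].
Arguments JJ : clear implicits.

Definition exponents := forall i j : nat, (i - j).+1.-tuple 'I_n -> nat.

Definition Sprod (alpha : exponents) : P :=
  \prod_(1 <= i < n.+1) \prod_(1 <= j < i.+1) \prod_(Theta in JJ i j)
    dmin i j Theta ^+ alpha i j Theta.

Definition admissible (alpha : exponents) : Prop :=
  forall j, (1 <= j <= n)%N ->
    (\sum_(j <= i < n.+1) \sum_(Theta in JJ i j) alpha i j Theta
       <= k (n - j + 1))%N.

(* (S_n(lambda))_r; the set S_n(lambda) is the union over all r. *)
Definition Snr (r : nat) : set P :=
  [set u | exists alpha, [/\ admissible alpha,
     (\sum_(1 <= j < n.+1) \sum_(Theta in JJ n j) alpha n j Theta)%N = r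
     & u = Sprod alpha]].

(* The lexicographic order on tuples; lexdeg 0 is the zero tuple. *)
Definition lexdeg (f : P) : (nvars n).-tuplelexi nat :=
  \big[Order.max/Order.bottom]_(m <- msupp f) (multinom_val m : (nvars n).-tuplelexi nat).

Definition lexdeg_repr (S B : set P) : Prop :=
  B `<=` S /\ forall u, S u -> exists! v, B v /\ lexdeg u = lexdeg v.

Definition lambda_size : nat := (\sum_(1 <= i < n.+1) k i)%N.

(* t is the top row (tau_{n+1,1}, ..., tau_{n+1,n+1}), numbered from 0. *)
Definition gl_weight (t : 'I_n.+1 -> C) : Prop :=
  forall i : 'I_n, t (widen_ord (leqnSn n) i) - t (lift ord0 i) = (k i.+1)%:R.

(* A triangular array (tau_{i,j})_{1 <= j <= i <= n+1} is stored in a lower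
   triangular matrix; rows and columns are numbered from 0. *)
Definition gt_patterns (t : 'I_n.+1 -> C) : set 'M[C]_n.+1 :=
  [set T | [/\ is_trig_mx T, (forall j, T ord_max j = t j)
    & forall i j : 'I_n, (j <= i)%N ->
        let w := widen_ord (leqnSn n) in
        let s := lift ord0 in
        (exists a : nat, T (s i) (w j) - T (w i) (w j) = a%:R) /\
        (exists b : nat, T (w i) (w j) - T (s i) (s j) = b%:R)]].

End Realization.

(* Main.v *)
(* Consider a generic matrix with rows 0, ..., n and columns 1, ..., n + 1, and
   call invariant a polynomial in its entries which is killed by the operators
   adding to a row a multiple of a lower row, and which is homogeneous of degree
   k_n + ... + k_(n-l+1) in the row l.  Specializing the matrix to (x_{l,c})
   (with x_{l,l+1} = -1 and zeros to the right) sends an invariant g to an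
   element f of C_n, and the derivatives of g with respect to the specialized
   entries are determined by f and by the invariance: this recursion is the one
   defining the action of sl(n+1), so that column operations on g induce that
   action on f.

   Invariants and V_n: the specialization is injective on the invariants, and
   its image contains V_n.  For the Fock scalar product, the adjoint of the
   column operator E_{a,b} is E_{b,a}; thus the invariants orthogonal to the
   module generated by the preimage v of 1 form a module.  If it were nonzero its
   image would contain the constants, which is absurd as these come from the
   multiples of v.  Hence V_n is the image of the invariants.  Products of minors
   of the generic matrix are invariant, so S_n(lambda) is contained in V_n.

   Leading exponents: by sl_2-theory (that is, by positivity of the Fock scalar
   product), f in V_n is killed by the power k_(n-l+1) + 1 of
   D_l = sum_{c <= l} x_{l-1,c} d/dx_{l,c}.  This forces the leading exponent of
   f to satisfy the Gelfand-Tsetlin inequalities.  Conversely, an exponent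
   satisfying them is a tableau, and the product of the minors given by the
   columns of that tableau belongs to S_n(lambda) and has the given leading
   exponent.  Thus the leading exponents of V_n are those of S_n(lambda), and
   they correspond to the Gelfand-Tsetlin patterns. *)

From HB Require Import structures.
From mathcomp Require Import all_boot all_order all_algebra.
From mathcomp Require Import boolp classical_sets functions reals.
From mathcomp Require Import fingroup perm complex mpoly ring zify.
Require Import Defs.

Set Implicit Arguments.
Unset Strict Implicit.
Unset Printing Implicit Defensive.

Import Order.TTheory GRing.Theory Num.Theory.

Local Open Scope classical_set_scope.
Local Open Scope ring_scope.

(** * The Fock scalar product *)

Section Fock.
Context {K : numClosedFieldType} {N : nat}.
Local Notation P := {mpoly K[N]}.
Implicit Types (f g h : P) (m : 'X_{1..N}) (i j : 'I_N).

Definition mfact m : nat := \prod_(i < N) (m i)`!.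

Lemma mfact_gt0 m : (0 < mfact m)%N.
Proof. by apply: prodn_gt0 => i; apply: fact_gt0. Qed.

Lemma mfactU m i : mfact (m + U_(i))%MM = ((m i).+1 * mfact m)%N.
Proof.
rewrite /mfact (bigD1 i) //= [in RHS](bigD1 i) //= mulnA; congr (_ * _)%N.
  by rewrite mnmDE mnm1E eqxx addn1 factS.
apply: eq_bigr => j ji; rewrite mnmDE mnm1E.
by rewrite eq_sym (negbTE ji) addn0.
Qed.

(** Monomials are orthogonal, and ['X_[m]] has squared norm [mfact m]. The terms outside [msupp g]
    vanish; a range of summation that does not involve [f] makes linearity in [f] immediate. *)
Definition fock f g : K :=
  \sum_(m <- msupp g) f@_m * (g@_m)^* * (mfact m)%:R.

Lemma fockDl f1 f2 g : fock (f1 + f2) g = fock f1 g + fock f2 g.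
Proof.
by rewrite /fock -big_split; apply: eq_bigr => m _; rewrite mcoeffD !mulrDl.
Qed.

Lemma fockZl a f g : fock (a *: f) g = a * fock f g.
Proof.
by rewrite /fock mulr_sumr; apply: eq_bigr => m _; rewrite mcoeffZ !mulrA.
Qed.

Lemma fock0l g : fock 0 g = 0.
Proof. by rewrite -(scale0r 0) fockZl mul0r. Qed.

Lemma fockBl f1 f2 g : fock (f1 - f2) g = fock f1 g - fock f2 g.
Proof. by rewrite -scaleN1r fockDl fockZl mulN1r. Qed.

Lemma fock_suml (I : Type) (r : seq I) (A : pred I) (F : I -> P) g :
  fock (\sum_(x <- r | A x) F x) g = \sum_(x <- r | A x) fock (F x) g.
Proof. by apply: (big_morph (fock^~ g)) => [x y|]; rewrite (fockDl, fock0l). Qed.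

Lemma fockXl m g : fock 'X_[m] g = (g@_m)^* * (mfact m)%:R.
Proof.
rewrite /fock; case: (boolP (m \in msupp g)) => mg.
  rewrite (bigD1_seq m) ?msupp_uniq //= mcoeffX eqxx mul1r big1 ?addr0 // => k.
  by rewrite mcoeffX eq_sym => /negbTE ->; rewrite !mul0r.
rewrite (memN_msupp_eq0 mg) conjC0 mul0r big_seq big1 // => k kg.
rewrite mcoeffX; case: eqP => [mk|_]; last by rewrite !mul0r.
by rewrite mk kg in mg.
Qed.

Lemma fock_conj f g : fock g f = (fock f g)^*.
Proof.
rewrite {2}[f]mpolyE fock_suml rmorph_sum; apply: eq_bigr => m _ /=.
rewrite fockZl fockXl !rmorphM /= conjCK conjC_nat.
by rewrite mulrCA mulrA.
Qed.

Lemma fockDr f g1 g2 : fock f (g1 + g2) = fock f g1 + fock f g2.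
Proof. by rewrite ![fock f _]fock_conj fockDl rmorphD. Qed.

Lemma fockZr a f g : fock f (a *: g) = a^* * fock f g.
Proof. by rewrite ![fock f _]fock_conj fockZl rmorphM. Qed.

Lemma fockBr f g1 g2 : fock f (g1 - g2) = fock f g1 - fock f g2.
Proof. by rewrite ![fock f _]fock_conj fockBl rmorphB. Qed.

Lemma fock0r f : fock f 0 = 0.
Proof. by rewrite fock_conj fock0l conjC0. Qed.

Lemma fock_sumr (I : Type) (r : seq I) (A : pred I) (F : I -> P) f :
  fock f (\sum_(x <- r | A x) F x) = \sum_(x <- r | A x) fock f (F x).
Proof. by apply: (big_morph (fock f)) => [x y|]; rewrite (fockDr, fock0r). Qed.

(** On monomials, the factor gained by [mfact] when the exponent of ['X_i] grows by one is the
    factor produced by the derivation. *)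
Lemma fock_adj i f g : fock ('X_i * f) g = fock f g^`M(i).
Proof.
rewrite [f]mpolyE mulr_sumr !fock_suml; apply: eq_bigr => m _.
rewrite -scalerAr !fockZl -mpolyXD addmC !fockXl mcoeff_deriv mfactU.
by rewrite rmorphMn /= natrM; congr (_ * _); rewrite mulrA; congr (_ * _); rewrite mulr_natr.
Qed.

Lemma fock_adjr i f g : fock f^`M(i) g = fock f ('X_i * g).
Proof. by rewrite fock_conj -fock_adj -fock_conj. Qed.

Lemma fock_eq0 f : fock f f = 0 -> f = 0.
Proof.
have ge0 m : 0 <= f@_m * (f@_m)^* * (mfact m)%:R.
  by rewrite mulr_ge0 ?ler0n // mul_conjC_ge0.
move=> /eqP; rewrite /fock psumr_eq0 // => /allP f0; apply/mpolyP => m; rewrite mcoeff0.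
case: (boolP (m \in msupp f)) => [mf|/memN_msupp_eq0 //].
have := f0 _ mf; rewrite mulf_eq0 mul_conjC_eq0 pnatr_eq0.
by rewrite (gtn_eqF (mfact_gt0 m)) orbF => /eqP.
Qed.

(* By induction on the list of the monomials occurring in A. *)
Lemma fock_proj (A : P -> Prop) (s : seq 'X_{1..N}) :
  A 0 -> (forall f g, A f -> A g -> A (f + g)) ->
  (forall a f, A f -> A (a *: f)) ->
  (forall f, A f -> {subset msupp f <= s}) ->
  forall g, exists2 f, A f & forall h, A h -> fock h (g - f) = 0.
Proof.
elim: s A => [|m s IHs] A A0 AD AZ As g.
  exists 0 => // h /As h0; have -> : h = 0; last by rewrite fock0l.
  by apply/mpolyP => m; rewrite mcoeff0 memN_msupp_eq0 //; apply/negP => /h0.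
pose A' f := A f /\ f@_m = 0.
have A'A f : A' f -> A f by case.
have proj g' : exists2 f, A' f & forall h, A' h -> fock h (g' - f) = 0.
  apply: (IHs A'); first by split; rewrite ?mcoeff0.
  - by move=> f h [? fm] [? hm]; split; [apply: AD | rewrite mcoeffD fm hm addr0].
  - by move=> a f [? fm]; split; [apply: AZ | rewrite mcoeffZ fm mulr0].
  - move=> f [/As fs fm] k kf; move: (fs _ kf); rewrite inE => /predU1P[km|//].
    by move: kf; rewrite mcoeff_msupp km fm eqxx.
case: (pselect (exists2 f1, A f1 & f1@_m <> 0)) => [[f1 Af1 f1m]|no]; last first.
  have [f [Af _] f_orth] := proj g; exists f => // h Ah; apply: f_orth; split=> //.
  by apply: contrapT => hm; apply: no; exists h.
(* A Gram-Schmidt step: [e] is orthogonal to [A'], and [A] is the sum of [A'] and the line spanned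
   by [e], so that the projection on [A] is the sum of two projections. *)
have [f0 A'f0 f0_orth] := proj f1; pose e := f1 - f0.
have Ae : A e by apply: AD => //; rewrite -scaleN1r; apply/AZ/A'A.
have em : e@_m = f1@_m by rewrite mcoeffB A'f0.2 subr0.
have e_neq0 : fock e e != 0.
  by apply/eqP => /fock_eq0 e0; apply: f1m; rewrite -em e0 mcoeff0.
have [a0 A'a0 a0_orth] := proj g; pose c := (fock (g - a0) e) / fock e e.
exists (a0 + c *: e) => [|h Ah]; first exact/AD/AZ/Ae/A'A.
have -> : g - (a0 + c *: e) = (g - a0) - c *: e by rewrite opprD addrA.
pose b := h@_m / f1@_m.
have A'h : A' (h - b *: e).
  split; first by apply: AD => //; rewrite -scaleN1r; apply/AZ/AZ.
  by rewrite mcoeffB mcoeffZ em mulfVK ?subrr //; apply/eqP.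
have -> : h = (h - b *: e) + b *: e by rewrite subrK.
have orth k : A' k -> fock k (g - a0 - c *: e) = 0.
  by move=> A'k; rewrite fockBr fockZr a0_orth // f0_orth // mulr0 subr0.
rewrite fockDl fockZl orth // add0r fock_conj fockBl fockZl mulfVK //.
by rewrite subrr conjC0 mulr0.
Qed.

End Fock.

(** * Derivations of polynomial rings *)

Section Derivations.
Context {K : numFieldType}.

Lemma mpoly_ring_ind (N : nat) (Q : {mpoly K[N]} -> Prop) :
  (forall c, Q c%:MP) -> (forall i, Q 'X_i) ->
  (forall f g, Q f -> Q g -> Q (f + g)) ->
  (forall f g, Q f -> Q g -> Q (f * g)) -> forall f, Q f.
Proof.
move=> QC QX QD QM; apply: mpolyind => [|c m f _ _ Qf]; first by rewrite -mpolyC0.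
apply: QD => //; rewrite -mul_mpolyC; apply: (QM) => //.
rewrite mpolyXE_id; apply: big_rec => [|i g _ Qg]; first by rewrite -mpolyC1.
apply: (QM) => //; elim: (m i) => [|k IH]; first by rewrite expr0 -mpolyC1.
by rewrite exprS; apply: (QM).
Qed.

Lemma mderiv_eq0_const (N : nat) (f : {mpoly K[N]}) :
  (forall i, f^`M(i) = 0) -> f = (f@_0%MM)%:MP.
Proof.
move=> df; apply/mpolyP => m; rewrite mcoeffC.
case: (eqVneq 0%MM m) => [<-|m0]; first by rewrite mulr1.
rewrite mulr0.
have [i mi] : exists i, m i != 0%N.
  apply/existsP; apply: contra_neqT m0 => /existsPn mi0; apply/esym.
  by apply/mnmP => i; rewrite mnm0E; apply/eqP; rewrite -[_ == _]negbK.
have := congr1 (mcoeff (m - U_(i))%MM) (df i).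
rewrite mcoeff_deriv mcoeff0 submK ?lep1mP // => /eqP.
by rewrite mulrn_eq0 /= => /eqP.
Qed.

Lemma msize_mderiv (N : nat) (f : {mpoly K[N]}) i :
  f != 0 -> (msize f^`M(i) < msize f)%N.
Proof.
move=> f0; have [-> | d0] := eqVneq f^`M(i) 0.
  by rewrite msize0 lt0n msize_poly_eq0.
rewrite -(mlead_deg d0).
have : mlead f^`M(i) \in msupp f^`M(i) by apply: mlead_supp.
rewrite !mcoeff_msupp mcoeff_deriv mulrn_eq0 /= -mcoeff_msupp => /msize_mdeg_lt.
by rewrite mdegD mdeg1 addn1.
Qed.

(** As functions of [f], both sides are derivations along [phi], so it is enough to compare them on
    the variables. *)
Lemma mderiv_morph (N N' : nat) (phi : {mpoly K[N]} -> {mpoly K[N']}) i j :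
  (forall c, phi c%:MP = c%:MP) -> {morph phi : f g / f + g} ->
  {morph phi : f g / f * g} ->
  (forall l, (phi 'X_l)^`M(j) = (l == i)%:R) ->
  forall f, (phi f)^`M(j) = phi f^`M(i).
Proof.
move=> phiC phiD phiM phiX; apply: mpoly_ring_ind => [c|l|f g IHf IHg|f g IHf IHg].
- by rewrite phiC !mderivC -mpolyC0 phiC.
- rewrite phiX mderivX mnm1E; case: eqVneq => [->|_].
    have -> : (U_(i) - U_(i))%MM = 0%MM.
      by apply/mnmP => k; rewrite mnmBE subnn mnm0E.
    by rewrite scale1r mpolyX0 -mpolyC1 phiC.
  by rewrite scale0r -mpolyC0 phiC.
- by rewrite !(mderivD, phiD) IHf IHg.
- by rewrite !(mderivM, phiM, phiD) IHf IHg.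
Qed.

End Derivations.

(** * Nilpotency of polarization operators *)

Section Supports.
Context {K : numFieldType} {N : nat}.
Local Notation P := {mpoly K[N]}.
Implicit Types (f g h : P) (m : 'X_{1..N}) (i j : 'I_N).

Lemma iter_comm1 (T : Type) (F G : T -> T) : (forall x, F (G x) = G (F x)) ->
  forall n x, F (iter n G x) = iter n G (F x).
Proof. by move=> FG; elim=> //= n IH x; rewrite FG IH. Qed.

Lemma iter_comm (T : Type) (F G : T -> T) : (forall x, F (G x) = G (F x)) ->
  forall a b x, iter a F (iter b G x) = iter b G (iter a F x).
Proof. by move=> FG; elim=> //= a IH b x; rewrite IH iter_comm1. Qed.

Lemma iter_fix (T : Type) (F : T -> T) x : F x = x -> forall n, iter n F x = x.
Proof. by move=> Fx; elim=> //= n ->. Qed.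

Lemma mpoly_mulrn_eq0 f a : (0 < a)%N -> f *+ a = 0 -> f = 0.
Proof.
move=> a_gt0 /eqP; rewrite -scaler_nat mscalerI pnatr_eq0 (gtn_eqF a_gt0).
by move/eqP.
Qed.

Lemma msupp_iter_mderiv f m j a : m \in msupp f -> (a <= m j)%N ->
  (m - U_(j) *+ a)%MM \in msupp (iter a (mderiv j) f).
Proof.
move=> mf; elim: a => [|a IH] am; first by rewrite mulm0n subm0.
have {IH} := IH (ltnW am); rewrite !mcoeff_msupp /= mcoeff_deriv.
rewrite mulrn_eq0 /=; congr (_ @_ _ != 0).
apply/mnmP => i; rewrite !(mnmDE, mnmBE, mulmnE, mnm1E).
by case: eqP => [<-|_]; rewrite ?mul1n ?mul0n ?subn0 ?addn0 //= addn1 subnSK.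
Qed.

(** In characteristic zero an iterated derivation kills only the monomials whose exponent is too
    small. Nilpotency is thereby translated into bounds on exponents, and back. *)
Lemma iter_mderiv_eq0 f j a :
  reflect (forall m, m \in msupp f -> (m j < a)%N) (iter a (mderiv j) f == 0).
Proof.
apply: (iffP eqP) => [f0 m mf|].
  rewrite ltnNge; apply/negP => /(msupp_iter_mderiv mf).
  by rewrite f0 msupp0.
elim: a f => [|a IH] f fa.
  by apply/eqP; rewrite -msupp_eq0; case: (msupp f) fa => // m s /(_ m (mem_head _ _)).
rewrite iterSr; apply: IH => m; rewrite mcoeff_msupp mcoeff_deriv mulrn_eq0 /=.
by rewrite -mcoeff_msupp => /fa; rewrite mnmDE mnm1E eqxx addn1.
Qed.

Definition restr (A : pred 'X_{1..N}) f : P :=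
  \sum_(m <- msupp f | A m) f@_m *: 'X_[m].

Lemma mcoeff_restr A f m : (restr A f)@_m = if A m then f@_m else 0.
Proof.
rewrite /restr raddf_sum /= -big_filter.
have [mA|mA] := boolP (m \in [seq k <- msupp f | A k]).
  rewrite (bigD1_seq m) ?filter_uniq ?msupp_uniq //= mcoeffZ mcoeffX eqxx mulr1.
  rewrite big1 ?addr0 => [|k km]; last by rewrite mcoeffZ mcoeffX (negbTE km) mulr0.
  by move: mA; rewrite mem_filter => /andP[->].
rewrite big_seq big1 => [|k kA]; last first.
  rewrite mcoeffZ mcoeffX; case: eqP => [km|_]; last by rewrite mulr0.
  by rewrite -km kA in mA.
move: mA; rewrite mem_filter; case: (A m) => //=.
by move/memN_msupp_eq0.
Qed.

Lemma mem_msupp_restr A f m : (m \in msupp (restr A f)) = A m && (m \in msupp f).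
Proof. by rewrite !mcoeff_msupp mcoeff_restr; case: (A m); rewrite ?eqxx. Qed.

Lemma eq_restr A B f : A =1 B -> restr A f = restr B f.
Proof. by move=> AB; apply: eq_bigl. Qed.

Lemma restr_restr A B f : restr A (restr B f) = restr (predI A B) f.
Proof. by apply/mpolyP => m; rewrite !mcoeff_restr /=; case: (A m). Qed.

Lemma restrD A f g : restr A (f + g) = restr A f + restr A g.
Proof.
apply/mpolyP => m; rewrite !(mcoeffD, mcoeff_restr).
by case: (A m); rewrite ?addr0.
Qed.

Lemma restr0 A : restr A 0 = 0.
Proof. by rewrite /restr msupp0 big_nil. Qed.

Lemma restrN A f : restr A (- f) = - restr A f.
Proof.
apply/mpolyP => m; rewrite !(mcoeffN, mcoeff_restr).
by case: (A m); rewrite ?oppr0.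
Qed.

Lemma restr_sum (I : Type) (r : seq I) (Q : pred I) (F : I -> P) A :
  restr A (\sum_(x <- r | Q x) F x) = \sum_(x <- r | Q x) restr A (F x).
Proof. by apply: (big_morph (restr A)) => [x y|]; rewrite (restrD, restr0). Qed.

Lemma restr_mderiv A j f : (forall m, A (m + U_(j))%MM = A m) ->
  restr A f^`M(j) = (restr A f)^`M(j).
Proof.
move=> Aj; apply/mpolyP => m; rewrite !(mcoeff_deriv, mcoeff_restr) Aj.
by case: (A m); rewrite ?mul0rn.
Qed.

Lemma restr_mulX A j f : (forall m, A (m + U_(j))%MM = A m) ->
  restr A ('X_j * f) = 'X_j * restr A f.
Proof.
move=> Aj; rewrite {1}[f]mpolyE mulr_sumr restr_sum /restr big_mkcond mulr_sumr.
rewrite [RHS]big_mkcond /=; apply: eq_bigr => m _.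
rewrite -scalerAr -mpolyXD addmC; apply/mpolyP => k.
rewrite -/(restr _ _) mcoeff_restr !(mcoeffZ, mcoeffX).
case: (eqVneq (m + U_(j))%MM k) => [<-|mk].
  by rewrite Aj; case: (A m); rewrite ?mcoeff0 // mcoeffZ mcoeffX eqxx.
rewrite mulr0 if_same; case: (A m); rewrite ?mcoeff0 //.
by rewrite mcoeffZ mcoeffX (negbTE mk) mulr0.
Qed.

End Supports.

(** * Operators ['X_i] d_j + [Y] with [Y] commuting with ['X_i], d_i and d_j *)

Section KeyLemma.
Context {K : numFieldType} {N : nat}.
Local Notation P := {mpoly K[N]}.
Variables (i j : 'I_N) (Y : P -> P).
Hypothesis ij : i != j.
Hypothesis YD : {morph Y : f g / f + g}.
Hypothesis YX : forall f, Y ('X_i * f) = 'X_i * Y f.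
Hypothesis Yi : forall f, Y f^`M(i) = (Y f)^`M(i).
Hypothesis Yj : forall f, Y f^`M(j) = (Y f)^`M(j).
Implicit Types f g h : P.

Let D f := 'X_i * f^`M(j) + Y f.
Local Notation di := (mderiv i).
Local Notation dj := (mderiv j).

Let mderivXii : ('X_i : P)^`M(i) = 1.
Proof.
rewrite mderivX mnm1E eqxx scale1r.
have -> : (U_(i) - U_(i))%MM = 0%MM by apply/mnmP => k; rewrite mnmBE subnn mnm0E.
by rewrite mpolyX0.
Qed.

Let mderivXij : ('X_i : P)^`M(j) = 0.
Proof. by rewrite mderivX mnm1E (negbTE ij) scale0r. Qed.

Let Y0 : Y 0 = 0.
Proof. by apply: (addIr (Y 0)); rewrite -YD !add0r. Qed.

Let YMn f n : Y (f *+ n) = Y f *+ n.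
Proof. by elim: n => [|n IH]; rewrite ?mulr0n // !mulrS YD IH. Qed.

Let Y_sum (I : Type) (r : seq I) (Q : pred I) (F : I -> P) :
  Y (\sum_(x <- r | Q x) F x) = \sum_(x <- r | Q x) Y (F x).
Proof. by apply: big_morph => //; apply: YD. Qed.

Let DD f g : D (f + g) = D f + D g.
Proof. by rewrite /D mderivD mulrDr YD addrACA. Qed.

Let DMn f n : D (f *+ n) = D f *+ n.
Proof. by rewrite /D mderivMn YMn mulrnDl mulrnAr. Qed.

Let Dj f : D f^`M(j) = (D f)^`M(j).
Proof. by rewrite /D mderivD mderivM mderivXij mul0r add0r Yj. Qed.

Let DY f : D (Y f) = Y (D f).
Proof. by rewrite /D YD YX Yj. Qed.

Let mderiv_iter0 (l : 'I_N) n : iter n (mderiv l) (0 : P) = 0.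
Proof. by elim: n => //= n ->; rewrite mderiv0. Qed.

Let iter_diD M f g : iter M di (f + g) = iter M di f + iter M di g.
Proof. by elim: M => //= M ->; rewrite mderivD. Qed.

Let di_dj f : (f^`M(j))^`M(i) = (f^`M(i))^`M(j).
Proof. exact: mderiv_comm. Qed.

Let diD f : (D f)^`M(i) = D f^`M(i) + f^`M(j).
Proof. by rewrite /D mderivD mderivM mderivXii mul1r di_dj Yi -addrA addrC. Qed.

Let iter_di_D M f :
  iter M.+1 di (D f) = D (iter M.+1 di f) + (iter M di f)^`M(j) *+ M.+1.
Proof.
elim: M f => [|M IH] f; first by rewrite /= diD mulr1n.
rewrite iterSr diD iter_diD IH -!iterSr [X in _ + X](esym (iter_comm1 (fun x => esym (di_dj x)) _ _)).
by rewrite -addrA -mulrSr.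
Qed.

Let di_iter_D M f :
  (iter M.+1 D f)^`M(i) = iter M.+1 D f^`M(i) + (iter M D f)^`M(j) *+ M.+1.
Proof.
elim: M => [|M IH]; first by rewrite /= diD mulr1n.
by rewrite iterS diD IH DD DMn Dj -addrA -mulrSr.
Qed.

(** Multiplication by ['X_i], [dj] and [Y] commute pairwise, so this is the binomial formula. *)
Let iter_D n h : iter n D h =
  \sum_(s < n.+1) ('X_i ^+ s * iter s dj (iter (n - s) Y h)) *+ 'C(n, s).
Proof.
elim: n => [|n IH]; first by rewrite big_ord1 /= mul1r mulr1n.
rewrite iterS IH /D raddf_sum mulr_sumr Y_sum /=.
have YXn s f : Y ('X_i ^+ s * f) = 'X_i ^+ s * Y f.
  by elim: s f => [|s IHs] f; rewrite ?mul1r // exprSr -!mulrA IHs YX.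
have djXn s f : ('X_i ^+ s * f)^`M(j) = 'X_i ^+ s * f^`M(j).
  elim: s f => [|s IHs] f; rewrite ?mul1r // exprSr -!mulrA IHs.
  by rewrite mderivM mderivXij mul0r add0r.
have YjY f : Y (dj f) = dj (Y f) by apply: Yj.
rewrite [RHS]big_ord_recl bin0 mulr1n expr0 mul1r subn0.
under [in RHS]eq_bigr => s _ do rewrite lift0 binS mulrnDr subSS.
rewrite big_split addrA [RHS]addrC; congr (_ + _).
  apply: eq_bigr => s _; rewrite mderivMn djXn mulrnAr mulrA -exprS //.
under eq_bigr => s _ do rewrite YMn YXn (iter_comm1 YjY) -iterS.
rewrite [LHS]big_ord_recl bin0 mulr1n mul1r subn0; congr (_ + _).
rewrite [RHS]big_ord_recr /= bin_small // mulr0n addr0.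
apply: eq_bigr => s _; rewrite /= /bump /= add1n -!iterS.
by rewrite subnSK // ltn_ord.
Qed.

Let indep (n : nat) (g : nat -> P) : (forall s, (g s)^`M(i) = 0) ->
  \sum_(s < n) 'X_i ^+ s * g s = 0 -> forall s, (s < n)%N -> g s = 0.
Proof.
elim: n g => [//|n IH] g dg sum0.
(* As the [g s] are free of ['X_i], these are the coefficients of the derivative of the sum with
   respect to ['X_i]. *)
pose g' (s : nat) : P := g s.+1 *+ s.+1.
have dg' s : (g' s)^`M(i) = 0 by rewrite mderivMn dg mul0rn.
have sum' : \sum_(s < n) 'X_i ^+ s * g' s = 0.
  transitivity (\sum_(s < n.+1) 'X_i ^+ s * g s)^`M(i); last by rewrite sum0 mderiv0.
  rewrite raddf_sum big_ord_recl /= expr0 mul1r dg add0r.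
  apply: eq_bigr => t _; rewrite /bump /= add1n.
  rewrite mderivM dg mulr0 addr0 mulrnAr -mulrnAl; congr (_ * _).
  elim: (nat_of_ord t) => [|m IHm]; first by rewrite expr1 mderivXii expr0.
  by rewrite [in RHS]exprS mderivM mderivXii mul1r -IHm mulrnAr -exprS -mulrS.
have g1 s : (s < n)%N -> g s.+1 = 0.
  by move=> sn; apply: (mpoly_mulrn_eq0 (ltn0Sn s)); apply: (IH g').
case=> [|s] sn; last exact: g1.
move: sum0; rewrite big_ord_recl /= mul1r big1 ?addr0 // => t _.
by rewrite /bump /= add1n g1 ?mulr0.
Qed.

Let polar_step n a h : iter n D h = 0 ->
  (forall b c, (b + c = n + a)%N -> (iter b dj (iter c Y h))^`M(i) = 0) ->
  forall b c, (b + c = n + a)%N -> iter b dj (iter c Y h) = 0.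
Proof.
have YjY f : dj (Y f) = Y (dj f) by rewrite Yj.
have Dj' f : D (dj f) = dj (D f) by rewrite Dj.
(* Of the [b] derivations [dj], [b0 <= a] are applied beforehand together with [a - b0] factors [Y];
   the other [s0 <= n] accompany the power [s0] of ['X_i] in the expansion of [iter n D h0]. *)
move=> Dh d0 b c bc; pose s0 := minn b n; pose b0 := (b - s0)%N.
pose h0 := iter b0 dj (iter (a - b0) Y h).
have Dh0 : iter n D h0 = 0.
  rewrite (iter_comm Dj') (iter_comm DY) Dh.
  by rewrite (iter_fix (x := 0 : P)) // mderiv_iter0.
have := iter_D n h0; rewrite Dh0 => /esym sum0.
pose g (s : nat) : P := iter s dj (iter (n - s) Y h0) *+ 'C(n, s).
have gE s : (s <= n)%N ->
    g s = iter (s + b0) dj (iter (n - s + (a - b0)) Y h) *+ 'C(n, s).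
  by move=> sn; rewrite /g /h0 -(iter_comm YjY) -!iterD.
have dg s : (g s)^`M(i) = 0.
  case: (leqP s n) => sn; last by rewrite /g bin_small // mulr0n mderiv0.
  by rewrite gE // mderivMn d0 ?mul0rn //; lia.
have sum' : \sum_(s < n.+1) 'X_i ^+ s * g s = 0.
  by rewrite -[RHS]sum0; apply: eq_bigr => s _; rewrite mulrnAr.
have s0n : (s0 < n.+1)%N by lia.
have := indep dg sum' s0n; rewrite gE; last by lia.
have s0_bin : (0 < 'C(n, s0))%N by rewrite bin_gt0.
move/(mpoly_mulrn_eq0 s0_bin).
have -> : (s0 + b0 = b)%N by lia.
by have -> : (n - s0 + (a - b0) = c)%N by lia.
Qed.

(* Derivation with respect to X_i lowers the degree a in X_i, and turns D^n h = 0
   into D^(n+1) (d_i h) = 0 as [d_i, D] = d_j.  Once all the polynomials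
   d_j^b Y^c h with b + c = n + a are known to be free of X_i, they are the
   coefficients of the powers of X_i in the expansions of
   d_j^b' Y^c' D^n h = 0, for b' + c' = a. *)
Lemma polar_nilpotent n a h : iter n D h = 0 -> iter a.+1 di h = 0 ->
  forall b c, (b + c = n + a)%N -> iter b dj (iter c Y h) = 0.
Proof.
have YiY f : di (Y f) = Y (di f) by rewrite Yi.
have YjY f : dj (Y f) = Y (dj f) by rewrite Yj.
have Yn0 c : iter c Y 0 = 0 by apply: iter_fix.
have Dj' f : D (dj f) = dj (D f) by rewrite Dj.
elim: a n h => [|a IH] n h Dh dh.
  have d0 b c : (iter b dj (iter c Y h))^`M(i) = 0.
    by rewrite (iter_comm1 di_dj) (iter_comm1 YiY) -[_^`M(i)]/(iter 1 di h) dh Yn0 mderiv_iter0.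
  by apply: (polar_step Dh) => b c _; apply: d0.
apply: (polar_step Dh) => b c bc.
rewrite (iter_comm1 di_dj) (iter_comm1 YiY).
apply: (IH n.+1); [|by rewrite -iterSr | by rewrite bc addSnnS].
have := di_iter_D n h; rewrite iterS Dh.
rewrite mderiv0 mul0rn addr0 => <-.
by rewrite /D !mderiv0 mulr0 add0r Y0 mderiv0.
Qed.

(** Since [d_i, D] = d_j, moving d_i across D leaves a d_j. As [h] has degree at most [a] in ['X_i],
    applying d_i [a + n] times to D^n [h] leaves only the terms in which every D has been turned
    into a d_j, with a positive coefficient. *)
Lemma polar_top n a h : iter n D h = 0 -> iter a.+1 di h = 0 ->
  iter n dj (iter a di h) = 0.
Proof.
move=> Dh dh.
have [c c_gt0] : exists2 c, (0 < c)%N &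
    iter (a + n) di (iter n D h) = iter n dj (iter a di h) *+ c.
  elim: n a h {Dh} dh => [|n IH] a h dh; first by exists 1%N; rewrite ?addn0.
  have dDh : iter a.+2 di (D h) = 0.
    by rewrite iter_di_D iterS dh !mderiv0 mul0rn addr0 /D mderiv0 mulr0 Y0 addr0.
  have [c c_gt0 Ec] := IH a.+1 (D h) dDh.
  exists (a.+1 * c)%N; first by rewrite muln_gt0.
  rewrite iterSr addnS -addSn Ec iter_di_D dh {1}/D mderiv0 mulr0 Y0 add0r add0r.
  have iter_djMn f m q : iter q dj (f *+ m) = iter q dj f *+ m.
    by elim: q => //= q ->; rewrite mderivMn.
  by rewrite iter_djMn -iterSr mulrnA.
by rewrite Dh mderiv_iter0 => /esym/(mpoly_mulrn_eq0 c_gt0).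
Qed.

End KeyLemma.

(** * Leading exponents in two consecutive rows *)

(** The lexicographic order, in a form that yields bounds one coordinate at a time; [lex_leP]
    identifies it with the order on tuples. *)
Definition lex_le (N : nat) (m m' : 'X_{1..N}) : Prop :=
  forall p : 'I_N, (forall q : 'I_N, (q < p)%N -> m q = m' q) -> (m p <= m' p)%N.

Definition is_lead (K : numFieldType) (N : nat) (m : 'X_{1..N})
    (f : {mpoly K[N]}) : Prop :=
  m \in msupp f /\ forall m', m' \in msupp f -> lex_le m' m.

Section TwoRows.
Context {K : numFieldType} {N : nat}.
Local Notation P := {mpoly K[N]}.
Variables (base l : nat) (t y : nat -> 'I_N).
Hypothesis tE : forall c, (c < l)%N -> t c = (base + c)%N :> nat.
Hypothesis yE : forall c, (c <= l)%N -> y c = (base + l + c)%N :> nat.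
Implicit Types (f g h : P) (m : 'X_{1..N}).

(** With [t] the variables of a row and [y] those of the next one, [row_op 0] adds multiples of the
    first row to the second; the last term comes from the conventional entry -1. For [i > 0] the
    first [i] columns are dropped. *)
Definition row_op (i : nat) f : P :=
  \sum_(i <= c < l) 'X_(t c) * f^`M(y c) - f^`M(y l).

Lemma row_opD i : {morph row_op i : f g / f + g}.
Proof.
move=> f g; rewrite /row_op mderivD opprD addrACA -big_split.
by congr (_ + _); apply: eq_bigr => c _; rewrite mderivD mulrDr.
Qed.

Lemma row_opE i f : (i < l)%N ->
  row_op i f = 'X_(t i) * f^`M(y i) + row_op i.+1 f.
Proof. by move=> il; rewrite /row_op big_ltn // addrA. Qed.

Lemma mderivXn (i j : 'I_N) : i != j -> ('X_i : P)^`M(j) = 0.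
Proof. by move=> ij; rewrite mderivX mnm1E (negbTE ij) scale0r. Qed.

Lemma row_op_mulX i (p : 'I_N) f : (i <= l)%N ->
  (forall c, (i <= c <= l)%N -> p != y c) ->
  row_op i ('X_p * f) = 'X_p * row_op i f.
Proof.
move=> il py; have E c : (i <= c <= l)%N -> ('X_p * f)^`M(y c) = 'X_p * f^`M(y c).
  by move=> icl; rewrite mderivM (mderivXn (py _ icl)) mul0r add0r.
rewrite /row_op mulrBr mulr_sumr E ?il ?leqnn //; congr (_ - _).
rewrite !big_seq; apply: eq_bigr => c; rewrite mem_index_iota => /andP[ic cl].
by rewrite E; [exact: mulrCA | rewrite ic ltnW].
Qed.

Lemma row_op_mderiv i (p : 'I_N) f : (forall c, (i <= c < l)%N -> p != t c) ->
  row_op i f^`M(p) = (row_op i f)^`M(p).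
Proof.
move=> pt; rewrite /row_op mderivD mderivN [X in _ = _ - X]mderiv_comm.
congr (_ + _); rewrite raddf_sum !big_seq; apply: eq_bigr => c.
rewrite mem_index_iota => ic; have tp : t c != p by rewrite eq_sym pt.
by rewrite /= mderivM (mderivXn tp) mul0r add0r mderiv_comm.
Qed.

Lemma restr_row_op (A : pred 'X_{1..N}) i f : (i <= l)%N ->
  (forall c m, (i <= c < l)%N -> A (m + U_(t c))%MM = A m) ->
  (forall c m, (i <= c <= l)%N -> A (m + U_(y c))%MM = A m) ->
  restr A (row_op i f) = row_op i (restr A f).
Proof.
move=> il At Ay; rewrite /row_op restrD restrN restr_sum; congr (_ - _).
  rewrite !big_seq; apply: eq_bigr => c; rewrite mem_index_iota => ic.
  have Atc m : A (m + U_(t c))%MM = A m by apply: At.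
  have Ayc m : A (m + U_(y c))%MM = A m by apply: Ay; case/andP: ic => -> /ltnW ->.
  by rewrite restr_mulX // restr_mderiv.
by rewrite restr_mderiv // => m; apply: Ay; rewrite il leqnn.
Qed.

Lemma iter_restr (A : pred 'X_{1..N}) (F : P -> P) n f :
  (forall g, restr A (F g) = F (restr A g)) ->
  restr A (iter n F f) = iter n F (restr A f).
Proof. by move=> AF; rewrite (iter_comm1 AF). Qed.

Variables (f : P) (m0 : 'X_{1..N}) (kappa : nat).
Hypothesis lead_f : is_lead m0 f.
Hypothesis row_f : iter kappa.+1 (row_op 0) f = 0.

(** Agreement with [m0] on all the variables before [t i] and on the first [i] variables [y]: the
    two rows are fixed column by column, not in the lexicographic order. *)
Let agree i m := [forall q : 'I_N,
  ((q < base + i) || (base + l <= q < base + l + i))%N ==> (m q == m0 q)].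

Let agreeP i m : reflect (forall q : 'I_N,
  ((q < base + i) || (base + l <= q < base + l + i))%N -> m q = m0 q) (agree i m).
Proof.
apply: (iffP forallP) => [Am q qi|Am q]; last by apply/implyP => /Am ->.
by apply/eqP; apply: (implyP (Am q)).
Qed.

Let agreeU i m (p : 'I_N) :
  ~~ ((p < base + i) || (base + l <= p < base + l + i))%N ->
  agree i (m + U_(p))%MM = agree i m.
Proof.
move=> pi; apply/eq_forallb => q; have [<-|pq] := eqVneq p q.
  by rewrite (negbTE pi).
by rewrite mnmDE mnm1E (negbTE pq) addn0.
Qed.

Let h i := restr (agree i) f.

Let h_lead i : m0 \in msupp (h i).
Proof. by rewrite mem_msupp_restr lead_f.1 andbT; apply/agreeP. Qed.

Let sumt i := (\sum_(0 <= c < i) m0 (t c))%N.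
Let sumy i := (\sum_(0 <= c < i) m0 (y c))%N.

(** The monomials of [h i] agree with [m0] before [t i], so the maximality of [m0] bounds their
    exponent at [t i]. *)
Let mderiv_h i : (i < l)%N -> iter (m0 (t i)).+1 (mderiv (t i)) (h i) = 0.
Proof.
move=> il; apply/eqP/iter_mderiv_eq0 => m; rewrite mem_msupp_restr => /andP[mi mf].
rewrite ltnS; apply: (lead_f.2 m mf) => q; rewrite tE // => qt.
by move/agreeP: mi; apply; rewrite qt.
Qed.

Let agree_step i m : (i < l)%N ->
  agree i.+1 m = [&& m (t i) == m0 (t i), m (y i) == m0 (y i) & agree i m].
Proof.
move=> il; apply/agreeP/and3P => [Am|[/eqP mt /eqP my /agreeP Am] q].
  split; first by rewrite Am // tE //; lia.
    by rewrite Am // yE; lia.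
  by apply/agreeP => q qi; apply: Am; lia.
have [qt _|qt] := eqVneq (nat_of_ord q) (base + i)%N.
  by have -> : q = t i by apply: val_inj; rewrite /= tE.
have [qy _|qy] := eqVneq (nat_of_ord q) (base + l + i)%N.
  by have -> : q = y i by apply: val_inj; rewrite /= yE //; lia.
by move=> qi; apply: Am; lia.
Qed.

Let ty c c' : (c < l)%N -> (c' <= l)%N -> t c != y c'.
Proof. by move=> cl cl'; rewrite -(inj_eq val_inj) /= yE // tE //; lia. Qed.

Let tt c c' : (c < l)%N -> (c' < l)%N -> c != c' -> t c != t c'.
Proof. by move=> cl cl' cc'; rewrite -(inj_eq val_inj) /= !tE //; lia. Qed.

Let yy c c' : (c <= l)%N -> (c' <= l)%N -> c != c' -> y c != y c'.
Proof. by move=> cl cl' cc'; rewrite -(inj_eq val_inj) /= !yE //; lia. Qed.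

Let row_op_dt i g : (i < l)%N ->
  row_op i.+1 g^`M(t i) = (row_op i.+1 g)^`M(t i).
Proof. by move=> il; apply: row_op_mderiv => c /andP[ic cl]; apply: tt; lia. Qed.

(** By [polar_top] with [a = m0 (t i)], the [n]-th power of the derivation in [y i] kills a
    polynomial having in its support [m0] lowered to 0 at [t i], whose exponent at [y i] is still
    [m0 (y i)]. *)
Let y_lt i n : (i < l)%N -> iter n (row_op i) (h i) = 0 -> (m0 (y i) < n)%N.
Proof.
move=> il; rewrite (eq_iter (fun g => row_opE g il)) => h0.
have top := polar_top (@row_opD i.+1) (fun g => row_op_dt g il) h0 (mderiv_h il).
have := iter_mderiv_eq0 _ _ _ (introT eqP top) _ (msupp_iter_mderiv (h_lead i) (leqnn _)).
by rewrite mnmBE mulmnE mnm1E (negbTE (ty il (ltnW il))) mul0n subn0.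
Qed.

(** Fixing one more column raises the order of nilpotency by [m0 (t i)], the degree of [h i] in
    [t i], and lowers it by [m0 (y i)], the exponent selected at [y i]; [polar_nilpotent] is applied
    with these values. *)
Let restr_h i : (i <= l)%N -> (sumy i <= kappa + sumt i)%N /\
  iter (kappa.+1 + sumt i - sumy i) (row_op i) (h i) = 0.
Proof.
elim: i => [_|i IH il].
  rewrite /sumy /sumt !big_geq // !addn0 subn0; split => //.
  rewrite /h -iter_restr ?row_f ?restr0 // => g; apply: restr_row_op => // c m cl.
    by apply: agreeU; rewrite tE; lia.
  by apply: agreeU; rewrite yE; lia.
have {IH}[le_i h0] := IH (ltnW il); set n := (_ - _)%N in h0.
have yn := y_lt il h0.
have sumyS : sumy i.+1 = (sumy i + m0 (y i))%N by rewrite /sumy big_nat_recr.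
have sumtS : sumt i.+1 = (sumt i + m0 (t i))%N by rewrite /sumt big_nat_recr.
split; first by rewrite sumyS sumtS; move: yn; rewrite /n; lia.
set n' := (_ - _)%N; have n'E : (m0 (y i) + n' = n + m0 (t i))%N.
  by rewrite /n' sumyS sumtS; move: yn; rewrite /n; lia.
rewrite (eq_iter (fun g => row_opE g il)) in h0.
have mulX g : row_op i.+1 ('X_(t i) * g) = 'X_(t i) * row_op i.+1 g.
  by apply: row_op_mulX => // c /andP[ic cl]; apply: ty.
have dy g : row_op i.+1 g^`M(y i) = (row_op i.+1 g)^`M(y i).
  by apply: row_op_mderiv => c /andP[ic cl]; rewrite eq_sym ty // ltnW.
have nil := polar_nilpotent (ty il (ltnW il)) (@row_opD i.+1) mulX
  (fun g => row_op_dt g il) dy h0 (mderiv_h il) n'E.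
pose A m := (m (t i) == m0 (t i)) && (m (y i) == m0 (y i)).
have -> : h i.+1 = restr A (h i).
  by rewrite /h restr_restr; apply: eq_restr => m /=; rewrite agree_step // /A andbA.
have AU m p : p != t i -> p != y i -> A (m + U_(p))%MM = A m.
  by move=> pt py; rewrite /A !mnmDE !mnm1E (negbTE pt) (negbTE py) !addn0.
rewrite -iter_restr => [|g]; last first.
  apply: restr_row_op => // c m /andP[ic cl]; apply: AU.
  - by apply: tt; lia.
  - by apply: ty => //; lia.
  - by rewrite eq_sym ty.
  - by apply: yy; lia.
(* By [nil] the exponents at [y i] are less than [m0 (y i)], whereas the restriction to [A] keeps
   only those equal to it: nothing is left. *)
apply/eqP; rewrite -msupp_eq0; case E: (msupp _) => [//|m s].
have : m \in msupp (restr A (iter n' (row_op i.+1) (h i))) by rewrite E mem_head.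
rewrite mem_msupp_restr => /andP[/andP[_ /eqP my]].
by move/(iter_mderiv_eq0 _ _ _ (introT eqP nil)); rewrite my ltnn.
Qed.

Lemma two_rows i : (i <= l)%N ->
  (\sum_(0 <= c < i.+1) m0 (y c) <= kappa + \sum_(0 <= c < i) m0 (t c))%N.
Proof.
move=> il; have [le_i] := restr_h il; rewrite big_nat_recr //= -/(sumt i) -/(sumy i).
set n := (_ - _)%N => h0; suff : (m0 (y i) < n)%N by rewrite /n; lia.
have [li|il'] := eqVneq i l; last by apply: y_lt h0; lia.
rewrite {}li in h0 *.
(* For [i = l] the sum in [row_op] is empty, and the operator is minus the derivation in [y l]. *)
have : iter n (mderiv (y l)) (h l) = 0.
  have : iter n (fun g => - g^`M(y l)) (h l) = 0.
    rewrite -[RHS]h0; apply: eq_iter => g; rewrite /row_op big_geq // add0r //.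
  have -> : iter n (fun g => - g^`M(y l)) (h l) = (-1) ^+ n *: iter n (mderiv (y l)) (h l).
    elim: (n) => [|q IHq]; first by rewrite expr0 scale1r.
    by rewrite [LHS]/= IHq mderivZ exprS mulN1r scaleNr.
  by move/eqP; rewrite mscalerI signr_eq0 => /eqP.
by move/eqP/iter_mderiv_eq0; apply; apply: h_lead.
Qed.

End TwoRows.

(** * Invariants of the row operations *)

Section Lift.
Context {K : numClosedFieldType} {n : nat}.
Local Notation I := 'I_n.+1.
Local Notation lift_dim := #|{: I * I}|.
Local Notation P := {mpoly K[lift_dim]}.
Implicit Types (f g h : P) (l a b c p q : I).

(* c stands for the column c + 1 of the paper, and l for the row l, the row 0
   being (x_{0,1}, x_{0,2}, ...) = (-1, 0, ...). *)
Definition gvar l c : P := 'X_(enum_rank (l, c)).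
Definition dgvar l c f : P := f^`M(enum_rank (l, c)).

Lemma dgvarD l c : {morph dgvar l c : f g / f + g}.
Proof. by move=> f g; apply: mderivD. Qed.

Lemma dgvarM l c f g : dgvar l c (f * g) = dgvar l c f * g + f * dgvar l c g.
Proof. exact: mderivM. Qed.

Lemma dgvarZ l c x f : dgvar l c (x *: f) = x *: dgvar l c f.
Proof. exact: mderivZ. Qed.

Lemma dgvar_sum (J : Type) (r : seq J) (Q : pred J) (F : J -> P) l c :
  dgvar l c (\sum_(x <- r | Q x) F x) = \sum_(x <- r | Q x) dgvar l c (F x).
Proof. exact: raddf_sum. Qed.

Lemma dgvar_gvar l c l' c' : dgvar l c (gvar l' c') = ((l' == l) && (c' == c))%:R.
Proof.
rewrite /dgvar /gvar mderivX mnm1E (inj_eq enum_rank_inj) xpair_eqE.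
case: andP => [[/eqP-> /eqP->]|_]; last by rewrite scale0r.
rewrite scale1r -[RHS]mpolyX0; congr ('X_[_]).
by apply/mnmP => i; rewrite mnmBE subnn mnm0E.
Qed.

Lemma dgvar_comm l c l' c' f : dgvar l c (dgvar l' c' f) = dgvar l' c' (dgvar l c f).
Proof. exact: mderiv_comm. Qed.

(** Polarizations: [Row l l'] is the infinitesimal addition of a multiple of the row [l] to the row
    [l'], and [Col a b] that of the column [a] to the column [b]. The operator [Row l l] measures
    the degree in the row [l]. *)
Definition Row l l' f : P := \sum_c gvar l c * dgvar l' c f.
Definition Col a b f : P := \sum_l gvar l a * dgvar l b f.

Lemma RowD l l' : {morph Row l l' : f g / f + g}.
Proof.
by move=> f g; rewrite -big_split; apply: eq_bigr => c _; rewrite dgvarD mulrDr.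
Qed.

Lemma RowZ l l' x f : Row l l' (x *: f) = x *: Row l l' f.
Proof. by rewrite scaler_sumr; apply: eq_bigr => c _; rewrite dgvarZ scalerAr. Qed.

Lemma Row0 l l' : Row l l' 0 = 0.
Proof. by rewrite -(scale0r 0) RowZ !scale0r. Qed.

Lemma Row_sum (J : Type) (r : seq J) (Q : pred J) (F : J -> P) l l' :
  Row l l' (\sum_(x <- r | Q x) F x) = \sum_(x <- r | Q x) Row l l' (F x).
Proof. by apply: big_morph; [apply: RowD | apply: Row0]. Qed.

Lemma RowM l l' f g : Row l l' (f * g) = Row l l' f * g + f * Row l l' g.
Proof.
rewrite mulr_suml mulr_sumr -big_split; apply: eq_bigr => c _ /=.
by rewrite dgvarM mulrDr mulrA; congr (_ + _); exact: mulrCA.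
Qed.

Lemma Row_gvar l l' p c : Row l l' (gvar p c) = (p == l')%:R *: gvar l c.
Proof.
rewrite /Row (bigD1 c) //= dgvar_gvar eqxx andbT big1 ?addr0 => [|d dc].
  by rewrite mulr_natr scaler_nat.
by rewrite dgvar_gvar [c == d]eq_sym (negbTE dc) andbF mulr0.
Qed.

Lemma dgvar_Row l l' p c f :
  dgvar p c (Row l l' f) = Row l l' (dgvar p c f) + (p == l)%:R *: dgvar l' c f.
Proof.
rewrite dgvar_sum; under eq_bigr => d _ do rewrite dgvarM dgvar_gvar.
rewrite big_split [RHS]addrC; congr (_ + _); last first.
  by apply: eq_bigr => d _; rewrite dgvar_comm.
rewrite (bigD1 c) //= eqxx andbT big1 ?addr0 => [|d dc].
  by rewrite eq_sym mulr_natl scaler_nat.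
by rewrite (negbTE dc) andbF mul0r.
Qed.

Lemma Row_Row p q l l' f : Row p q (Row l l' f) =
  Row l l' (Row p q f) + (l == q)%:R *: Row p l' f - (p == l')%:R *: Row l q f.
Proof.
have E c : Row p q (gvar l c * dgvar l' c f) = gvar l c * dgvar l' c (Row p q f) +
    (l == q)%:R *: (gvar p c * dgvar l' c f) - (p == l')%:R *: (gvar l c * dgvar q c f).
  rewrite RowM Row_gvar dgvar_Row mulrDr -scalerAl -scalerAr [p == l']eq_sym.
  rewrite [RHS]addrAC addrK addrC; congr (_ + _).
rewrite [in LHS]/(Row l l' f) Row_sum (eq_bigr _ (fun c _ => E c)).
by rewrite sumrB big_split /= -!scaler_sumr.
Qed.

Lemma Col_sum (J : Type) (r : seq J) (Q : pred J) (F : J -> P) a b :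
  Col a b (\sum_(x <- r | Q x) F x) = \sum_(x <- r | Q x) Col a b (F x).
Proof.
rewrite exchange_big; apply: eq_bigr => l _.
by rewrite dgvar_sum mulr_sumr.
Qed.

Lemma ColZ a b x f : Col a b (x *: f) = x *: Col a b f.
Proof. by rewrite scaler_sumr; apply: eq_bigr => c _; rewrite dgvarZ scalerAr. Qed.

Lemma Col0 a b : Col a b 0 = 0.
Proof. by rewrite -(scale0r 0) ColZ !scale0r. Qed.

Lemma Row_Col l l' a b f : Row l l' (Col a b f) = Col a b (Row l l' f).
Proof.
(* The two composites share the second-order part [S], and the same first-order term, in which one
   operator differentiates the coefficients of the other. *)
pose S := \sum_p \sum_c gvar p a * (gvar l c * dgvar p b (dgvar l' c f)).
transitivity (gvar l a * dgvar l' b f + S).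
  have E p : Row l l' (gvar p a * dgvar p b f) = (p == l')%:R *: (gvar l a * dgvar p b f)
      + \sum_c gvar p a * (gvar l c * dgvar p b (dgvar l' c f)).
    rewrite RowM Row_gvar -scalerAl; congr (_ + _); rewrite /Row mulr_sumr.
    by apply: eq_bigr => c _; rewrite dgvar_comm.
  rewrite Row_sum (eq_bigr _ (fun p _ => E p)) big_split /=; congr (_ + _).
  rewrite (bigD1 l') //= eqxx scale1r big1 ?addr0 // => p pl.
  by rewrite (negbTE pl) scale0r.
have E c : Col a b (gvar l c * dgvar l' c f) = (c == b)%:R *: (gvar l a * dgvar l' c f)
    + \sum_p gvar p a * (gvar l c * dgvar p b (dgvar l' c f)).
  rewrite /Col; under eq_bigr => p _ do rewrite dgvarM dgvar_gvar mulrDr.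
  rewrite big_split /=; congr (_ + _).
  rewrite (bigD1 l) //= eqxx big1 ?addr0 /= => [|p pl].
    by rewrite mulr_natl scaler_nat mulrnAr.
  by rewrite eq_sym (negbTE pl) mul0r mulr0.
rewrite Col_sum (eq_bigr _ (fun c _ => E c)) big_split /= exchange_big.
congr (_ + _); rewrite (bigD1 b) //= eqxx scale1r big1 ?addr0 // => c cb.
by rewrite (negbTE cb) scale0r.
Qed.

Lemma fock_Row l l' f g : fock (Row l l' f) g = fock f (Row l' l g).
Proof.
rewrite fock_suml fock_sumr; apply: eq_bigr => c _.
by rewrite fock_adj fock_adjr.
Qed.

Lemma fock_Col a b f g : fock (Col a b f) g = fock f (Col b a g).
Proof.
rewrite fock_suml fock_sumr; apply: eq_bigr => c _.
by rewrite fock_adj fock_adjr.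
Qed.

(** Highest weight vectors of the row action of gl(n+1), for the Borel subalgebra which adds lower
    rows to upper ones. *)
Definition invariant (w : nat -> nat) f : Prop :=
  (forall l l', (l' < l)%N -> Row l l' f = 0) /\
  (forall l, Row l l f = (w l)%:R *: f).

Lemma invariantD w f g : invariant w f -> invariant w g -> invariant w (f + g).
Proof.
move=> [f0 fw] [g0 gw]; split=> [l l' ll'|l]; rewrite RowD.
  by rewrite f0 ?g0 ?addr0.
by rewrite fw gw scalerDr.
Qed.

Lemma invariantZ w x f : invariant w f -> invariant w (x *: f).
Proof.
move=> [f0 fw]; split=> [l l' ll'|l]; rewrite RowZ.
  by rewrite f0 ?scaler0.
by rewrite fw scalerA mulrC -scalerA.
Qed.

Lemma invariant0 w : invariant w 0.
Proof. by split=> [l l' ll'|l]; rewrite Row0 ?scaler0. Qed.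

Lemma invariantB w f g : invariant w f -> invariant w g -> invariant w (f - g).
Proof. by move=> wf wg; rewrite -scaleN1r; apply/invariantD/invariantZ. Qed.

Lemma invariantM w w' f g : invariant w f -> invariant w' g ->
  invariant (fun i => w i + w' i)%N (f * g).
Proof.
move=> [f0 fw] [g0 gw]; split=> [l l' ll'|l]; rewrite RowM.
  by rewrite f0 ?g0 // mul0r mulr0 addr0.
by rewrite fw gw natrD scalerDl scalerAl scalerAr.
Qed.

Lemma invariant1 : invariant (fun=> 0%N) 1.
Proof.
have Row1 l l' : Row l l' 1 = 0.
  by apply: (addIr (Row l l' 1)); rewrite add0r -{3}[1]mulr1 RowM mulr1 mul1r.
by split=> *; rewrite Row1 ?scale0r.
Qed.

Lemma invariant_Col w a b f : invariant w f -> invariant w (Col a b f).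
Proof.
move=> [f0 fw]; split=> [l l' ll'|l]; rewrite Row_Col.
  by rewrite f0 ?Col0.
by rewrite fw ColZ.
Qed.

(* If E kills f and H = [E, F] multiplies f by kappa, then
   E F^(j+1) f = (j+1) (kappa - j) F^j f.  In particular F^(kappa+1) f is
   killed by E, hence orthogonal to itself. *)
Lemma invariant_nilpotent w f l l' kappa : invariant w f -> (l' < l)%N ->
  w l = (w l' + kappa)%N -> iter kappa.+1 (Row l' l) f = 0.
Proof.
move=> [f0 fw] ll' wl; pose h j := iter j (Row l' l) f.
have ll : (l == l') = false by apply/negbTE; rewrite -(inj_eq val_inj) gtn_eqF.
have ll1 : (l' == l) = false by rewrite eq_sym.
have hl j : Row l l (h j) = ((w l)%:R - j%:R) *: h j.
  elim: j => [|j IH]; first by rewrite subr0 /h /= fw.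
  rewrite [h _.+1]/h iterS -/(h j) Row_Row ll1 eqxx IH RowZ scale0r addr0 scale1r.
  by rewrite -[X in _ - X]scale1r -scalerBl; congr (_ *: _); rewrite -natr1; ring.
have hl' j : Row l' l' (h j) = ((w l')%:R + j%:R) *: h j.
  elim: j => [|j IH]; first by rewrite addr0 /h /= fw.
  rewrite [h _.+1]/h iterS -/(h j) Row_Row ll1 eqxx IH RowZ scale0r subr0 scale1r.
  by rewrite -[X in _ + X]scale1r -scalerDl; congr (_ *: _); rewrite -natr1; ring.
have Eh j : Row l l' (h j.+1) = (j.+1%:R * (kappa%:R - j%:R)) *: h j.
  elim: j => [|j IH]; rewrite [h _.+1]/h iterS -/(h _) Row_Row !eqxx !scale1r hl hl'.
    by rewrite f0 // Row0 add0r -scalerBl wl natrD; congr (_ *: _); ring.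
  rewrite IH RowZ -[Row l' l (h j)]/(h j.+1) -addrA -scalerBl -scalerDl wl natrD.
  by congr (_ *: _); rewrite -!natr1; ring.
apply: fock_eq0; rewrite {1}iterS fock_Row -[iter kappa.+1 _ _]/(h kappa.+1) Eh.
by rewrite subrr mulr0 scale0r fock0r.
Qed.

End Lift.

(** * The action of sl(n+1) *)

Section Variables.
Context {R : realType} {n : nat}.
Local Notation C := (R[i])%C.
Local Notation P := {mpoly C[nvars n]}.
Implicit Types (f g h : P) (i j : nat).

Lemma var_index_val i j p : var_index n i j = Some p ->
  (1 <= j <= i)%N /\ p = ('C(i, 2) + j.-1)%N :> nat.
Proof.
rewrite /var_index; case: ifP => // ij; case: insubP => // q _ qE [<-].
by rewrite qE.
Qed.

Lemma var_index_inj i j i' j' p : var_index n i j = Some p ->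
  var_index n i' j' = Some p -> i = i' /\ j = j'.
Proof.
move=> /var_index_val[/andP[j1 ji] pE] /var_index_val[/andP[j1' ji']]; rewrite {}pE.
have lt a b c d : (0 < b <= a)%N -> (0 < d <= c)%N -> (a < c)%N ->
    ('C(a, 2) + b.-1 <> 'C(c, 2) + d.-1)%N.
  move=> b1 d1 ac; have := leq_bin2l 2 ac; rewrite binS bin1; lia.
move=> E; have [ii'|ii'|ii'] := ltngtP i i'; last by move: E; rewrite ii'; lia.
  by case: (lt i j i' j') => //; apply/andP.
by case: (lt i' j' i j) => //; apply/andP.
Qed.

Lemma xvar_var i j p : var_index n i j = Some p -> xvar R n i j = 'X_p.
Proof. by rewrite /xvar => ->. Qed.

Lemma dvar_var i j p f : var_index n i j = Some p -> dvar i j f = f^`M(p).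
Proof. by rewrite /dvar => ->. Qed.

Lemma xvarS i : xvar R n i i.+1 = -1.
Proof. by rewrite /xvar /var_index ltnn andbF eqxx. Qed.

Lemma xvar_gt i j : (i.+1 < j)%N -> xvar R n i j = 0.
Proof.
move=> ij; rewrite /xvar /var_index; case: ifP => [|_]; first lia.
by case: eqP => [|//]; lia.
Qed.

Lemma dvarD i j : {morph @dvar R n i j : f g / f + g}.
Proof.
by move=> f g; rewrite /dvar; case: var_index => [p|]; rewrite ?mderivD ?addr0.
Qed.

Lemma dvarZ i j (a : C) f : dvar i j (a *: f) = a *: dvar i j f.
Proof. by rewrite /dvar; case: var_index => [p|]; rewrite ?mderivZ ?scaler0. Qed.

Lemma dvarM i j f g : dvar i j (f * g) = dvar i j f * g + f * dvar i j g.
Proof.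
rewrite /dvar; case: var_index => [p|]; first exact: mderivM.
by rewrite mul0r mulr0 addr0.
Qed.

Lemma dvar_xvar i j i' j' : (1 <= j <= i)%N -> (i <= n)%N ->
  dvar i j (xvar R n i' j') = ((i' == i) && (j' == j))%:R.
Proof.
move=> ji lein; have [p pE _] := var_indexP ji lein.
rewrite (dvar_var _ pE) /xvar; case p'E: (var_index n i' j') => [p'|].
  rewrite mderivX mnm1E; case: eqVneq => [pp'|pp'].
    rewrite pp' in p'E; have [-> ->] := var_index_inj p'E pE; rewrite !eqxx scale1r.
    rewrite -[RHS]mpolyX0; congr ('X_[_]); apply/mnmP => q.
    by rewrite mnmBE pp' subnn mnm0E.
  rewrite scale0r; case: andP => // -[/eqP ii' /eqP jj'].
  by move: pp'; rewrite ii' jj' pE in p'E; case: p'E => ->; rewrite eqxx.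
have -> : (i' == i) && (j' == j) = false.
  by apply/negP => /andP[/eqP ii' /eqP jj']; rewrite ii' jj' pE in p'E.
by case: ifP => _; rewrite ?mderiv0 // mderivN -mpolyC1 mderivC oppr0.
Qed.

End Variables.

(* The bound on the number of factors of the form d_{i,j}. *)
Definition kap (n : nat) (k : nat -> nat) (j : nat) : nat := k (n - j + 1)%N.

(* The degree in the row l, and the length of the row l of the tableaux. *)
Definition wt (n : nat) (k : nat -> nat) (l : nat) : nat :=
  (\sum_(1 <= j < l.+1) kap n k j)%N.

Lemma wtS n k l : wt n k l.+1 = (wt n k l + kap n k l.+1)%N.
Proof. by rewrite /wt big_nat_recr. Qed.

(** * The inductive formulas of the action as column operators *)

Section Action.
Context {R : realType} {n : nat}.
Variable k : nat -> nat.
Local Notation C := (R[i])%C.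
Local Notation P := {mpoly C[nvars n]}.
Local Notation xvar := (xvar R n).
Local Notation kap := (kap n k).
Local Notation wt := (wt n k).

Definition acts_as (m : nat) (A : sl_action R n) (f : P) (T : nat -> nat -> P) : Prop :=
  (forall i j, (1 <= i <= m.+1)%N -> (1 <= j <= m.+1)%N -> i != j ->
     opE A i j f = T i j) /\
  (forall i j, (1 <= i <= m.+1)%N -> (1 <= j <= m.+1)%N ->
     opH A i j f = T i i - T j j).

(** When [G l b] is the specialized derivative of an invariant in the entry (l, b), this is the
    column operator E_{a,b} truncated to the rows 1, ..., m. *)
Definition row_sum (G : nat -> nat -> P) (m a b : nat) : P :=
  \sum_(1 <= l < m.+1) xvar l a * G l b.

Lemma cstE m : (m <= n)%N ->
  cst R n k m = - (m.+1%:R)^-1 * (\sum_(1 <= j < m.+1) j * kap j)%N%:R.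
Proof.
move=> mn; rewrite /cst; congr (_ * (_ %:R)).
rewrite big_nat_rev big_add1 add0n /= !big_mkord; apply: eq_bigr => i _.
by rewrite /kap; congr (_ * k _)%N; have := ltn_ord i; lia.
Qed.

Lemma sum_wt m : (\sum_(1 <= l < m) wt l + \sum_(1 <= j < m.+1) j * kap j
  = m * wt m)%N.
Proof.
elim: m => [|m IH]; first by rewrite !big_geq.
rewrite [X in (_ + X)%N]big_nat_recr //= [in RHS]wtS.
case: m IH => [|m] IH; first by rewrite !big_geq // /wt big_geq.
by rewrite big_nat_recr //=; lia.
Qed.

(** The trace of gl(m) is prescribed to be [cst m], while that of the column operators is the sum of
    the [wt l] for [l < m]. The lemma computes the resulting shift of each diagonal operator. *)
Lemma cst_wt m : (0 < m <= n)%N ->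
  (m%:R)^-1 * (cst R n k m - (\sum_(1 <= l < m) wt l)%N%:R) = - (wt m)%:R - cst R n k m.
Proof.
move=> /andP[m0 mn]; have := congr1 (fun x => x%:R : C) (sum_wt m).
rewrite natrD natrM cstE //; set S := (\sum_(1 <= j < m.+1) _)%N.
move=> /(canRL (addrK _)) ->.
have m0' : m%:R != 0 :> C by rewrite pnatr_eq0 -lt0n.
have m1' : m.+1%:R != 0 :> C by rewrite pnatr_eq0.
by rewrite -natr1 in m1' *; field; rewrite m0' m1'.
Qed.

Variables (f : P) (G : nat -> nat -> P).
Hypothesis G_low : forall l c, (1 <= c <= l)%N -> (l <= n)%N -> G l c = dvar l c f.
Hypothesis G_high : forall l l', (1 <= l <= l')%N -> (l' <= n)%N ->
  G l l'.+1 = \sum_(1 <= c < l'.+1) xvar l' c * G l c - (if l == l' then wt l else 0%N)%:R *: f.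

Local Notation T := (row_sum G).

Let TS m a b : T m.+1 a b = xvar m.+1 a * G m.+1 b + T m a b.
Proof. by rewrite /row_sum big_nat_recr //= addrC. Qed.

Let T_low m a b : (m.+1 < a)%N -> T m a b = 0.
Proof.
move=> ma; rewrite /row_sum big_nat_cond big1 // => l /andP[/andP[_ lm] _].
by rewrite xvar_gt ?mul0r //; lia.
Qed.

Let euler_G m : (m <= n)%N -> \sum_(1 <= c < m.+1) xvar m c * G m c = euler m f.
Proof.
move=> mn; rewrite /euler !big_nat; apply: eq_bigr => c /andP[c1 cm].
by rewrite G_low ?c1.
Qed.

Let G_next m : (0 < m <= n)%N -> G m m.+1 = euler m f - (wt m)%:R *: f.
Proof. by move=> /andP[m0 mn]; rewrite G_high ?m0 ?leqnn // eqxx euler_G. Qed.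

(** In the rows up to [m], [G_high] expresses the derivatives in the column m+2 through those in the
    columns up to m+1; regrouping them by column yields the operators [T m i c]. *)
Let T_next m i : (m < n)%N -> T m.+1 i m.+2 =
  xvar m.+1 i * euler m.+1 f - (wt m.+1)%:R *: (xvar m.+1 i * f)
  + \sum_(1 <= c < m.+2) xvar m.+1 c * T m i c.
Proof.
move=> mn; rewrite TS G_next ?mn // mulrBr -scalerAr; congr (_ + _).
rewrite /row_sum; under [RHS]eq_bigr => c _ do rewrite mulr_sumr.
rewrite exchange_big /= !big_nat; apply: eq_bigr => l /andP[l1 lm].
rewrite G_high ?l1 //=; last by rewrite ltnW.
rewrite (ltn_eqF lm) scale0r subr0 mulr_sumr; apply: eq_bigr => c _.
exact: mulrCA.
Qed.

(** In the row [l] the columns beyond l+1 vanish and the column l+1 contributes [- G l l.+1]; the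
    Euler terms cancel, which leaves [wt l]. *)
Let T_trace m : (m < n)%N ->
  \sum_(1 <= l < m.+2) T m l l = (\sum_(1 <= l < m.+1) wt l)%N%:R *: f.
Proof.
move=> mn; rewrite /row_sum exchange_big natr_sum scaler_suml !big_nat /=.
apply: eq_bigr => l /andP[l1 lm]; rewrite (big_cat_nat _ (n := l.+2)) //=.
rewrite [X in _ + X]big_nat_cond [X in _ + X]big1 ?addr0 => [|c]; last first.
  by case/andP => /andP[lc _] _; rewrite xvar_gt ?mul0r.
rewrite big_nat_recr //= xvarS mulN1r euler_G ?G_next ?l1; try lia.
by rewrite opprB addrCA subrr addr0.
Qed.

Let gl_extE m (A : sl_action R n) i j : (m < n)%N -> acts_as m A f (T m) ->
  (1 <= i <= m.+1)%N -> (1 <= j <= m.+1)%N ->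
  gl_ext k m.+1 A i j f = T m i j -
    (if i == j then (wt m.+1)%:R + cst R n k m.+1 else 0) *: f.
Proof.
move=> mn [AE AH] im jm; rewrite /gl_ext.
case: (eqVneq i j) => ij; last by rewrite scale0r subr0 AE.
rewrite -ij.
have -> : \sum_(1 <= l < m.+2) opH A i l f =
    m.+1%:R *: T m i i - (\sum_(1 <= l < m.+1) wt l)%N%:R *: f.
  rewrite -(T_trace mn); rewrite scaler_nat.
  transitivity (\sum_(1 <= l < m.+2) (T m i i - T m l l)).
    by rewrite !big_nat; apply: eq_bigr => l /andP[l1 lm]; rewrite AH ?l1.
  by rewrite sumrB sumr_const_nat subn1.
rewrite addrCA -scalerBl scalerDr scalerA mulVf ?pnatr_eq0 // scale1r scalerA.
by rewrite cst_wt ?mn // -opprD scaleNr.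
Qed.

(** By induction on [m]. A new row contributes the terms in x_{m+1,i}; the new column vanishes on
    the older rows and is -1 on the new one, and E_{i,m+2} is given by [T_next]. The shift in
    [gl_extE] turns the scalar [cst] into [- wt]. *)
Lemma sl_actE m : (0 < m <= n)%N -> acts_as m (sl_act R n k m) f (T m).
Proof.
elim: m => [//|m IH] /andP[_ mn].
have E12 : G m.+1 m.+2 = euler m.+1 f - (wt m.+1)%:R *: f by rewrite G_next ?mn.
case: m mn IH E12 => [|m] mn IH E12.
  have eu1 : euler 1 f = xvar 1 1 * dvar 1 1 f by rewrite /euler big_nat1.
  have wt1 : wt 1 = k n by rewrite /wt big_nat1 /kap subn1 addn1 prednK.
  have TE a b : T 1 a b = xvar 1 a * G 1 b by rewrite /row_sum big_nat1.
  have G11 : G 1 1 = dvar 1 1 f by rewrite G_low.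
  rewrite eu1 wt1 in E12.
  have x11 : xvar 1 1 * G 1 1 - xvar 1 2 * G 1 2 =
      2%:R *: (xvar 1 1 * dvar 1 1 f) - (k n)%:R *: f.
    rewrite G11 E12 xvarS mulN1r opprK -scaler_nat scaler_nat.
    by rewrite addrA -mulr2n scaler_nat.
  split=> -[//|[|[|//]]] [//|[|[|//]]] // _ _.
  - by move=> _; rewrite /= TE E12 mulrBr -scalerAr mulrA.
  - by move=> _; rewrite /= TE G11 xvarS mulN1r.
  - by rewrite /= /cartan_ext subrr.
  - by rewrite /= /cartan_ext /= !TE x11 add0r.
  - by rewrite /= /cartan_ext /= !TE -x11 add0r opprB.
  - by rewrite /= /cartan_ext subrr.
have {IH}act := IH (ltnW mn); have [AE AH] := act.
have HE i j : (1 <= i <= m.+2)%N -> (1 <= j <= m.+2)%N ->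
    xvar m.+2 i * dvar m.+2 i f - xvar m.+2 j * dvar m.+2 j f
    + opH (sl_act R n k m.+1) i j f = T m.+2 i i - T m.+2 j j.
  move=> im jm; rewrite AH // (TS m.+1 i) (TS m.+1 j) (G_low im) // (G_low jm) //.
  by rewrite opprD addrACA.
have last_E : euler m.+2 f + xvar m.+2 m.+2 * dvar m.+2 m.+2 f
    + cst R n k m.+2 *: f + gl_ext k m.+2 (sl_act R n k m.+1) m.+2 m.+2 f
    = T m.+2 m.+2 m.+2 - T m.+2 m.+3 m.+3.
  rewrite gl_extE ?leqnn // eqxx [T m.+2 m.+2 _]TS [T m.+2 m.+3 _]TS (@T_low m.+1 m.+3) //.
  rewrite addr0 xvarS mulN1r opprK E12 G_low ?leqnn // scalerDl.
  set a := euler _ _; set b := _ * dvar _ _ _; set c := cst _ _ _ _ *: _.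
  set d := T _ _ _; set e := _ *: f.
  by ring.
split=> i j; rewrite [sl_act R n k m.+2]/(sl_action_step k m.+2 (sl_act R n k m.+1)) /=.
  move=> im jm ij; case: (leqP i m.+2) => im'.
    case: (leqP j m.+2) => jm'.
      have i1 : (1 <= i <= m.+2)%N by rewrite im'; case/andP: im => ->.
      have j1 : (1 <= j <= m.+2)%N by rewrite jm'; case/andP: jm => ->.
      by rewrite AE // (TS m.+1) (G_low j1).
    have -> : j = m.+3 by lia.
    rewrite andbF.
    have i1 : (1 <= i <= m.+2)%N by rewrite im'; case/andP: im => ->.
    have EE r : (1 <= r <= m.+2)%N -> xvar m.+2 r * gl_ext k m.+2 (sl_act R n k m.+1) i r f
       = xvar m.+2 r * T m.+1 i r - 
         (if i == r then ((wt m.+2)%:R + cst R n k m.+2) *: (xvar m.+2 i * f) else 0).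
      move=> r1; rewrite gl_extE // mulrBr; congr (_ - _).
      by case: eqP => [->|_]; rewrite ?scale0r ?mulr0 // -scalerAr.
    have -> : \sum_(1 <= r < m.+3) xvar m.+2 r * gl_ext k m.+2 (sl_act R n k m.+1) i r f
        = \sum_(1 <= r < m.+3) xvar m.+2 r * T m.+1 i r
          - ((wt m.+2)%:R + cst R n k m.+2) *: (xvar m.+2 i * f).
      rewrite [LHS]big_nat (eq_bigr _ EE) -big_nat sumrB; congr (_ - _).
      rewrite (bigD1_seq i) ?iota_uniq ?mem_index_iota //= eqxx big1 ?addr0 // => r ri.
      by rewrite eq_sym (negbTE ri).
    rewrite T_next // -!addrA; congr (_ + _); rewrite [RHS]addrC scalerDl opprD.
    by rewrite addrCA; congr (_ + _); rewrite addrCA subrr addr0.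
  have iE : i = m.+3 by lia.
  have j1 : (1 <= j <= m.+2)%N.
    by case/andP: jm => -> jm /=; move/eqP: ij => ij; lia.
  by rewrite iE /= TS (@T_low m.+1) // addr0 xvarS mulN1r (G_low j1).
move=> im jm; rewrite /cartan_ext.
case: (leqP i m.+2) => im'; case: (leqP j m.+2) => jm'.
- by rewrite HE //; lia.
- have -> : j = m.+3 by lia.
  by rewrite last_E HE; [rewrite addrA subrK | lia | lia].
- have -> : i = m.+3 by lia.
  by rewrite last_E HE; [rewrite addrA subrK opprB | lia | lia].
- have -> : i = m.+3 by lia.
  have -> : j = m.+3 by lia.
  by rewrite subrr.
Qed.

End Action.

(** * Specialization of the invariants *)

Section Projection.
Context {R : realType} {n : nat}.
Local Notation C := (R[i])%C.
Local Notation P := {mpoly C[nvars n]}.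
Local Notation I := 'I_n.+1.
Local Notation lift_dim := #|{: I * I}|.
Local Notation L := {mpoly C[lift_dim]}.
Local Notation xvar := (xvar R n).
Implicit Types (g h : L) (l a b c p q : I).

Definition proj g : P :=
  g \mPo [tuple xvar (enum_val u).1 (enum_val u).2.+1 | u < lift_dim].

Lemma projD : {morph proj : g h / g + h}. Proof. exact: comp_mpolyD. Qed.
Lemma projM : {morph proj : g h / g * h}. Proof. exact: rmorphM. Qed.
Lemma projZ x g : proj (x *: g) = x *: proj g. Proof. exact: comp_mpolyZ. Qed.
Lemma projC x : proj x%:MP = x%:MP. Proof. exact: comp_mpolyC. Qed.
Lemma projB g h : proj (g - h) = proj g - proj h. Proof. exact: comp_mpolyB. Qed.
Lemma proj1 : proj 1 = 1. Proof. exact: rmorph1. Qed.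
Lemma proj0 : proj 0 = 0. Proof. exact: raddf0. Qed.
Lemma proj_sum (J : Type) (r : seq J) (Q : pred J) (F : J -> L) :
  proj (\sum_(x <- r | Q x) F x) = \sum_(x <- r | Q x) proj (F x).
Proof. exact: raddf_sum. Qed.

Lemma proj_gvar l c : proj (gvar l c) = xvar l c.+1.
Proof. by rewrite /proj comp_mpolyXU -tnth_nth tnth_mktuple enum_rankK. Qed.

(** An entry with [c < l] specializes to a variable which occurs in no other entry, so that
    [mderiv_morph] applies. *)
Lemma proj_dgvar l c g : (c < l)%N -> dvar l c.+1 (proj g) = proj (dgvar l c g).
Proof.
move=> cl; have ln : (l <= n)%N by rewrite -ltnS.
have [q qE _] := @var_indexP n l c.+1 cl ln.
rewrite (dvar_var _ qE); apply: mderiv_morph; first exact: projC.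
- exact: projD.
- exact: projM.
move=> u; rewrite -(dvar_var _ qE).
have -> : 'X_u = gvar (enum_val u).1 (enum_val u).2 :> L.
  by rewrite /gvar -surjective_pairing enum_valK.
rewrite proj_gvar dvar_xvar // eqSS !(inj_eq val_inj) -xpair_eqE -surjective_pairing.
by rewrite -[u in RHS]enum_valK (inj_eq enum_rank_inj).
Qed.

(* Here the column c is numbered as in the paper. *)
Definition dproj g (l c : nat) : P := proj (dgvar (inord l) (inord c.-1) g).

Lemma dproj_low g (l c : nat) : (1 <= c <= l)%N -> (l <= n)%N ->
  dproj g l c = dvar l c (proj g).
Proof.
move=> /andP[c1 cl] ln; rewrite /dproj -proj_dgvar !inordK ?prednK //; lia.
Qed.

Lemma sum_low (F : nat -> P) l' : (forall d : nat, (l'.+1 < d)%N -> F d = 0) ->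
  \sum_c F (nat_of_ord (c : I)).+1 = \sum_(1 <= d < l'.+1) F d + F l'.+1.
Proof.
move=> F0; rewrite -(big_mkord xpredT (fun d => F d.+1)).
rewrite (big_cat_nat _ (n := l'.+1)) //= [X in _ + X]big_nat_cond.
rewrite [X in _ + X]big1 ?addr0 => [|c /andP[/andP[lc _] _]]; last exact: F0.
by rewrite big_nat_recr //= big_add1.
Qed.

Lemma proj_Row l l' g : proj (Row l' l g) =
  \sum_(1 <= d < l'.+1) xvar l' d * dproj g l d - dproj g l l'.+1.
Proof.
pose F (d : nat) := xvar l' d * dproj g l d.
have -> : proj (Row l' l g) = \sum_c F (nat_of_ord (c : I)).+1.
  by rewrite proj_sum; apply: eq_bigr => c _; rewrite projM proj_gvar /F /dproj !inord_val.
rewrite (@sum_low _ l') => [|c lc]; last by rewrite /F xvar_gt ?mul0r.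
by rewrite {2}/F xvarS mulN1r.
Qed.

(** The specialization of [Row l' l g] is known by invariance, and it contains the derivative in the
    column l'+1 with coefficient -1: the relation is solved for this derivative. *)
Lemma dproj_high w g (l l' : nat) : invariant w g -> (l <= l')%N -> (l' <= n)%N ->
  dproj g l l'.+1 = \sum_(1 <= d < l'.+1) xvar l' d * dproj g l d
    - (if l == l' then w l else 0%N)%:R *: proj g.
Proof.
move=> [g0 gw] ll' ln; have := proj_Row (inord l) (inord l') g.
have ln' : (l <= n)%N by apply: leq_trans ln.
rewrite !inordK // => E.
have -> : (if l == l' then w l else 0%N)%:R *: proj g = proj (Row (inord l') (inord l) g).
  case: eqVneq => [<-|nll']; first by rewrite gw projZ inordK.
  by rewrite g0 ?proj0 ?scale0r // !inordK // ltn_neqAle nll'.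
by rewrite E opprB addrCA subrr addr0.
Qed.

(* Induced by the addition of multiples of the row l - 1 to the row l. *)
Definition row_shift (l : nat) (f : P) : P :=
  \sum_(1 <= d < l) xvar l.-1 d * dvar l d f - dvar l l f.

Lemma proj_row_shift (l : nat) g : (0 < l <= n)%N ->
  proj (Row (inord l.-1) (inord l) g) = row_shift l (proj g).
Proof.
case: l => // l ln; rewrite proj_Row !inordK //; last by rewrite ltnS ltnW.
rewrite /row_shift /= dproj_low ?leqnn //; congr (_ - _).
by rewrite !big_nat; apply: eq_bigr => c /andP[c1 cl]; rewrite dproj_low // c1 ltnW.
Qed.

Lemma row_shift_nilpotent w g (l kappa : nat) : invariant w g -> (0 < l <= n)%N ->
  w l = (w l.-1 + kappa)%N -> iter kappa.+1 (row_shift l) (proj g) = 0.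
Proof.
move=> gw ln wl.
have shift i : iter i (row_shift l) (proj g) = proj (iter i (Row (inord l.-1) (inord l)) g).
  by elim: i => [//|i IH]; rewrite !iterS IH (proj_row_shift _ ln).
rewrite shift (invariant_nilpotent gw) ?proj0 // !inordK //; lia.
Qed.

(** The span of the derivatives of order [i]. The commutator of a row operator with a derivation is
    again a derivation, so each order is preserved by the row operators that act on [g] by
    scalars. *)
Inductive derivatives g : nat -> L -> Prop :=
| Derivatives0 : derivatives g 0 g
| DerivativesS i l c h : derivatives g i h -> derivatives g i.+1 (dgvar l c h)
| DerivativesD i h h' : derivatives g i h -> derivatives g i h' ->
    derivatives g i (h + h')
| DerivativesZ i x h : derivatives g i h -> derivatives g i (x *: h).

Lemma derivatives_Row w g i h l l' : invariant w g -> derivatives g i h ->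
  (l' <= l)%N -> derivatives g i (Row l l' h).
Proof.
move=> [g0 gw] dh ll'; elim: dh => {i h} [|i p c h dh IH|i h h' dh IH dh' IH'|i x h dh IH].
- case: (eqVneq l l') => [->|nll']; first by rewrite gw; apply/DerivativesZ/Derivatives0.
  rewrite g0; last by rewrite ltn_neqAle eq_sym nll'.
  by rewrite -(scale0r g); apply/DerivativesZ/Derivatives0.
- have := dgvar_Row l l' p c h => /esym /(canRL (addrK _)) ->.
  apply: DerivativesD; first exact: DerivativesS.
  by rewrite -scaleNr; apply/DerivativesZ/DerivativesS.
- by rewrite RowD; apply: DerivativesD.
- by rewrite RowZ; apply: DerivativesZ.
Qed.

(** By induction on the order, then on the column. For variable entries, derivation commutes with
    the specialization; for the others, the specialized derivative is obtained from that of a row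
    operator applied to [h], which has the order of [h], and from the previous columns. *)
Lemma proj_derivatives w g i h : invariant w g -> proj g = 0 ->
  derivatives g i h -> proj h = 0.
Proof.
move=> gw g0; elim: i h => [|i IHi] h.
  move E: 0%N => i dh; elim: dh E => {i h} [|i l c h _ _|i h h' _ IH _ IH'|i x h _ IH] E.
  - exact: g0.
  - discriminate E.
  - by rewrite projD (IH E) (IH' E) addr0.
  - by rewrite projZ (IH E) scaler0.
move E: i.+1 => i' dh.
elim: dh E => {i' h} [|i' l c h dh _|i' h h' _ IH _ IH'|i' x h _ IH] E.
- discriminate E.
- case: E dh => <- dh; have dproj0 (d : nat) : (d <= n)%N -> dproj h l d.+1 = 0.
    elim/ltn_ind: d => d IHd dn; case: (ltnP d l) => dl.
      rewrite dproj_low ?dl //; last by rewrite -ltnS.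
      by rewrite (IHi h dh) /dvar; case: var_index => [q|]; rewrite ?mderiv0.
    have dK : (inord d : I) = d :> nat by rewrite inordK.
    have dRow : derivatives g i (Row (inord d) l h).
      by apply: derivatives_Row gw dh _; rewrite dK.
    have := proj_Row l (inord d) h; rewrite (IHi _ dRow) dK big_nat big1.
      by move/eqP; rewrite eq_sym sub0r oppr_eq0 => /eqP.
    move=> e /andP[e1 ed]; have e1d : (e.-1 < d)%N by lia.
    by rewrite -(prednK e1) (IHd _ e1d) ?mulr0 //; lia.
  have cn : (c <= n)%N by rewrite -ltnS.
  by have := dproj0 c cn; rewrite /dproj !inord_val.
- by rewrite projD (IH E) (IH' E) addr0.
- by rewrite projZ (IH E) scaler0.
Qed.

(* All the derivatives of an invariant g with proj g = 0 project to 0, but some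
   derivative of a nonzero polynomial is a nonzero constant. *)
Lemma proj_invariant_inj w g : invariant w g -> proj g = 0 -> g = 0.
Proof.
move=> gw g0; suff H (s : nat) i h : (msize h < s)%N -> derivatives g i h -> h = 0.
  exact: H (ltnSn _) (Derivatives0 g).
elim: s i h => // s IH i h hs dh; apply/eqP/negPn/negP => h0.
have dh0 u : h^`M(u) = 0.
  have -> : h^`M(u) = dgvar (enum_val u).1 (enum_val u).2 h.
    by rewrite /dgvar -surjective_pairing enum_valK.
  apply: (IH i.+1); last exact: DerivativesS.
  by apply: leq_trans (msize_mderiv _ h0) _; rewrite -ltnS.
have hE := mderiv_eq0_const dh0; have := proj_derivatives gw g0 dh.
rewrite hE projC => /eqP; rewrite mpolyC_eq0 => /eqP E.
by move: h0; rewrite hE E mpolyC0 eqxx.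
Qed.

End Projection.

(** * Minors *)

Lemma sum_nat_delta a b j : (\sum_(a <= i < b) (i == j) = (a <= j < b))%N.
Proof.
rewrite -mem_index_iota -count_uniq_mem ?iota_uniq // -sum1_count [RHS]big_mkcond.
by apply: eq_bigr => i _ /=; case: (i == j).
Qed.

Section DerivationDet.
Variables (S : comNzRingType) (D : S -> S).
Hypothesis DD : {morph D : x y / x + y}.
Hypothesis DM : forall x y, D (x * y) = D x * y + x * D y.

Let D0 : D 0 = 0.
Proof. by apply: (addIr (D 0)); rewrite -DD !add0r. Qed.

Let D1 : D 1 = 0.
Proof. by apply: (addIr (D 1)); rewrite add0r -{3}[1]mulr1 DM mulr1 mul1r. Qed.

Let DN x : D (- x) = - D x.
Proof. by apply: (addIr (D x)); rewrite -DD !addNr D0. Qed.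

Let Dsign (b : bool) x : D ((-1) ^+ b * x) = (-1) ^+ b * D x.
Proof. by case: b; rewrite ?expr1 ?expr0 ?mulN1r ?mul1r ?DN. Qed.

Lemma derivation_prod (I : eqType) (r : seq I) (F : I -> S) : uniq r ->
  D (\prod_(i <- r) F i) =
  \sum_(a <- r) \prod_(i <- r) (if i == a then D (F i) else F i).
Proof.
elim: r => [|x r IH] /=; first by rewrite !big_nil D1.
case/andP=> xr ur; rewrite !big_cons DM IH // eqxx mulr_sumr; congr (_ * _ + _).
  rewrite !big_seq; apply: eq_bigr => i ir; case: eqP => // ix.
  by rewrite -ix ir in xr.
rewrite !big_seq; apply: eq_bigr => a ar; rewrite big_cons; case: eqP => // xa.
by rewrite xa ar in xr.
Qed.

Lemma derivation_det m (A : 'M[S]_m) : D (\det A) =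
  \sum_a \det (\matrix_(i, j) if i == a then D (A i j) else A i j).
Proof.
rewrite /determinant exchange_big (big_morph D DD D0); apply: eq_bigr => s _.
rewrite Dsign derivation_prod ?index_enum_uniq // mulr_sumr; apply: eq_bigr => a _.
by congr (_ * _); apply: eq_bigr => i _; rewrite mxE.
Qed.

End DerivationDet.

Section Minors.
Context {R : realType} {n : nat}.
Local Notation C := (R[i])%C.
Local Notation P := {mpoly C[nvars n]}.
Local Notation I := 'I_n.+1.
Local Notation L := {mpoly C[#|{: I * I}|]}.
Local Notation xvar := (xvar R n).

(** The rows extend to the last one, so that adding a lower row to an upper one either repeats a row
    of the minor or does not affect it: such minors are invariant. *)
Definition lift_minor (j : nat) (theta : nat -> nat) : L :=
  \det (\matrix_(a < (n - j).+1, b < (n - j).+1)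
    gvar (inord (j + a)) (inord (theta b).-1)).

Lemma Row_lift_minor j theta (l l' : I) : (1 <= j <= n)%N -> (l' <= l)%N ->
  Row l l' (lift_minor j theta) = ((l == l') && (j <= l)%N)%:R *: lift_minor j theta.
Proof.
move=> /andP[j1 jn] ll'; rewrite /lift_minor derivation_det; last 2 first.
- exact: RowD.
- exact: RowM.
set A := \matrix_(a, b) _; have rowE (a : 'I_(n - j).+1) : (inord (j + a) : I) = (j + a)%N :> nat.
  by rewrite inordK //; have := ltn_ord a; lia.
have row_a (a : 'I_(n - j).+1) : (inord (j + a) == l') = false -> 
    \det (\matrix_(i, i') (if i == a then Row l l' (A i i') else A i i')) = 0.
  move=> al'; rewrite (expand_det_row _ a) big1 // => b _.
  by rewrite !mxE eqxx Row_gvar al' scale0r mul0r.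
case: (leqP j l') => jl'; last first.
  have -> : (l == l') && (j <= l)%N = false by case: eqP => // ->; rewrite leqNgt jl'.
  rewrite scale0r big1 // => a _; apply: row_a; apply/negbTE.
  by rewrite -val_eqE /= rowE; lia.
have la : (l - j < (n - j).+1)%N by have := ltn_ord l; lia.
have l'a : (l' - j < (n - j).+1)%N by have := ltn_ord l; lia.
have l'E : inord (j + Ordinal l'a) = l'.
  by apply: val_inj; rewrite [LHS](rowE (Ordinal l'a)) /=; lia.
rewrite (bigD1 (Ordinal l'a)) //= big1 ?addr0 => [|a al']; last first.
  apply: row_a; apply: contraNF al' => /eqP al'; apply/eqP/val_inj => /=.
  by rewrite -al' rowE; lia.
case: eqVneq => [ll'E|nll'] /=.
  rewrite ll'E jl' scale1r; congr (\det _); apply/matrixP => i i'; rewrite !mxE.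
  by case: eqP => // ->; rewrite l'E Row_gvar eqxx scale1r.
rewrite scale0r (determinant_alternate (i1 := Ordinal l'a) (i2 := Ordinal la)) //.
  by rewrite -val_eqE /=; move: nll'; rewrite -val_eqE /=; lia.
move=> i; rewrite !mxE eqxx l'E Row_gvar eqxx scale1r ifN; last first.
  by rewrite -val_eqE /=; move: nll'; rewrite -val_eqE /=; lia.
by congr (gvar _ _); apply: val_inj; rewrite [RHS](rowE (Ordinal la)) /=; lia.
Qed.

Definition minor (m j : nat) (theta : nat -> nat) : P :=
  \det (\matrix_(a < m, b < m) xvar (j + a) (theta b)).

Lemma eq_minor m j theta theta' : (forall b, (b < m)%N -> theta b = theta' b) ->
  minor m j theta = minor m j theta'.
Proof.
by move=> E; congr (\det _); apply/matrixP => a b; rewrite !mxE E.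
Qed.

Lemma proj_lift_minor j theta : (1 <= j <= n)%N ->
  (forall b, (b < (n - j).+1)%N -> (1 <= theta b <= n.+1)%N) ->
  proj (lift_minor j theta) = minor (n - j).+1 j theta.
Proof.
move=> jn theta_n; rewrite /proj /lift_minor -[_ \mPo _]/(comp_mpoly _ _) -det_map_mx.
congr (\det _); apply/matrixP => a b; rewrite !mxE.
have := ltn_ord a; have := theta_n b (ltn_ord b) => ? ?.
by rewrite -[LHS]/(proj _) proj_gvar !inordK ?prednK //; lia.
Qed.

Lemma minorS m j theta : theta m = (j + m).+1 ->
  minor m.+1 j theta = - minor m j theta.
Proof.
move=> thm; rewrite /minor (expand_det_col _ ord_max) big_ord_recr /= big1 ?add0r.
  rewrite mxE thm xvarS mulN1r /cofactor -signr_odd addnn odd_double expr0 mul1r.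
  congr (- \det _); apply/matrixP => a b; rewrite !mxE.
  by rewrite /= /bump !(ltn_geF (ltn_ord _)) !add0n.
move=> a _; rewrite mxE /= thm xvar_gt ?mul0r //.
by have := ltn_ord a; lia.
Qed.

(** Each appended column has -1 in the bottom row as its only nonzero entry. A minor of the rows j,
    ..., i is thus, up to sign, a minor of the rows j, ..., n, which lifts to an invariant. *)
Lemma minor_ext m j theta t : (forall b, (m <= b)%N -> theta b = (j + b).+1) ->
  minor (m + t) j theta = (-1) ^+ t *: minor m j theta.
Proof.
move=> thE; elim: t => [|t IH]; first by rewrite addn0 scale1r.
by rewrite addnS minorS ?thE ?leq_addr // IH exprS mulN1r scaleNr.
Qed.

Definition theta_of i j (Theta : (i - j).+1.-tuple 'I_n) (b : nat) : nat :=
  (nth 0%N (map val Theta) b).+1.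

Lemma dmin_minor i j (Theta : (i - j).+1.-tuple 'I_n) :
  dmin R Theta = minor (i - j).+1 j (theta_of Theta).
Proof.
congr (\det _); apply/matrixP => a b; rewrite !mxE /theta_of.
by rewrite (nth_map (tnth Theta b)) ?size_tuple // -tnth_nth.
Qed.

(* f lifts to an invariant which behaves as a product of kappa j minors of the
   rows j, ..., n for each j. *)
Definition liftable (kappa : nat -> nat) (f : P) : Prop :=
  exists2 g : L, invariant (fun l => \sum_(1 <= j < l.+1) kappa j)%N g & proj g = f.

Lemma eq_liftable kappa kappa' f :
  (forall j, (1 <= j <= n)%N -> kappa j = kappa' j) ->
  liftable kappa f -> liftable kappa' f.
Proof.
move=> E [g [g0 gw] gf]; exists g => //; split=> // l; rewrite gw.
congr (_%:R *: _); rewrite !big_nat; apply: eq_bigr => j /andP[j1 jl].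
by apply: E; rewrite j1; have := ltn_ord l; lia.
Qed.

Lemma liftableM kappa kappa' f f' : liftable kappa f -> liftable kappa' f' ->
  liftable (fun j => kappa j + kappa' j)%N (f * f').
Proof.
move=> [g gw <-] [g' gw' <-]; exists (g * g'); last exact: projM.
have [H1 H2] := invariantM gw gw'; split=> // l; rewrite H2.
by rewrite big_split.
Qed.

Lemma liftableZ kappa a f : liftable kappa f -> liftable kappa (a *: f).
Proof.
by move=> [g gw <-]; exists (a *: g); [apply: invariantZ | apply: projZ].
Qed.

Lemma liftable1 : liftable (fun=> 0%N) 1.
Proof.
exists 1; last exact: proj1.
have [H1 H2] := @invariant1 C n; split=> // l; rewrite H2.
by rewrite big1_eq.
Qed.

Lemma liftable_prod (J : Type) (r : seq J) (Q : pred J) (kappa : J -> nat -> nat)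
    (F : J -> P) : (forall x, Q x -> liftable (kappa x) (F x)) ->
  liftable (fun j => \sum_(x <- r | Q x) kappa x j)%N (\prod_(x <- r | Q x) F x).
Proof.
move=> H; elim: r => [|x r IH].
  rewrite big_nil; apply: eq_liftable liftable1 => j _; by rewrite big_nil.
rewrite big_cons; case: ifP => Qx.
  apply: eq_liftable (liftableM (H x Qx) IH) => j _.
  by rewrite big_cons Qx.
by apply: eq_liftable IH => j _; rewrite big_cons Qx.
Qed.

Lemma liftableX kappa f a : liftable kappa f ->
  liftable (fun j => a * kappa j)%N (f ^+ a).
Proof.
move=> H; elim: a => [|a IH]; first exact: eq_liftable liftable1.
rewrite exprS; apply: eq_liftable (liftableM H IH) => j _.
by rewrite mulSn.
Qed.

Lemma liftable_minor m j theta : (1 <= j <= n)%N -> (m <= (n - j).+1)%N ->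
  (forall b, (b < m)%N -> (1 <= theta b <= n.+1)%N) ->
  liftable (fun i => (i == j) : nat) (minor m j theta).
Proof.
move=> /andP[j1 jn] mn theta_n.
pose theta' b := if (b < m)%N then theta b else (j + b).+1.
have thE b : (m <= b)%N -> theta' b = (j + b).+1.
  by move=> mb; rewrite /theta' ltnNge mb.
have -> : minor m j theta = (-1) ^+ ((n - j).+1 - m) *: minor (n - j).+1 j theta'.
  have := minor_ext ((n - j).+1 - m) thE; rewrite subnKC // => ->.
  rewrite scalerA -expr2 sqrr_sign scale1r; apply: eq_minor => b bm.
  by rewrite /theta' bm.
apply: liftableZ; exists (lift_minor j theta'); last first.
  rewrite proj_lift_minor ?j1 // => b bn; rewrite /theta'; case: ifP => [/theta_n //|_].
  by lia.
have sumE l : (\sum_(1 <= i < l.+1) (i == j) = (j <= l))%N.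
  by rewrite sum_nat_delta j1.
split=> [l l' ll'|l]; rewrite Row_lift_minor ?j1 //; try exact: ltnW.
  by rewrite -val_eqE /= gtn_eqF // scale0r.
by rewrite eqxx sumE.
Qed.

End Minors.

(** * The module V_n *)

Section SlModule.
Context {R : realType} {n : nat}.
Variable k : nat -> nat.
Local Notation C := (R[i])%C.
Local Notation P := {mpoly C[nvars n]}.
Local Notation I := 'I_n.+1.
Local Notation L := {mpoly C[#|{: I * I}|]}.
Local Notation xvar := (xvar R n).
Local Notation kap := (kap n k).
Local Notation wt := (wt n k).
Implicit Types (f : P) (g h : L) (a b : I).

(** The constant 1 is an empty minor, hence up to sign the specialization of the minor of the rows
    j, ..., n and the columns j+1, ..., n+1. Such factors absorb any slack in the bounds on the
    exponents. *)
Lemma liftable_const kappa : @liftable R n kappa 1.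
Proof.
pose one := \prod_(j <- index_iota 1 n.+1) (1 : P) ^+ kappa j.
have -> : 1 = one by rewrite /one big1 // => j _; rewrite expr1n.
have H j : (1 <= j <= n)%N -> @liftable R n (fun i => kappa j * (i == j))%N (1 ^+ kappa j).
  move=> jn; apply: liftableX; rewrite -(det_mx00 (0 : 'M[P]_0)).
  have -> : \det (0 : 'M[P]_0) = minor 0 j id by congr (\det _); apply/matrixP => -[].
  by apply: liftable_minor.
rewrite /one big_seq_cond; pose kappa' j i := (kappa j * (i == j))%N.
apply: (@eq_liftable _ _ (fun i =>
  \sum_(j <- index_iota 1 n.+1 | (j \in index_iota 1 n.+1) && true) kappa' j i)%N).
  move=> i i1; rewrite -big_seq_cond (bigD1_seq i) ?iota_uniq ?mem_index_iota //=.
  by rewrite /kappa' eqxx muln1 big1 ?addn0 // => j /negbTE ji; rewrite eq_sym ji muln0.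
apply: liftable_prod => j; rewrite mem_index_iota andbT => j1.
exact: H.
Qed.

Lemma liftable_le kappa kappa' f : (forall j, (1 <= j <= n)%N -> (kappa j <= kappa' j)%N) ->
  liftable kappa f -> liftable kappa' f.
Proof.
move=> le_k Hf; rewrite -[f]mulr1.
apply: eq_liftable (liftableM Hf (liftable_const (fun j => kappa' j - kappa j)%N)).
by move=> j /le_k /subnKC.
Qed.

(** As [wt 0 = 0], [dproj_high] expresses these derivatives through those in the previous columns of
    the row 0. Column operators thus specialize to sums over the rows from 1 on. *)
Lemma dproj_row0 g c : invariant wt g -> (0 < c <= n.+1)%N -> dproj g 0 c = 0.
Proof.
move=> gw; elim/ltn_ind: c => -[//|c] IH cn.
rewrite (dproj_high gw) // /wt big_geq // if_same scale0r subr0.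
rewrite big_nat big1 // => d /andP[d1 dc].
by rewrite IH ?mulr0 // d1 ltnW // (leq_trans dc).
Qed.

Lemma proj_Col g a b : invariant wt g ->
  proj (Col a b g) = row_sum (dproj g) n a.+1 b.+1.
Proof.
move=> gw; rewrite proj_sum /row_sum.
pose F (l : nat) := xvar l a.+1 * dproj g l b.+1.
transitivity (\sum_(l < n.+1) F l).
  by apply: eq_bigr => l _; rewrite projM proj_gvar /F /dproj !inord_val.
have F0 : F 0%N = 0 by rewrite /F dproj_row0 ?mulr0 //= ltn_ord.
by rewrite -(big_mkord xpredT F) big_ltn // F0 add0r.
Qed.

Lemma act_proj g : (0 < n)%N -> invariant wt g ->
  acts_as n (sl_act R n k n) (proj g) (row_sum (dproj g) n).
Proof.
move=> n0 gw; apply: sl_actE; last by rewrite n0 leqnn.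
  by move=> l c lc ln; rewrite dproj_low.
by move=> l l' /andP[_ ll'] ln; apply: dproj_high.
Qed.

Lemma sl_ops_liftable T f : (0 < n)%N -> sl_ops k n T ->
  liftable kap f -> liftable kap (T f).
Proof.
move=> n0 [i [j [/andP[i1 iN] /andP[j1 jN] ij TE]]] [g gw <-].
have [AE AH] := act_proj n0 gw.
have [a iE] : exists a : I, i = a.+1.
  by exists (inord i.-1); rewrite inordK prednK.
have [b jE] : exists b : I, j = b.+1.
  by exists (inord j.-1); rewrite inordK prednK.
rewrite {}iE {}jE in i1 iN j1 jN ij TE *; case: TE => ->.
  exists (Col a b g); first exact: invariant_Col.
  by rewrite (proj_Col _ _ gw); apply/esym/AE.
exists (Col a a g - Col b b g).
  by apply: invariantB; apply: invariant_Col.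
rewrite projB (proj_Col a a gw) (proj_Col b b gw).
exact/esym/AH.
Qed.

(* The polynomials in the subalgebra C_m. *)
Definition free_above (m : nat) f : Prop :=
  forall l c, (m < l <= n)%N -> (1 <= c <= l)%N -> dvar l c f = 0.

Lemma freeD m f f' : free_above m f -> free_above m f' -> free_above m (f + f').
Proof. by move=> H H' l c lm lc; rewrite dvarD (H l c) // (H' l c) // addr0. Qed.

Lemma freeZ m x f : free_above m f -> free_above m (x *: f).
Proof. by move=> H l c lm lc; rewrite dvarZ (H l c) // scaler0. Qed.

Lemma freeN m f : free_above m f -> free_above m (- f).
Proof. by rewrite -scaleN1r; apply: freeZ. Qed.

Lemma freeB m f f' : free_above m f -> free_above m f' -> free_above m (f - f').
Proof. by move=> H H'; apply/freeD/freeN. Qed.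

Lemma free0 m : free_above m 0.
Proof. by rewrite -(scale0r 0) => l c _ _; rewrite dvarZ scale0r. Qed.

Lemma free1 m : free_above m 1.
Proof.
move=> l c _ _; rewrite /dvar -mpolyC1; case: var_index => [q|//].
exact: mderivC.
Qed.

Lemma freeM m f f' : free_above m f -> free_above m f' -> free_above m (f * f').
Proof.
by move=> H H' l c lm lc; rewrite dvarM (H l c) // (H' l c) // mul0r mulr0 addr0.
Qed.

Lemma free_xvar m i j : (i <= m)%N -> free_above m (xvar i j).
Proof.
move=> im l c /andP[ml ln] lc; rewrite dvar_xvar //.
by rewrite (ltn_eqF (leq_ltn_trans im ml)).
Qed.

Lemma free_dvar m i j f : free_above m f -> free_above m (dvar i j f).
Proof.
move=> H l c lm lc; have := H l c lm lc; rewrite /dvar.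
case: (var_index n l c) => [q|//]; case: (var_index n i j) => [p|] dq.
  by rewrite mderiv_comm dq mderiv0.
exact: mderiv0.
Qed.

Lemma free_sum m (J : Type) (r : seq J) (Q : pred J) (F : J -> P) :
  (forall x, Q x -> free_above m (F x)) -> free_above m (\sum_(x <- r | Q x) F x).
Proof. by move=> H; apply: big_ind; [apply: free0 | apply: freeD | exact: H]. Qed.

Lemma free_sl_act M m f : (0 < m <= M)%N -> free_above M f ->
  (forall i j, free_above M (opE (sl_act R n k m) i j f)) /\
  (forall i j, free_above M (opH (sl_act R n k m) i j f)).
Proof.
have free_ext m' H Hl i j : (forall i j, free_above M (H i j f)) -> free_above M (Hl f) ->
    free_above M (@cartan_ext R n m' H Hl i j f).
  move=> HH HHl; rewrite /cartan_ext; case: ifP => _; case: ifP => _ //.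
  - exact: freeD.
  - exact/freeN/freeD.
  - exact: free0.
elim: m => [//|m IH] /andP[_ mM] fM.
have fx i j f' : (i <= m.+1)%N -> free_above M f' -> free_above M (xvar i j * f').
  by move=> im; apply/freeM/free_xvar/(leq_trans im).
have fd i j : free_above M (dvar i j f) by apply: free_dvar.
case: m => [|m] in IH mM fx *.
  split=> i j /=.
    case: ifP => _; last exact/freeN/fd.
    apply: freeB; last exact/freeZ/fx.
    by rewrite expr2 -mulrA; apply/fx/fx/fd.
  apply: free_ext => [*|]; first exact: free0.
  by apply: freeB; apply: freeZ => //; apply/fx/fd.
have [//|fE fH] := IH _ fM; first exact: ltnW.
have feuler : free_above M (euler m.+2 f) by apply: free_sum => s _; apply/fx/fd.
have fgl i j : free_above M (gl_ext k m.+2 (sl_act R n k m.+1) i j f).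
  rewrite /gl_ext; case: ifP => _; last exact: fE.
  by apply/freeZ/freeD; [apply: freeZ | apply: free_sum => l _; apply: fH].
split=> i j; rewrite [sl_act R n k m.+2]/(sl_action_step k m.+2 (sl_act R n k m.+1)) /=.
  case: ifP => _; first by apply: freeD; [apply/fx/fd | apply: fE].
  case: ifP => _; last exact/freeN/fd.
  apply: freeD; first by apply: freeD; [apply: fx | apply/freeZ/fx].
  by apply: free_sum => r _; apply: fx.
apply: free_ext => [i' j'|].
  by apply: freeD; [apply: freeB; apply/fx/fd | apply: fH].
apply: freeD => //; apply: freeD; last exact: freeZ.
by apply: freeD => //; apply/fx/fd.
Qed.

(** On C_m, the terms added by each further step differentiate in rows beyond [m] and vanish. Hence
    the operators generating V^(m) are restrictions of operators of sl(n+1). *)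
Lemma free_sl_act_eq m m' f i j : (0 < m <= m')%N -> (m' <= n)%N -> free_above m f ->
  (1 <= i <= m.+1)%N -> (1 <= j <= m.+1)%N ->
  opE (sl_act R n k m') i j f = opE (sl_act R n k m) i j f /\
  opH (sl_act R n k m') i j f = opH (sl_act R n k m) i j f.
Proof.
move=> /andP[m0 mm'] mn fm /andP[i1 im] /andP[j1 jm].
elim: m' mm' mn => [|m' IH] mm' mn; first by case: m m0 mm' {fm im jm}.
have [->//|mm1] := eqVneq m m'.+1.
have {mm1}mm : (m <= m')%N by rewrite -ltnS ltn_neqAle mm1.
have [EE EH] := IH mm (ltnW mn).
case: m' => [|m'] in mm' mn mm EE EH {IH} *; first by case: m m0 mm {fm im jm EE EH mm'}.
rewrite [sl_act R n k m'.+2]/(sl_action_step k m'.+2 (sl_act R n k m'.+1)).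
have im' : (i <= m'.+2)%N by apply: leq_trans im _.
have jm' : (j <= m'.+2)%N by apply: leq_trans jm _.
by rewrite /= /cartan_ext im' jm' /= !fm ?mulr0 ?subrr ?add0r ?i1 ?j1 ?mn ?andbT.
Qed.

(** The powers of x_{1,1} up to [k n] are powers of a minor of size 1, completed by constants;
    [free_sl_act_eq] and [sl_ops_liftable] then give stability under each sl(m+1). *)
Lemma Vm_liftable m f : (0 < m <= n)%N -> Vm k m f -> liftable kap f /\ free_above m f.
Proof.
elim: m f => [//|m IH] f /andP[_ mn]; have n0 : (0 < n)%N by case: (n) mn.
have lift0 : @liftable R n kap 0.
  by exists 0; [apply: invariant0 | apply: proj0].
have liftD f1 f2 : @liftable R n kap f1 -> liftable kap f2 -> liftable kap (f1 + f2).
  move=> [g1 gw1 <-] [g2 gw2 <-]; exists (g1 + g2); last exact: projD.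
  exact: invariantD.
case: m => [|m] in IH mn *.
  case=> s [c [sV ->]].
  rewrite big_seq; apply: (big_ind (fun f => liftable kap f /\ free_above 1 f)).
  - by split=> //; apply: free0.
  - by move=> f1 f2 [? ?] [? ?]; split; [apply: liftD | apply: freeD].
  move=> u /sV [i /= ik <-]; split; last first.
    by apply: freeZ; elim: (i) => [|i' IHi]; rewrite ?exprS; [apply: free1 | apply/freeM/IHi/free_xvar].
  have x11 : liftable (fun j => (j == 1%N) : nat) (xvar 1 1).
    have -> : xvar 1 1 = minor 1 1 (fun=> 1%N) by rewrite /minor det_mx11 mxE.
    by apply: liftable_minor; rewrite ?n0.
  apply: liftableZ; apply: liftable_le (liftableX i x11) => j /andP[j1 jn].
  case: eqP => [->|_]; rewrite ?muln0 // muln1 /kap.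
  by have -> : (n - 1 + 1 = n)%N by lia.
move=> Vf; have m1n : (0 < m.+1 <= n)%N by apply: ltnW mn.
elim: Vf => {f} [f /(IH f m1n) [lf ff]|T f [i [j [i1 j1 ij TE]]] _ [lf ff]||f1 f2 _ [? ?] _ [? ?]|x f _ [[g gw <-] ff]].
- by split=> // l c /andP[ml ln]; apply: ff; rewrite ltnW.
- have m2 : (0 < m.+2 <= n)%N by [].
  have [HE HH] := free_sl_act_eq m2 (leqnn _) ff i1 j1.
  have [fE fH] := free_sl_act (m := m.+2) (leqnn _) ff.
  have ops T' : T' = opE (sl_act R n k n) i j \/ T' = opH (sl_act R n k n) i j ->
      liftable kap (T' f).
    move=> T'E; apply: sl_ops_liftable => //; exists i, j; split=> //.
      by case/andP: i1 => -> /leq_trans; apply.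
    by case/andP: j1 => -> /leq_trans; apply.
  case: TE => ->.
    by rewrite -HE; split; [apply: (ops (opE _ i j)); left | rewrite HE].
  by rewrite -HH; split; [apply: (ops (opH _ i j)); right | rewrite HH].
- by split=> //; apply: free0.
- by split; [apply: liftD | apply: freeD].
- split; last exact: freeZ.
  by apply: liftableZ; exists g.
Qed.

End SlModule.

Lemma var_index_surj n (q : 'I_(nvars n)) :
  exists i j, [/\ (1 <= j <= i)%N, (i <= n)%N & var_index n i j = Some q].
Proof.
have ex0 : exists i, ('C(i, 2) <= q)%N by exists 0%N.
have bnd i : ('C(i, 2) <= q)%N -> (i <= n)%N.
  move=> iq; rewrite leqNgt; apply/negP => ni.
  by have := leq_trans (leq_bin2l 2 ni) iq; rewrite leqNgt ltn_ord.
have [i iq imax] := ex_maxnP ex0 bnd.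
have qi : (q < 'C(i.+1, 2))%N by rewrite ltnNge; apply/negP => /imax; rewrite ltnn.
rewrite binS bin1 in qi.
have ij : (1 <= (q - 'C(i, 2)).+1 <= i)%N by lia.
have [p pE pv] := var_indexP ij (bnd i iq).
exists i, (q - 'C(i, 2)).+1; split=> //; first exact: bnd.
by rewrite pE; congr Some; apply: val_inj; rewrite /= pv /= subnKC.
Qed.

(** * The invariants as a module generated by the lift of 1 *)

Section Complement.
Context {R : realType} {n : nat}.
Variable k : nat -> nat.
Local Notation C := (R[i])%C.
Local Notation P := {mpoly C[nvars n]}.
Local Notation I := 'I_n.+1.
Local Notation L := {mpoly C[#|{: I * I}|]}.
Local Notation xvar := (xvar R n).
Local Notation kap := (kap n k).
Local Notation wt := (wt n k).
Implicit Types (f : P) (g h : L) (a b : I).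

Lemma free0_const f : free_above 0 f -> f = (f@_0%MM)%:MP.
Proof.
move=> f0; apply: mderiv_eq0_const => q; have [i [j [ij lein qE]]] := var_index_surj q.
by rewrite -(dvar_var _ qE) f0 // lein andbT; case/andP: ij => /leq_trans; apply.
Qed.

Lemma msize_Col g a b : (msize (Col a b g) <= msize g)%N.
Proof.
apply: (big_ind (fun h => (msize h <= msize g)%N)) => [|h h' hg h'g|l _].
- by rewrite msize0.
- by apply: leq_trans (msizeD_le _ _) _; rewrite geq_max hg.
have [d0|d0] := eqVneq (dgvar l b g) 0; first by rewrite d0 mulr0 msize0.
have g0 : g != 0 by apply: contraNneq d0 => ->; rewrite /dgvar mderiv0.
have Y0 : gvar l a != 0 :> L by rewrite -msize_poly_eq0 msizeX.
by rewrite msizeM // msizeX mdeg1; apply: msize_mderiv.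
Qed.

(** The root vectors of both signs: this set is closed under the Fock adjoint, which makes the
    orthogonal of a submodule stable. *)
Definition raising : set (L -> L) :=
  [set T | exists a b, a != b /\ T = Col a b].

Variable v : L.
Hypothesis v_inv : invariant wt v.
Hypothesis v_proj : proj v = 1.

Let A : set L := submodule_gen raising [set v].

Let A_inv g : A g -> invariant wt g.
Proof.
elim=> {g} [g ->|T g [a [b [_ ->]]] _ gw||g h _ gw _ hw|x g _ gw] //.
- exact: invariant_Col.
- exact: invariant0.
- exact: invariantD.
- exact: invariantZ.
Qed.

Let A_msize g : A g -> (msize g <= msize v)%N.
Proof.
elim=> {g} [g ->|T g [a [b [_ ->]]] _ gw||g h _ gw _ hw|x g _ gw] //.
- exact: leq_trans (msize_Col _ _ _) gw.
- by rewrite msize0.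
- by apply: leq_trans (msizeD_le _ _) _; rewrite geq_max gw.
- exact: leq_trans (msizeZ_le _ _) gw.
Qed.

Let orth g : Prop := invariant wt g /\ forall h, A h -> fock h g = 0.

Let orth_Col g a b : a != b -> orth g -> orth (Col a b g).
Proof.
move=> ab [gw gA]; split=> [|h Ah]; first exact: invariant_Col.
rewrite -fock_Col; apply: gA; apply: SubmoduleAct => //.
by exists b, a; rewrite eq_sym.
Qed.

(** The column m+2 is 0 on the rows before m+1 and -1 on the row m+1, while the derivatives in the
    later rows vanish as [proj g] is in C_{m+1}. *)
Let proj_lower g (m c : nat) : invariant wt g -> (m < n)%N -> (1 <= c <= m.+1)%N ->
  free_above m.+1 (proj g) ->
  proj (Col (inord m.+1) (inord c.-1) g) = - dvar m.+1 c (proj g).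
Proof.
move=> gw mn /andP[c1 cm] gfree; rewrite (proj_Col _ _ gw) !inordK //; last by lia.
rewrite prednK // /row_sum (bigD1_seq m.+1) ?iota_uniq ?mem_index_iota //=.
rewrite xvarS mulN1r dproj_low ?c1 // big_seq_cond big1 ?addr0 // => l.
rewrite mem_index_iota => /andP[/andP[l1 ln] lm].
case: (ltnP l m.+1) => lm'; first by rewrite xvar_gt ?mul0r.
have {}lm : (m.+1 < l)%N by rewrite ltn_neqAle eq_sym lm.
have cl : (1 <= c <= l)%N by rewrite c1 (leq_trans cm) // ltnW.
by rewrite dproj_low // gfree ?mulr0 // lm.
Qed.

(** The rows are eliminated from the last one upwards. Within a row, [proj_lower] realizes
    derivations by column operators, which are applied as long as some derivative is nonzero; the
    size decreases each time. *)
Let orth_free m g : (m <= n)%N -> orth g -> proj g != 0 ->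
  exists2 h, orth h & proj h != 0 /\ free_above (n - m) (proj h).
Proof.
elim: m => [|m IH] mn og g0.
  exists g => //; split=> // l c; rewrite subn0 => /andP[nl ln].
  by move: nl; rewrite ltnNge ln.
have [g1 og1 [g10 g1f]] := IH (ltnW mn) og g0.
move: g1 og1 g10 g1f => {IH og g0 g} g og g0 gfree.
have nm : (n - m = (n - m.+1).+1)%N by lia.
rewrite nm in gfree; set m' := (n - m.+1)%N in gfree *.
have m'n : (m' < n)%N by rewrite /m'; lia.
move: {2}(msize _) (leqnn (msize (proj g))) => s.
elim: s g og g0 gfree => [|s IHs] g og g0 gfree gs.
  by exfalso; move: g0; rewrite -msize_poly_eq0 -leqn0 gs.
case: (pselect (exists2 c, (1 <= c <= m'.+1)%N & dvar m'.+1 c (proj g) != 0)).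
  move=> [c cm dc]; have E := proj_lower og.1 m'n cm gfree.
  apply: (IHs (Col (inord m'.+1) (inord c.-1) g)).
  - apply: orth_Col => //; rewrite -val_eqE /= !inordK //; lia.
  - by rewrite E oppr_eq0.
  - by rewrite E; apply/freeN/free_dvar.
  rewrite E -scaleN1r; apply: leq_trans (msizeZ_le _ _) _.
  rewrite -ltnS; apply: leq_trans gs; move: dc; rewrite /dvar.
  case: var_index => [q _|]; last by rewrite eqxx.
  exact: msize_mderiv.
move=> no; exists g => //; split=> // l c /andP[ml ln] cl.
have [lm|lm] := eqVneq l m'.+1; last by apply: gfree => //; lia.
apply/eqP/negPn/negP => dc; apply: no; exists c; last by rewrite -lm.
by rewrite -lm.
Qed.

Lemma orth_eq0 g : invariant wt g -> (forall h, A h -> fock h g = 0) -> g = 0.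
Proof.
move=> gw gA; apply/eqP/negPn/negP => g0.
have pg0 : proj g != 0 by apply: contra_neq g0; apply: proj_invariant_inj gw.
have [h [hw hA] [h0]] := orth_free (leqnn n) (conj gw gA) pg0.
rewrite subnn => /free0_const hE; set c := _@__ in hE.
have hv : h = c *: v.
  apply/eqP; rewrite -subr_eq0; apply/eqP/(@proj_invariant_inj _ _ wt).
    exact/invariantB/invariantZ.
  by rewrite projB projZ v_proj hE -mul_mpolyC mulr1 subrr.
have : h = 0 by apply: fock_eq0; apply: hA; rewrite hv; apply/SubmoduleZ/SubmoduleIn.
by move=> hz; rewrite hz proj0 eqxx in h0.
Qed.

(* The invariants orthogonal to A form a submodule, whose projection contains a
   nonzero constant if it is not trivial; but the multiples of v, which project
   to the constants, are in A. *)
Lemma invariant_generated g : invariant wt g -> submodule_gen raising [set v] g.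
Proof.
(* Column operators do not increase the size, so this finite list contains the supports of all the
   elements of [A], as [fock_proj] requires. *)
move=> gw; pose s := [seq bmnm m | m <- enum {: 'X_{1..#|{: I * I}| < (msize v).+1}}].
have [||||f Af fA] := @fock_proj _ _ A s _ _ _ _ g.
- exact: Submodule0.
- by move=> f h; apply: SubmoduleD.
- by move=> x f; apply: SubmoduleZ.
- move=> f /A_msize fv m /msize_mdeg_lt mf; have mv := leq_trans mf fv.
  have mv' : (mdeg m < (msize v).+1)%N by rewrite ltnW.
  by apply/mapP; exists (BMultinom mv') => //; rewrite mem_enum.
have gf : g - f = 0 by apply: orth_eq0 => //; apply/invariantB/A_inv.
by move/eqP: gf; rewrite subr_eq0 => /eqP->.
Qed.

End Complement.

(** * V_n as the image of the invariants *)

Section Generated.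
Context {R : realType} {n : nat}.
Variable k : nat -> nat.
Local Notation C := (R[i])%C.
Local Notation P := {mpoly C[nvars n]}.

Lemma Vm1 m : @Vm R n k m 1.
Proof.
elim: m => [|[|m] IH]; last exact: SubmoduleIn.
- by exists [:: 1], (fun=> 1); split=> [u|]; rewrite ?big_seq1 ?scale1r //
    inE => /eqP->; exists 0%N; rewrite ?expr0.
- by exists [:: 1], (fun=> 1); split=> [u|]; rewrite ?big_seq1 ?scale1r //
    inE => /eqP->; exists 0%N; rewrite ?expr0.
Qed.

(** From left to right, the lift is generated from the lift of 1 by column operators, which
    specialize to operators of sl(n+1), and 1 belongs to V_n. The converse is [Vm_liftable]. *)
Lemma liftable_Vn (f : P) : (2 <= n)%N -> liftable (kap n k) f <-> Vn k f.
Proof.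
move=> n2; have n0 := ltnW n2; split; last first.
  by move=> Vf; have [] := @Vm_liftable R n k n f; rewrite ?n0 ?leqnn.
have [v v_inv v_proj] := @liftable_const R n (kap n k).
move=> [g gw <-]; have := invariant_generated v_inv v_proj gw.
have VnE : @Vn R n k = submodule_gen (@sl_ops R n k n) (@Vm R n k n.-1).
  by rewrite /Vn; case: (n) n2 => [|[|m]].
elim=> {g gw} [g ->|T g [a [b [ab ->]]] gA Vg||g h _ Vg _ Vh|x g _ Vg].
- by rewrite v_proj VnE; apply/SubmoduleIn/Vm1.
- have gw : invariant (wt n k) g.
    elim: gA {Vg} => {g} [g ->|T' g [a' [b' [_ ->]]] _ gw||g h _ gw _ hw|x g _ gw] //.
    + exact: invariant_Col.
    + exact: invariant0.
    + exact: invariantD.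
    + exact: invariantZ.
  have [AE _] := act_proj n0 gw.
  rewrite (proj_Col _ _ gw) -AE ?ltn_ord //; move: Vg; rewrite VnE => Vg.
  apply: SubmoduleAct => //; exists a.+1, b.+1; split; rewrite ?ltn_ord //.
  by left.
- by rewrite proj0 VnE; apply: Submodule0.
- by move: Vg Vh; rewrite projD VnE; apply: SubmoduleD.
- by move: Vg; rewrite projZ VnE; apply: SubmoduleZ.
Qed.

End Generated.

(** * Leading exponents *)

Section Lex.
Context {N : nat}.
Implicit Types m : 'X_{1..N}.

Definition lex_tuple m : N.-tuplelexi nat := multinom_val m.

Lemma lex_tuple_inj : injective lex_tuple.
Proof. by move=> m m' mm'; apply: val_inj. Qed.

Lemma lex_ltP m m' : reflect
  (exists2 p : 'I_N, (forall q : 'I_N, (q < p)%N -> m q = m' q) & (m p < m' p)%N)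
  (lex_tuple m < lex_tuple m')%O.
Proof.
apply: (iffP ltxi_tuplePlt) => -[p eq_p lt_p]; by exists p => // q; apply: eq_p.
Qed.

Lemma lex_leP m m' : reflect (lex_le m m') (lex_tuple m <= lex_tuple m')%O.
Proof.
apply: (iffP idP) => [|le_m].
  rewrite le_eqVlt => /predU1P[/lex_tuple_inj -> //|/lex_ltP[p eq_p lt_p] q eq_q].
  case: (ltngtP q p) => [/eq_p -> //|pq|/val_inj -> //]; last exact: ltnW.
  by rewrite (eq_q p pq) ltnn in lt_p.
rewrite leNgt; apply/negP => /lex_ltP[p eq_p]; rewrite ltnNge le_m // => q qp.
by rewrite eq_p.
Qed.

Lemma lex_ltD2r m m1 m2 :
  (lex_tuple m1 < lex_tuple m2)%O -> (lex_tuple (m1 + m)%MM < lex_tuple (m2 + m)%MM)%O.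
Proof.
move=> /lex_ltP[p eq_p lt_p]; apply/lex_ltP; exists p; last by rewrite !mnmDE ltn_add2r.
by move=> q qp; rewrite !mnmDE eq_p.
Qed.

Lemma lex_ltD2l m m1 m2 :
  (lex_tuple m1 < lex_tuple m2)%O -> (lex_tuple (m + m1)%MM < lex_tuple (m + m2)%MM)%O.
Proof. by rewrite ![(m + _)%MM]addmC; apply: lex_ltD2r. Qed.

Lemma lex_leD m1 m2 m1' m2' :
  (lex_tuple m1 <= lex_tuple m1')%O -> (lex_tuple m2 <= lex_tuple m2')%O ->
  (lex_tuple (m1 + m2)%MM <= lex_tuple (m1' + m2')%MM)%O.
Proof.
rewrite !(le_eqVlt (lex_tuple m1)) !(le_eqVlt (lex_tuple m2)).
move=> /predU1P[/lex_tuple_inj ->|lt1] /predU1P[/lex_tuple_inj ->|lt2] //.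
- by rewrite ltW ?lex_ltD2l.
- by rewrite ltW ?lex_ltD2r.
- by rewrite ltW // (lt_trans (lex_ltD2r _ lt1)) ?lex_ltD2l.
Qed.

Lemma lex_lt_leD m1 m2 m1' m2' :
  (lex_tuple m1 < lex_tuple m1')%O -> (lex_tuple m2 <= lex_tuple m2')%O ->
  (lex_tuple (m1 + m2)%MM < lex_tuple (m1' + m2')%MM)%O.
Proof.
move=> lt1 le2; apply: lt_le_trans (lex_ltD2r _ lt1) _.
exact: lex_leD.
Qed.

End Lex.

Section Lead.
Context {K : numFieldType} {N : nat}.
Implicit Types (m : 'X_{1..N}) (f g : {mpoly K[N]}).

Lemma is_leadP m f : is_lead m f <->
  m \in msupp f /\ forall m', m' \in msupp f -> (lex_tuple m' <= lex_tuple m)%O.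
Proof.
by split=> -[mf lm]; split=> // m' /lm; move/lex_leP.
Qed.

Lemma is_lead_neq0 m f : is_lead m f -> f != 0.
Proof. by case=> mf _; apply: contraTneq mf => ->; rewrite msupp0. Qed.

Lemma is_leadM m m' f g : is_lead m f -> is_lead m' g -> is_lead (m + m')%MM (f * g).
Proof.
move=> /is_leadP[mf lf] /is_leadP[mg lg]; apply/is_leadP; split; last first.
  move=> a /msuppM_le /allpairsP[[b c] /= [bf cg ->]].
  by apply: lex_leD; [apply: lf | apply: lg].
(* All the exponents of [f'] are smaller than [m], so [f' * g] does not contribute to the
   coefficient of [m + m']. *)
pose f' := f - f@_m *: 'X_[m].
have f'_lt a : a \in msupp f' -> (lex_tuple a < lex_tuple m)%O.
  rewrite mcoeff_msupp mcoeffB mcoeffZ mcoeffX; case: (eqVneq m a) => [->|ma].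
    by rewrite mulr1 subrr eqxx.
  rewrite mulr0 subr0 -mcoeff_msupp => /lf; rewrite le_eqVlt.
  by case/predU1P => // /lex_tuple_inj am; rewrite am eqxx in ma.
have -> : f = f@_m *: 'X_[m] + f' by rewrite addrC subrK.
rewrite mcoeff_msupp mulrDl mcoeffD -scalerAl mcoeffZ.
rewrite ['X_[m] * g]mulrC mcoeffMX [X in _ + X]memN_msupp_eq0 ?addr0.
  by rewrite mulf_neq0 // -mcoeff_msupp.
apply/negP => /msuppM_le /allpairsP[[b c] /= [bf cg E]].
have := lex_lt_leD (f'_lt b bf) (lg c cg); rewrite E ltxx //.
Qed.

Lemma is_lead1 : is_lead 0%MM (1 : {mpoly K[N]}).
Proof.
split=> [|m]; rewrite mcoeff_msupp mcoeff1 ?eqxx ?oner_eq0 //.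
by case: (m =P 0%MM) => [-> _ ?|_] //; rewrite eqxx.
Qed.

Lemma is_lead_prod (I : Type) (r : seq I) (Q : pred I) (F : I -> {mpoly K[N]})
    (M : I -> 'X_{1..N}) : (forall i, Q i -> is_lead (M i) (F i)) ->
  is_lead (\sum_(i <- r | Q i) M i)%MM (\prod_(i <- r | Q i) F i).
Proof.
move=> H; apply: (big_ind2 (fun m f => is_lead m f)) => //; first exact: is_lead1.
by move=> m1 f1 m2 f2; apply: is_leadM.
Qed.

End Lead.

(** * Lexicographic degrees and leading exponents of minors *)

Section Lexdeg.
Context {R : realType} {n : nat}.
Local Notation C := (R[i])%C.
Local Notation P := {mpoly C[nvars n]}.
Implicit Types (f : P) (m : 'X_{1..nvars n}).

Lemma lexdeg_lead f : f != 0 -> exists2 m, is_lead m f & lexdeg f = lex_tuple m.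
Proof.
move=> f0; suff [m mf lm] : exists2 m, m \in msupp f & lexdeg f = lex_tuple m.
  exists m => //; apply/is_leadP; split=> // m' m'f; rewrite -lm.
  by apply: (le_bigmax_seq _ m').
have : msupp f != [::] by rewrite msupp_eq0.
rewrite /lexdeg; elim: (msupp f) => //= m s IH _; rewrite big_cons.
have [->|s0] := eqVneq s [::].
  by exists m; rewrite ?mem_head // big_nil /Order.max ltx0.
have [m' m's ->] := IH s0; rewrite /Order.max; case: ifP => _.
  by exists m' => //; rewrite inE m's orbT.
by exists m => //; rewrite mem_head.
Qed.

Lemma is_lead_lexdeg m f : is_lead m f -> lexdeg f = lex_tuple m.
Proof.
move=> fm; have [m' /is_leadP[m'f lm'] ->] := lexdeg_lead (is_lead_neq0 fm).
have /is_leadP[mf lm] := fm.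
by apply/eqP; rewrite eq_le lm ?lm'.
Qed.

Lemma lexdeg_is_lead m f : f != 0 -> lexdeg f = lex_tuple m -> is_lead m f.
Proof. by move=> /lexdeg_lead[m' fm' ->] /lex_tuple_inj <-. Qed.

Definition mexp m (i j : nat) : nat :=
  if var_index n i j is Some p then m p else 0%N.

Definition mvar (i j : nat) : 'X_{1..nvars n} :=
  if var_index n i j is Some p then U_(p)%MM else 0%MM.

Lemma mexp_mvar i j i' j' : (1 <= j <= i)%N -> (i <= n)%N ->
  mexp (mvar i' j') i j = ((i' == i) && (j' == j)).
Proof.
move=> ji lein; have [p pE _] := var_indexP ji lein.
rewrite /mexp pE /mvar; case p'E: (var_index n i' j') => [p'|].
  rewrite mnm1E; case: eqVneq => [pp'|pp'].
    by rewrite pp' in p'E; have [-> ->] := var_index_inj p'E pE; rewrite !eqxx.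
  case: andP => // -[/eqP ii' /eqP jj'].
  by move: pp'; rewrite ii' jj' pE in p'E; case: p'E => ->; rewrite eqxx.
rewrite mnm0E; case: andP => // -[/eqP ii' /eqP jj'].
by rewrite ii' jj' pE in p'E.
Qed.

Lemma mexp0 i j : mexp 0%MM i j = 0%N.
Proof. by rewrite /mexp; case: var_index => // p; rewrite mnm0E. Qed.

Lemma mexpD m m' i j : mexp (m + m')%MM i j = (mexp m i j + mexp m' i j)%N.
Proof. by rewrite /mexp; case: var_index => // p; rewrite mnmDE. Qed.

Lemma mexp_sum (I : Type) (r : seq I) (Q : pred I) (M : I -> 'X_{1..nvars n}) i j :
  mexp (\sum_(x <- r | Q x) M x)%MM i j = (\sum_(x <- r | Q x) mexp (M x) i j)%N.
Proof.
by apply: (big_morph (fun m => mexp m i j)) => [m m'|]; rewrite (mexpD, mexp0).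
Qed.

Lemma mexpP m m' : (forall i j, (1 <= j <= i)%N -> (i <= n)%N -> mexp m i j = mexp m' i j) ->
  m = m'.
Proof.
move=> E; apply/mnmP => q; have [i [j [ij lein qE]]] := var_index_surj q.
by have := E i j ij lein; rewrite /mexp qE.
Qed.

Definition xcoef (i j : nat) : C :=
  if (1 <= j <= i)%N then 1 else if j == i.+1 then -1 else 0.

Lemma xvarE i j : (i <= n)%N -> xvar R n i j = xcoef i j *: 'X_[mvar i j].
Proof.
move=> lein; rewrite /xvar /xcoef /mvar; have [ij|ij] := boolP (1 <= j <= i)%N.
  by have [p -> _] := var_indexP ij lein; rewrite scale1r.
rewrite /var_index (negbTE ij); case: eqP => _; last by rewrite scale0r.
by rewrite mpolyX0 scaleN1r.
Qed.

Lemma lex_lt_mexp m m' i j : (1 <= j <= i)%N -> (i <= n)%N ->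
  (forall i' j', (1 <= j' <= i')%N -> (i' < i)%N -> mexp m i' j' = mexp m' i' j') ->
  (forall j', (1 <= j' < j)%N -> mexp m i j' = mexp m' i j') ->
  (mexp m i j < mexp m' i j)%N -> (lex_tuple m < lex_tuple m')%O.
Proof.
move=> ij lein lt_i lt_j lt_m; have [p pE pv] := var_indexP ij lein.
apply/lex_ltP; exists p; last by move: lt_m; rewrite /mexp pE.
move=> q qp; have [i' [j' [ij' lein' qE]]] := var_index_surj q.
have [_ qv] := var_index_val qE.
have : mexp m i' j' = mexp m' i' j'; last by rewrite /mexp qE.
have [ii'|ii'|ii'] := ltngtP i' i; first exact: lt_i.
  have := leq_bin2l 2 ii'; rewrite binS bin1 => le_b.
  by move: qp; rewrite qv pv; case/andP: ij => j1 ji; case/andP: ij' => *; lia.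
rewrite ii' lt_j //; move: qp; rewrite qv pv ii' ltn_add2l.
by case/andP: ij' => -> ; case/andP: ij => *; lia.
Qed.

Definition diag_mon (m j : nat) (theta : nat -> nat) : 'X_{1..nvars n} :=
  (\sum_(a < m) mvar (j + a) (theta a))%MM.

Lemma mexp_diag_mon (m j : nat) theta i c : (1 <= c <= i)%N -> (i <= n)%N ->
  mexp (diag_mon m j theta) i c = [&& (j <= i)%N, (i - j < m)%N & theta (i - j)%N == c].
Proof.
move=> ci lein; rewrite mexp_sum.
under eq_bigr => a _ do rewrite mexp_mvar //.
case: (boolP ((j <= i)%N && (i - j < m)%N)) => [/andP[ji im]|H].
  rewrite (bigD1 (Ordinal im)) //= subnKC // eqxx ji im /= big1 ?addn0 // => a.
  rewrite -val_eqE /= => ai; suff -> : (j + a == i)%N = false by [].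
  by apply/negbTE; lia.
rewrite andbA (negbTE H) big1 // => a _.
suff -> : (j + a == i)%N = false by [].
by apply/negbTE; have := ltn_ord a; lia.
Qed.

(** The upper bound on [theta] makes the diagonal entries nonzero. At the first row moved by a
    permutation, the entry it selects lies farther right since [theta] increases, which gives a
    smaller monomial. *)
Lemma is_lead_minor (m j : nat) theta : (1 <= j)%N -> (j + m <= n.+1)%N ->
  (forall a, (a < m)%N -> (1 <= theta a <= (j + a).+1)%N) ->
  (forall a b, (a < b < m)%N -> (theta a < theta b)%N) ->
  is_lead (diag_mon m j theta) (@minor R n m j theta).
Proof.
move=> j1 jm th_le th_lt.
pose coef (s : 'S_m) : C := \prod_(a < m) xcoef (j + a) (theta (s a)).
pose mon (s : 'S_m) : 'X_{1..nvars n} := (\sum_(a < m) mvar (j + a) (theta (s a)))%MM.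
have minorE : minor m j theta = \sum_(s : 'S_m) ((-1) ^+ s * coef s) *: 'X_[mon s].
  rewrite /minor /determinant; apply: eq_bigr => s _.
  rewrite -scalerA -[RHS]mul_mpolyC rmorph_sign; congr (_ * _).
  rewrite /coef /mon -mprodXE -scaler_prod; apply: eq_bigr => a _.
  by rewrite mxE xvarE //; have := ltn_ord a; lia.
have coef1 : coef 1%g != 0.
  apply/prodf_neq0 => a _; rewrite perm1 /xcoef.
  have /andP[t1 t2] := th_le a (ltn_ord a); rewrite t1 /=.
  case: leqP => [_|lt_t]; first exact: oner_neq0.
  have -> : theta a == (j + a).+1 by rewrite eqn_leq t2.
  by rewrite oppr_eq0 oner_eq0.
have mon1 : mon 1%g = diag_mon m j theta.
  by apply: eq_bigr => a _; rewrite perm1.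
have mon_lt s : s != 1%g -> coef s != 0 -> (lex_tuple (mon s) < lex_tuple (mon 1%g))%O.
  move=> s1 cs.
  have [a0 sa0] : exists a, s a != a.
    apply/existsP; apply: contra_neqT s1 => /existsPn sa.
    by apply/permP => a; rewrite perm1; apply/eqP; rewrite -[_ == _]negbK.
  case: (@arg_minnP _ a0 (fun a => s a != a) (fun a => a : nat) sa0) => a sa a_min.
  have fix_lt (b : 'I_m) : (b < a)%N -> s b = b.
    by move=> ba; apply/eqP/negPn/negP => /a_min; rewrite leqNgt ba.
  have sa_gt : (a < s a)%N.
    rewrite ltn_neqAle eq_sym sa /= leqNgt; apply/negP => /fix_lt /perm_inj E.
    by rewrite E eqxx in sa.
  have th_sa : (theta a < theta (s a))%N by apply: th_lt; rewrite sa_gt /=.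
  (* If the diagonal entry of this row were the conventional -1, the entry selected by [s], farther
     right, would be 0, against [cs]. *)
  have th_a : (1 <= theta a <= j + a)%N.
    have /andP[t1 t2] := th_le a (ltn_ord a); rewrite t1 /= -ltnS ltn_neqAle t2 andbT.
    apply: contraNneq cs => tE; rewrite /coef (bigD1 a) //= /xcoef.
    have -> : (theta (s a) <= j + a)%N = false by apply/negbTE; lia.
    by rewrite andbF ifN ?mul0r //; lia.
  have jan : (j + a <= n)%N by have := ltn_ord a; lia.
  rewrite mon1; have monE i c : (1 <= c <= i)%N -> (i <= n)%N -> mexp (mon s) i c =
      (\sum_(b < m) ((j + b == i) && (theta (s b) == c)))%N.
    by move=> ci lein; rewrite mexp_sum; under eq_bigr => b _ do rewrite mexp_mvar //.
  have diagE i c : (1 <= c <= i)%N -> (i <= n)%N -> mexp (diag_mon m j theta) i c =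
      (\sum_(b < m) ((j + b == i) && (theta b == c)))%N.
    by move=> ci lein; rewrite mexp_sum; under eq_bigr => b _ do rewrite mexp_mvar //.
  apply: (lex_lt_mexp th_a jan) => [i' c' ci lt_i|c' /andP[c1 lt_c]|].
  - rewrite monE ?diagE //; try lia.
    apply: eq_bigr => b _; case: eqP => //= bi; rewrite fix_lt //; lia.
  - rewrite monE ?diagE //; try lia.
    rewrite !big1 // => b _; have [/addnI/val_inj ->|//] := eqVneq (j + b)%N (j + a)%N.
      by rewrite gtn_eqF.
    by rewrite gtn_eqF // (ltn_trans lt_c).
  rewrite monE // diagE // big1 => [|b _]; last first.
    have [/addnI/val_inj ->|//] := eqVneq (j + b)%N (j + a)%N.
    by rewrite gtn_eqF.
  by rewrite (bigD1 a) //= !eqxx.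
rewrite -mon1; apply/is_leadP; split; last first.
  move=> m'; rewrite mcoeff_msupp minorE raddf_sum /= => H.
  have /existsP[s] : [exists s : 'S_m, (((-1) ^+ s * coef s) *: 'X_[mon s])@_m' != 0].
    apply: contraNT H => /existsPn H; rewrite big1 // => s _.
    by apply/eqP; rewrite -[_ == _]negbK.
  rewrite mcoeffZ mcoeffX; case: (mon s =P m') => [<- |_]; last by rewrite mulr0 eqxx.
  rewrite mulr1 mulf_eq0 signr_eq0 /= => cs.
  by have [->//|s1] := eqVneq s 1%g; apply/ltW/mon_lt.
rewrite mcoeff_msupp minorE raddf_sum /= (bigD1 1%g) //= big1 ?addr0 => [|s s1].
  by rewrite odd_perm1 expr0 mul1r mcoeffZ mcoeffX eqxx mulr1.
rewrite mcoeffZ mcoeffX; have [cs|cs] := eqVneq (coef s) 0.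
  by rewrite cs mulr0 mul0r.
by case: eqP => [E|_]; [have := mon_lt s s1 cs; rewrite E ltxx | rewrite mulr0].
Qed.

End Lexdeg.

(** * The products in S_n(lambda) *)

Section Products.
Context {R : realType} {n : nat}.
Variable k : nat -> nat.
Local Notation C := (R[i])%C.
Local Notation P := {mpoly C[nvars n]}.
Local Notation kap := (kap n k).
Implicit Types (f : P).

Lemma theta_of_le i j (Theta : (i - j).+1.-tuple 'I_n) b :
  (1 <= n)%N -> (1 <= theta_of Theta b <= n)%N.
Proof.
move=> n1; rewrite /theta_of /=; case: (ltnP b (size Theta)) => bs.
  by rewrite (nth_map (Ordinal n1)) // ltn_ord.
by rewrite nth_default // size_map.
Qed.

Lemma liftable_dmin i j (Theta : (i - j).+1.-tuple 'I_n) :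
  (1 <= j <= i)%N -> (i <= n)%N -> liftable (fun l => (l == j) : nat) (dmin R Theta).
Proof.
move=> /andP[j1 ji] lein; rewrite dmin_minor; apply: liftable_minor.
- by rewrite j1 (leq_trans ji).
- by rewrite ltnS leq_sub2r.
move=> b _; have n1 : (1 <= n)%N by apply: leq_trans lein; apply: leq_trans ji.
by have /andP[-> /leqW] := theta_of_le Theta b n1.
Qed.

Definition weight (alpha : exponents n) (j : nat) : nat :=
  (\sum_(j <= i < n.+1) \sum_(Theta in @JJ R n i j) alpha i j Theta)%N.

Lemma sum_triangle (F : nat -> nat -> nat) :
  (\sum_(1 <= i < n.+1) \sum_(1 <= j < i.+1) F i j =
   \sum_(1 <= j < n.+1) \sum_(j <= i < n.+1) F i j)%N.
Proof.
have E1 : (\sum_(1 <= i < n.+1) \sum_(1 <= j < i.+1) F i j =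
    \sum_(1 <= i < n.+1) \sum_(1 <= j < n.+1 | (j <= i)%N) F i j)%N.
  rewrite !big_nat; apply: eq_bigr => i /andP[i1 lein].
  rewrite (big_nat_widen _ _ n.+1) //.
have E2 : (\sum_(1 <= j < n.+1) \sum_(j <= i < n.+1) F i j =
    \sum_(1 <= j < n.+1) \sum_(1 <= i < n.+1 | (j <= i)%N) F i j)%N.
  rewrite !big_nat; apply: eq_bigr => j /andP[j1 jn].
  by rewrite (big_nat_widenl _ 1).
rewrite E1 E2 (exchange_big_dep xpredT) //.
Qed.

Lemma liftable_Sprod (alpha : exponents n) : liftable (weight alpha) (Sprod R alpha).
Proof.
pose K i j l := (\sum_(Theta in @JJ R n i j) alpha i j Theta * (l == j))%N.
have H : liftable (fun l => \sum_(1 <= i < n.+1) \sum_(1 <= j < i.+1) K i j l)%N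
    (Sprod R alpha).
  rewrite /Sprod big_nat_cond [X in liftable X](_ : _ = fun l =>
    (\sum_(1 <= i < n.+1 | (1 <= i < n.+1) && true) \sum_(1 <= j < i.+1) K i j l)%N); last first.
    by apply/funext => l; rewrite -big_nat_cond.
  apply: liftable_prod => i; rewrite andbT => /andP[i1 lein].
  rewrite big_nat_cond [X in liftable X](_ : _ = fun l =>
    (\sum_(1 <= j < i.+1 | (1 <= j < i.+1) && true) K i j l)%N); last first.
    by apply/funext => l; rewrite -big_nat_cond.
  apply: liftable_prod => j; rewrite andbT => /andP[j1 ji].
  by apply: liftable_prod => Theta _; apply/liftableX/liftable_dmin; rewrite ?j1.
apply: eq_liftable H => l ln; rewrite sum_triangle (bigD1_seq l) ?iota_uniq ?mem_index_iota //=.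
rewrite [X in (_ + X)%N]big1 ?addn0 => [|j jl].
  by apply: eq_bigr => i _; apply: eq_bigr => Theta _; rewrite eqxx muln1.
rewrite big1 // => i _; rewrite /K big1 // => Theta _.
by rewrite eq_sym (negbTE jl) muln0.
Qed.

Lemma Sprod_Vn (alpha : exponents n) : (2 <= n)%N -> admissible R k alpha ->
  @Vn R n k (Sprod R alpha).
Proof.
move=> n2 adm; apply/liftable_Vn => //.
by apply: liftable_le (liftable_Sprod alpha) => j jn; apply: adm.
Qed.

Lemma Sprod_neq0 (alpha : exponents n) : Sprod R alpha != 0.
Proof.
have ind := big_ind (fun x : P => x != 0) (oner_neq0 _) (fun x y => @mulf_neq0 _ x y).
apply: (ind) => i _; apply: (ind) => j _; apply: (ind) => Theta dT.
have dT0 : dmin R Theta != 0 by move: dT; rewrite unfold_in.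
by move: (dmin R Theta) dT0 => x; apply: expf_neq0.
Qed.

(** Let [mexp m l c] count the entries [c <= l] in the row [l], of length [wt l], of a tableau with
    weakly decreasing rows, the other entries being l+1. The inequalities say that the columns
    strictly increase downwards. *)
Definition gt_exp (m : 'X_{1..nvars n}) : Prop := forall l i, (l < n)%N -> (i <= l)%N ->
  (\sum_(1 <= c < i.+2) mexp m l.+1 c <= kap l.+1 + \sum_(1 <= c < i.+1) mexp m l c)%N.

(** In the numbering of the variables, the row [l] starts at 'C(l, 2) and is followed by the row
    l+1, so [row_shift l.+1] is an operator [row_op] to which [two_rows] applies. *)
Lemma lead_gt_exp f m : liftable kap f -> is_lead m f -> gt_exp m.
Proof.
move=> [g gw gf] lead l i ln il; have l1n : (0 < l.+1 <= n)%N by [].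
have := row_shift_nilpotent gw l1n (wtS n k l); rewrite gf => f0.
have [p0 _ _] := @var_indexP n l.+1 1 isT ln.
pose pos i j := odflt p0 (var_index n i j).
have posP i' j : (1 <= j <= i')%N -> (i' <= n)%N ->
    var_index n i' j = Some (pos i' j) /\ pos i' j = ('C(i', 2) + j.-1)%N :> nat.
  by move=> ij lein; have [p pE pv] := var_indexP ij lein; rewrite /pos pE.
pose t c := pos l c.+1; pose y c := pos l.+1 c.+1.
have tE c : (c < l)%N -> t c = ('C(l, 2) + c)%N :> nat.
  by move=> cl; have [_ ->] := @posP l c.+1 cl (ltnW ln).
have yE c : (c <= l)%N -> y c = ('C(l, 2) + l + c)%N :> nat.
  by move=> cl; have [_ ->] := @posP l.+1 c.+1 cl ln; rewrite binS bin1.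
have shiftE (h : P) : row_shift l.+1 h = row_op l t y 0 h.
  rewrite /row_shift /row_op big_add1 /=; congr (_ - _).
    rewrite !big_nat; apply: eq_bigr => c cl.
    have [tp _] := @posP l c.+1 cl (ltnW ln).
    have [yp _] := @posP l.+1 c.+1 (leqW cl) ln.
    by rewrite (xvar_var tp) (dvar_var _ yp).
  by have [yp _] := @posP l.+1 l.+1 (leqnn _) ln; rewrite (dvar_var _ yp).
rewrite (eq_iter shiftE) in f0; have := two_rows tE yE lead f0 il.
rewrite !big_add1 /=.
congr (_ <= _ + _)%N; rewrite !big_nat; apply: eq_bigr => c ci.
  have cl : (c <= l)%N by lia.
  by rewrite /mexp; have [-> _] := @posP l.+1 c.+1 cl ln.
have cl : (c < l)%N by lia.
by rewrite /mexp; have [-> _] := @posP l c.+1 cl (ltnW ln).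
Qed.

Definition products (kappa : nat -> nat) f : Prop := exists2 alpha : exponents n,
  f = Sprod R alpha & forall j, (1 <= j <= n)%N -> (weight alpha j <= kappa j)%N.

Lemma productsM kappa kappa' f f' : products kappa f -> products kappa' f' ->
  products (fun j => kappa j + kappa' j)%N (f * f').
Proof.
move=> [al -> le_al] [al' -> le_al'].
exists (fun i j Theta => al i j Theta + al' i j Theta)%N => [|j jn].
  rewrite /Sprod -big_split; apply: eq_bigr => i _; rewrite -big_split.
  apply: eq_bigr => j _; rewrite -big_split; apply: eq_bigr => Theta _.
  by rewrite exprD.
apply: leq_trans (leq_add (le_al j jn) (le_al' j jn)).
rewrite /weight -big_split leq_sum // => i _.
by rewrite -big_split.
Qed.

Lemma products1 kappa : products kappa 1.
Proof.
exists (fun _ _ _ => 0%N) => [|j jn].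
  by rewrite /Sprod big1 // => i _; rewrite big1 // => j _; rewrite big1.
by rewrite /weight big1 // => i _; rewrite big1_eq.
Qed.

Lemma eq_products kappa kappa' f : (forall j, (1 <= j <= n)%N -> kappa j = kappa' j) ->
  products kappa f -> products kappa' f.
Proof. by move=> E [al fE le_al]; exists al => // j jn; rewrite -E ?le_al. Qed.

Lemma products_prod (J : eqType) (r : seq J) (kappa : J -> nat -> nat)
    (F : J -> P) : (forall x, x \in r -> products (kappa x) (F x)) ->
  products (fun j => \sum_(x <- r) kappa x j)%N (\prod_(x <- r) F x).
Proof.
elim: r => [|x r IH] H.
  by rewrite big_nil; apply: products1.
rewrite big_cons; apply: eq_products (productsM (H x (mem_head _ _)) (IH _)) => [j _|y yr].
  by rewrite big_cons.
by apply: H; rewrite inE yr orbT.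
Qed.

Lemma products_dmin i j (Theta : (i - j).+1.-tuple 'I_n) : (1 <= j <= i)%N ->
  (i <= n)%N -> dmin R Theta != 0 -> products (fun l => (l == j) : nat) (dmin R Theta).
Proof.
move=> /andP[j1 ji] lein dT.
(* The types of [Theta'] and [Theta] depend on different indices; they are compared as sequences. *)
pose al i' j' (Theta' : (i' - j').+1.-tuple 'I_n) : nat :=
  [&& i' == i, j' == j & val Theta' == val Theta :> seq 'I_n].
exists al => [|l /andP[l1 ln]].
  have iin : i \in index_iota 1 n.+1 by rewrite mem_index_iota (leq_trans j1).
  have jin : j \in index_iota 1 i.+1 by rewrite mem_index_iota j1.
  have Tin : Theta \in @JJ R n i j by [].
  have Pi i' : i' != i -> \prod_(1 <= j' < i'.+1) \prod_(Theta' in @JJ R n i' j')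
      dmin R Theta' ^+ al i' j' Theta' = 1.
    move=> ii'; apply: big1 => j' _; apply: big1 => Theta' _.
    by rewrite /al (negbTE ii') expr0.
  have Pj j' : j' != j -> \prod_(Theta' in @JJ R n i j')
      dmin R Theta' ^+ al i j' Theta' = 1.
    move=> jj'; apply: big1 => Theta' _.
    by rewrite /al (negbTE jj') andbF expr0.
  rewrite /Sprod (bigD1_seq _ iin (iota_uniq _ _)) /= [X in _ * X]big1 => [|i' /Pi //].
  rewrite mulr1 (bigD1_seq _ jin (iota_uniq _ _)) /= [X in _ * X]big1 => [|j' /Pj //].
  rewrite mulr1 (bigD1 Theta Tin) /= [X in _ * X]big1 => [|Theta' /andP[_ TT']].
    by rewrite /al !eqxx mulr1 expr1.
  by rewrite /al (inj_eq val_inj) (negbTE TT') !andbF expr0.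
rewrite /weight; have [->|lj] := eqVneq l j; last first.
  rewrite big1 // => i' _; rewrite big1 // => Theta' _.
  by rewrite /al (negbTE lj) andbF.
rewrite (bigD1_seq i) ?iota_uniq ?mem_index_iota ?ji //= (bigD1 Theta) //=.
rewrite /al !eqxx big1 ?big1 // => [i' ii'|Theta' /andP[_ TT']].
  by rewrite big1 // => Theta' _; rewrite (negbTE ii').
by rewrite (inj_eq val_inj) (negbTE TT').
Qed.

End Products.

(** * Tableaux *)

Lemma sum_nat_interval a b lo hi : (a <= lo <= hi)%N -> (hi <= b)%N ->
  (\sum_(a <= p < b) (lo <= p < hi) = hi - lo)%N.
Proof.
move=> /andP[al lh] hb; rewrite (big_cat_nat _ (n := lo)) ?(leq_trans lh) //=.
rewrite [X in (_ + X)%N](big_cat_nat _ (n := hi)) //=.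
rewrite !big_nat [X in (X + _)%N]big1 => [|p]; last by lia.
rewrite [X in (_ + (_ + X))%N]big1 => [|p]; last by lia.
rewrite add0n addn0 (eq_bigr (fun=> 1%N)) => [|p ->] //.
by rewrite -big_nat sum_nat_const_nat muln1.
Qed.

Section Tableau.
Context {R : realType} {n : nat}.
Variable k : nat -> nat.
Local Notation C := (R[i])%C.
Local Notation P := {mpoly C[nvars n]}.
Local Notation kap := (kap n k).
Local Notation wt := (wt n k).

Lemma leq_wt i j : (i <= j)%N -> (wt i <= wt j)%N.
Proof.
move=> ij; rewrite /wt (big_cat_nat _ (n := i.+1) (p := j.+1)) //= leq_addr //.
Qed.

Lemma sum_wt_blocks (F : nat -> nat) i : (\sum_(0 <= p < wt i) F p =
  \sum_(1 <= j < i.+1) \sum_(wt j.-1 <= p < wt j) F p)%N.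
Proof.
elim: i => [|i IH]; first by rewrite [RHS]big_geq // /wt [X in index_iota _ X]big_geq ?big_geq.
rewrite [RHS]big_nat_recr //= -IH -big_cat_nat //=.
exact: leq_wt.
Qed.

Variable m : 'X_{1..nvars n}.
Hypothesis gt_m : gt_exp k m.

Let S l c : nat := (\sum_(1 <= d < c.+1) mexp m l d)%N.

(* The number of entries larger than c in the row l of the tableau. *)
Definition gt_entry (l c : nat) : nat := (wt l - S l c)%N.

Let S0 l : S l 0 = 0%N. Proof. by rewrite /S big_geq. Qed.

Let SS l c : S l c.+1 = (S l c + mexp m l c.+1)%N.
Proof. by rewrite /S big_nat_recr. Qed.

Let S_le l c c' : (c <= c')%N -> (S l c <= S l c')%N.
Proof.
by move=> cc'; rewrite /S (big_cat_nat _ (n := c.+1) (p := c'.+1)) //= leq_addr.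
Qed.

(** Iterating the inequalities down to the row 0. This makes the truncated subtraction in [gt_entry]
    exact. *)
Lemma row_sum_le l c : (l <= n)%N -> (c <= l)%N ->
  (\sum_(1 <= d < c.+1) mexp m l d <= wt l)%N.
Proof.
rewrite -/(S l c); elim: l c => [|l IH] c ln cl; first by case: c cl => //; rewrite S0.
case: c cl => [|c] cl; first by rewrite S0.
apply: leq_trans (gt_m ln cl) _; rewrite -/(S l c) wtS addnC leq_add2r.
exact: IH (ltnW ln) cl.
Qed.

Lemma gt_entry0 l : gt_entry l 0 = wt l.
Proof. by rewrite /gt_entry S0 subn0. Qed.

Lemma gt_entry_le l c c' : (c <= c')%N -> (gt_entry l c' <= gt_entry l c)%N.
Proof. by move=> cc'; rewrite leq_sub2l // S_le. Qed.

Lemma gt_entryS l c : (l <= n)%N -> (c < l)%N ->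
  gt_entry l c = (gt_entry l c.+1 + mexp m l c.+1)%N.
Proof.
move=> ln cl; have := row_sum_le ln cl; rewrite -/(S l c.+1) SS /gt_entry SS.
lia.
Qed.

Lemma gt_entry_diag l c : (l < n)%N -> (c <= l)%N ->
  (gt_entry l c <= gt_entry l.+1 c.+1)%N.
Proof.
move=> ln cl; have := gt_m ln cl; have := row_sum_le (ltnW ln) cl.
by rewrite -!/(S _ _) /gt_entry wtS; lia.
Qed.

(* The entry in row l and column p of the tableau. *)
Let tab (l p : nat) : nat := (\sum_(0 <= c < l.+1) (p < gt_entry l c))%N.

Let lt_tab l p c : (c <= l)%N -> (c < tab l p)%N = (p < gt_entry l c)%N.
Proof.
move=> cl; apply/idP/idP => [|pc].
  apply: contraTT; rewrite -!leqNgt => cp; rewrite /tab.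
  rewrite (big_cat_nat _ (n := c)) ?(leqW cl) //= [X in (_ + X)%N]big_nat.
  rewrite [X in (_ + X)%N]big1 ?addn0 => [|d /andP[cd _]].
    apply: leq_trans (leq_sum _ (fun d _ => leq_b1 _)) _.
    by rewrite sum_nat_const_nat muln1 subn0.
  by rewrite ltnNge (leq_trans (gt_entry_le _ cd)).
rewrite /tab (big_cat_nat _ (n := c.+1)) //=; apply: leq_trans (leq_addr _ _).
rewrite big_nat (eq_bigr (fun=> 1%N)) => [|d /andP[_ dc]].
  by rewrite -big_nat sum_nat_const_nat muln1 subn0.
by rewrite (leq_trans pc) // gt_entry_le.
Qed.

Let tab_le l p : (tab l p <= l.+1)%N.
Proof.
apply: leq_trans (leq_sum _ (fun d _ => leq_b1 _)) _.
by rewrite sum_nat_const_nat muln1 subn0.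
Qed.

Let tab_gt0 l p : (p < wt l)%N -> (0 < tab l p)%N.
Proof. by move=> pl; rewrite lt_tab ?gt_entry0. Qed.

Let tab_eq l p c : (1 <= c <= l)%N ->
  (tab l p == c) = (gt_entry l c <= p < gt_entry l c.-1)%N.
Proof.
case: c => // c /andP[_ cl]; rewrite -lt_tab ?(ltnW cl) //= leqNgt -lt_tab //.
by rewrite -leqNgt eqn_leq.
Qed.

(** The term of index 0 of [tab l.+1 p] is 1, and its term of index c+1 dominates the term of index
    c of [tab l p] by [gt_entry_diag]. *)
Let tab_lt l p : (l < n)%N -> (p < wt l)%N -> (tab l p < tab l.+1 p)%N.
Proof.
move=> ln pl; rewrite [tab l.+1 p]/tab big_ltn // gt_entry0.
rewrite (leq_trans pl (leq_wt (leqnSn l))) add1n ltnS big_add1 /=.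
rewrite /tab !big_nat leq_sum // => c /andP[_ cl].
case: ltnP => // pc; by rewrite (leq_trans pc) // gt_entry_diag.
Qed.

Let tab_mono j p a b : (p < wt j)%N -> (a < b)%N -> (j + b <= n)%N ->
  (tab (j + a) p < tab (j + b) p)%N.
Proof.
move=> pj; elim: b => // b IH; rewrite ltnS leq_eqVlt addnS => /predU1P[->|ab] jb.
  by apply: tab_lt => //; apply: leq_trans pj (leq_wt (leq_addr _ _)).
apply: ltn_trans (IH ab (ltnW jb)) _.
by apply: tab_lt => //; apply: leq_trans pj (leq_wt (leq_addr _ _)).
Qed.

(* When the last entry of a column is n + 1 the corresponding minor is, up to
   sign, the minor without the last row. *)
Let col_len j p := ((n - j) + (tab n p <= n))%N.

Let col j p : P := minor (col_len j p) j (fun a => tab (j + a) p).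

Let col_lead j p : (1 <= j <= n)%N -> (p < wt j)%N ->
  is_lead (diag_mon (n - j).+1 j (fun a => tab (j + a) p)) (col j p).
Proof.
move=> /andP[j1 jn] pj.
(* A last entry n+1 stands for the conventional x_{n,n+1}, which contributes no variable to the
   monomial. *)
have -> : @diag_mon n (n - j).+1 j (fun a => tab (j + a) p) =
    diag_mon (col_len j p) j (fun a => tab (j + a) p).
  rewrite /col_len; case: leqP => tn; first by rewrite addn1.
  rewrite addn0 /diag_mon big_ord_recr /= subnKC //.
  have -> : tab n p = n.+1 by apply/eqP; rewrite eqn_leq tab_le.
  by rewrite /mvar /var_index ltnn andbF addm0.
have len_le : (col_len j p <= (n - j).+1)%N.
  by rewrite /col_len -addn1 leq_add2l leq_b1.
apply: is_lead_minor => // [|a al|a b /andP[ab bl]]; first by lia.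
  by rewrite tab_le tab_gt0 // (leq_trans pj) // leq_wt // leq_addr.
by apply: tab_mono => //; lia.
Qed.

Let col_products j p : (1 <= j <= n)%N -> (p < wt j)%N ->
  products (fun l => (l == j) : nat) (col j p).
Proof.
(* The length is 0 when [j = n] and the single entry of the column is n+1; the minor is then 1.
   Otherwise the entries kept are at most [n], so that they form some [Theta]. *)
move=> /andP[j1 jn] pj; rewrite /col; case lE: (col_len j p) => [|len].
  rewrite [minor _ _ _](_ : _ = 1); first exact: products1.
  exact: det_mx00.
have lenn : (j + len <= n)%N.
  by move: lE; rewrite /col_len; case: leqP; lia.
have tabn a : (a < len.+1)%N -> (1 <= tab (j + a) p <= n)%N.
  move=> al; rewrite tab_gt0 /=; last by rewrite (leq_trans pj) // leq_wt // leq_addr.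
  have [jan|jan] := eqVneq (j + a)%N n.
    rewrite jan; move: lE; rewrite /col_len; case: leqP => //; lia.
  by apply: leq_trans (tab_le _ _) _; lia.
have n1 : (0 < n)%N by apply: leq_trans jn.
pose i := (j + len)%N; have ijE : (i - j).+1 = len.+1 by rewrite /i addKn.
pose ord a : 'I_n := insubd (Ordinal n1) (tab (j + a) p).-1.
pose Theta : (i - j).+1.-tuple 'I_n := [tuple ord b | b < (i - j).+1].
have dE : dmin R Theta = minor len.+1 j (fun a => tab (j + a) p).
  rewrite dmin_minor ijE; apply: eq_minor => b bl.
  have bi : (b < (i - j).+1)%N by rewrite ijE.
  rewrite /theta_of (nth_map (Ordinal n1)) ?size_tuple //.
  have := nth_mktuple ord (Ordinal n1) (Ordinal bi) => /= ->.
  have /andP[t1 tn] := tabn b bl.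
  have tn' : ((tab (j + b) p).-1 < n)%N by rewrite prednK.
  by rewrite /ord val_insubd tn' prednK.
rewrite -dE; apply: products_dmin => //; first by rewrite j1 leq_addr.
have jn' : (1 <= j <= n)%N by rewrite j1.
by rewrite dE; have := is_lead_neq0 (col_lead jn' pj); rewrite /col lE.
Qed.

(** The columns starting at the row [j] are those with [wt j.-1 <= p < wt j]; there are [kap j] of
    them. The exponent of x_{i,c} in the product of the diagonals is the number of entries c in the
    row i, that is [mexp m i c]. *)
Lemma gt_exp_products : exists2 f : P, products kap f & is_lead m f.
Proof.
pose r := index_iota 1 n.+1.
pose cols j := index_iota (wt j.-1) (wt j).
have rP j : j \in r -> (1 <= j <= n)%N by rewrite mem_index_iota ltnS.
have colsP j p : p \in cols j -> (p < wt j)%N by rewrite mem_index_iota => /andP[].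
exists (\prod_(j <- r) \prod_(p <- cols j) col j p).
  have H := products_prod (fun j jr => products_prod (fun p pj => col_products (rP j jr) (colsP j p pj))).
  apply: eq_products H => l ln.
  rewrite (bigD1_seq l) ?iota_uniq ?mem_index_iota //= [X in (_ + X)%N]big1 ?addn0 => [|j jl].
    rewrite eqxx sum_nat_const_nat muln1; case: l ln => // l _.
    by rewrite wtS addKn.
  by rewrite eq_sym (negbTE jl) big1.
have -> : m = (\sum_(j <- r | j \in r) \sum_(p <- cols j | p \in cols j)
    diag_mon (n - j).+1 j (fun a => tab (j + a) p))%MM.
  apply: mexpP => i c ci lein; rewrite mexp_sum -big_seq.
  under eq_bigr => j _ do rewrite mexp_sum -big_seq.
  transitivity (\sum_(1 <= j < i.+1) \sum_(wt j.-1 <= p < wt j) (tab i p == c))%N.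
    transitivity (\sum_(0 <= p < wt i) (tab i p == c))%N.
      under eq_bigr => p _ do rewrite tab_eq //.
      rewrite sum_nat_interval ?gt_entry_le ?leq_pred //; last first.
        by rewrite -gt_entry0 gt_entry_le.
      case: c ci => // c /andP[_ ci]; rewrite (gt_entryS lein ci).
      by rewrite addKn.
    exact: sum_wt_blocks.
  rewrite (big_cat_nat _ (n := i.+1) (p := n.+1)) //=.
  rewrite [X in (_ + X)%N]big_nat [X in (_ + X)%N]big1 ?addn0.
    rewrite !big_nat; apply: eq_bigr => j /andP[j1 ji]; apply: eq_bigr => p _.
    rewrite mexp_diag_mon // -ltnS ji subnKC //=.
    by have -> : (i - j < (n - j).+1)%N by lia.
  move=> j /andP[ij jn]; rewrite big1 // => p _; rewrite mexp_diag_mon //.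
  by rewrite leqNgt ij.
rewrite big_seq; apply: is_lead_prod => j jr; rewrite big_seq.
by apply: is_lead_prod => p pj; apply: col_lead; [apply: rP | apply: colsP].
Qed.

End Tableau.

(** * The degree in the last row *)

Section LastRowDegree.
Context {R : realType} {n : nat}.
Local Notation C := (R[i])%C.
Local Notation P := {mpoly C[nvars n]}.
Implicit Types (f g : P).

Lemma eulerD i : {morph @euler R n i : f g / f + g}.
Proof.
by move=> f g; rewrite /euler -big_split; apply: eq_bigr => s _; rewrite dvarD mulrDr.
Qed.

Lemma eulerM i f g : euler i (f * g) = euler i f * g + f * euler i g.
Proof.
rewrite /euler mulr_suml mulr_sumr -big_split; apply: eq_bigr => s _ /=.
by rewrite dvarM mulrDr mulrA; congr (_ + _); exact: mulrCA.
Qed.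

(** Homogeneity of degree [r] in the row [n], by Euler's identity. *)
Definition last_homog (r : nat) f : Prop := euler n f = r%:R *: f.

Lemma last_homogM r r' f g : last_homog r f -> last_homog r' g ->
  last_homog (r + r') (f * g).
Proof.
by move=> fr gr; rewrite /last_homog eulerM fr gr natrD scalerDl scalerAl scalerAr.
Qed.

Lemma last_homog1 : last_homog 0 1.
Proof.
rewrite /last_homog scale0r; apply: (addIr (euler n 1)).
by rewrite add0r -{3}[1]mulr1 eulerM mulr1 mul1r.
Qed.

Lemma last_homogX r f a : last_homog r f -> last_homog (a * r) (f ^+ a).
Proof.
move=> fr; elim: a => [|a IH]; first exact: last_homog1.
by rewrite exprS mulSn; apply: last_homogM.
Qed.

Lemma last_homog_prod (I : eqType) (s : seq I) (Q : pred I) (r : I -> nat) (F : I -> P) :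
  (forall x, x \in s -> Q x -> last_homog (r x) (F x)) ->
  last_homog (\sum_(x <- s | Q x) r x) (\prod_(x <- s | Q x) F x).
Proof.
move=> H; rewrite big_seq_cond [X in last_homog _ X]big_seq_cond.
apply: (big_ind2 last_homog) => [|r1 f1 r2 f2|x /andP[]]; first exact: last_homog1.
  exact: last_homogM.
exact: H.
Qed.

Lemma euler_xvar i c : (1 <= c <= n)%N -> (c <= i)%N || (i < n)%N ->
  euler n (xvar R n i c) = (i == n)%:R *: xvar R n i c.
Proof.
move=> /andP[c1 cn] ci; rewrite /euler.
have E s : (1 <= s < n.+1)%N -> xvar R n n s * dvar n s (xvar R n i c) =
    if (i == n) && (c == s) then xvar R n i c else 0.
  move=> sn; rewrite dvar_xvar //; case: andP => [[/eqP-> /eqP->]|_].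
    by rewrite mulr1.
  by rewrite mulr0.
rewrite big_nat (eq_bigr _ E) -big_nat; case: eqP => [->|_] /=; last first.
  by rewrite big1 ?scale0r.
rewrite scale1r (bigD1_seq c) ?iota_uniq ?mem_index_iota ?c1 //= eqxx.
by rewrite big1 ?addr0 // => s sc; rewrite eq_sym (negbTE sc).
Qed.

Lemma last_homog_dmin i j (Theta : (i - j).+1.-tuple 'I_n) :
  (1 <= j <= i)%N -> (i <= n)%N -> last_homog (i == n) (dmin R Theta).
Proof.
move=> /andP[j1 ji] lein; rewrite /last_homog /dmin.
rewrite (derivation_det (eulerD n) (eulerM n)); set A := \matrix_(a, b) _.
have EA a b : euler n (A a b) = (j + a == n)%N%:R *: A a b.
  have tn := ltn_ord (tnth Theta b); have an := ltn_ord a.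
  have ci : ((tnth Theta b).+1 <= j + a)%N || (j + a < n)%N by apply/orP; lia.
  by rewrite mxE euler_xvar.
have row0 (a : 'I_(i - j).+1) : (j + a == n)%N = false ->
    \det (\matrix_(i', b) (if i' == a then euler n (A i' b) else A i' b)) = 0.
  move=> ja; rewrite (expand_det_row _ a) big1 // => b _.
  by rewrite mxE eqxx EA ja scale0r mul0r.
case: eqP => [iE|/eqP iE]; last first.
  rewrite scale0r big1 // => a _; apply: row0; apply/negbTE.
  by have := ltn_ord a; move/eqP: iE; lia.
rewrite (bigD1 ord_max) //= big1 ?addr0 => [|a am].
  rewrite scale1r; congr (\det _); apply/matrixP => a b; rewrite [LHS]mxE.
  case: eqP => // ->; rewrite EA /=.
  have -> : (j + (i - j) == n)%N by apply/eqP; lia.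
  by rewrite scale1r.
apply: row0; apply/negbTE; move: am; rewrite -val_eqE /=.
by have := ltn_ord a; lia.
Qed.

Lemma last_homog_Sprod (alpha : exponents n) :
  last_homog (\sum_(1 <= j < n.+1) \sum_(Theta in @JJ R n n j) alpha n j Theta)%N
    (Sprod R alpha).
Proof.
have H : last_homog (\sum_(1 <= i < n.+1) \sum_(1 <= j < i.+1)
    \sum_(Theta in @JJ R n i j) alpha i j Theta * (i == n))%N (Sprod R alpha).
  apply: last_homog_prod => i; rewrite mem_index_iota => /andP[i1 lein] _.
  apply: last_homog_prod => j; rewrite mem_index_iota => /andP[j1 ji] _.
  apply: last_homog_prod => Theta _ _; apply/last_homogX/last_homog_dmin => //.
  by rewrite j1.
rewrite (_ : (\sum_(1 <= j < n.+1) _)%N = (\sum_(1 <= i < n.+1) \sum_(1 <= j < i.+1)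
    \sum_(Theta in @JJ R n i j) alpha i j Theta * (i == n))%N) //.
case: (posnP n) => [n0|n0].
  by rewrite [LHS]big_geq ?[RHS]big_geq // n0.
rewrite [RHS](bigD1_seq n) ?iota_uniq ?mem_index_iota ?n0 //= [X in (_ + X)%N]big1 ?addn0.
  by apply: eq_bigr => j _; apply: eq_bigr => Theta _; rewrite eqxx muln1.
move=> i /negbTE ni; rewrite big1 // => j _; rewrite big1 // => Theta _.
by rewrite ni muln0.
Qed.

Lemma mcoeff_mulX_mderiv f (p : 'I_(nvars n)) (m : 'X_{1..nvars n}) :
  ('X_p * f^`M(p))@_m = (m p)%:R * f@_m.
Proof.
rewrite mulrC; case: (posnP (m p)) => [m0|m0].
  rewrite m0 mul0r memN_msupp_eq0 //; apply/negP => /msuppM_le /allpairsP[[a b] /=].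
  rewrite msuppX inE => -[_ /eqP -> mE].
  by move: m0; rewrite mE mnmDE mnm1E eqxx addn1.
have {1}-> : m = (U_(p) + (m - U_(p)))%MM by rewrite addmC submK // lep1mP -lt0n.
rewrite mcoeffMX mcoeff_deriv submK ?lep1mP -?lt0n // mnmBE mnm1E eqxx subn1 prednK //.
by rewrite mulr_natl.
Qed.

Lemma last_homog_mexp r f (m : 'X_{1..nvars n}) : last_homog r f -> m \in msupp f ->
  (\sum_(1 <= s < n.+1) mexp m n s)%N = r.
Proof.
move=> /(congr1 (fun g => g@_m)); rewrite mcoeffZ mcoeff_msupp => E fm.
apply/eqP; rewrite -(eqr_nat C) -(inj_eq (mulIf fm)) -E /euler natr_sum mulr_suml.
rewrite raddf_sum /= !big_nat; apply/eqP/eq_bigr => s sn.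
have [p pE _] := @var_indexP n n s sn (leqnn n).
by rewrite (xvar_var pE) (dvar_var _ pE) mcoeff_mulX_mderiv /mexp pE.
Qed.

End LastRowDegree.

(** * The basis *)

Lemma lambda_size_wt n k : lambda_size n k = wt n k n.
Proof.
rewrite /lambda_size /wt big_nat_rev !big_nat; apply: eq_bigr => i /andP[i1 lein].
by rewrite /kap; congr k; lia.
Qed.

Lemma seq_max (T : eqType) (d : Order.disp_t) (O : orderType d) (F : T -> O) (s : seq T) :
  s != [::] -> exists2 v, v \in s & forall w, w \in s -> (F w <= F v)%O.
Proof.
elim: s => // x s IH _; have [->|s0] := eqVneq s [::].
  by exists x; rewrite ?mem_head // => w; rewrite inE => /eqP ->.
have [v vs v_max] := IH s0; have [xv|vx] := leP (F x) (F v).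
  exists v; first by rewrite inE vs orbT.
  by move=> w; rewrite inE => /predU1P[->|/v_max].
exists x; first exact: mem_head.
move=> w; rewrite inE => /predU1P[->//|/v_max wv].
exact/ltW/(le_lt_trans wv).
Qed.

Section Basis.
Context {R : realType} {n : nat}.
Variables (k : nat -> nat) (B : nat -> set {mpoly (R[i])%C[nvars n]}).
Local Notation C := (R[i])%C.
Local Notation P := {mpoly C[nvars n]}.
Local Notation N := (nvars n).
Implicit Types (u v f : P) (m : 'X_{1..N}).

Hypothesis n2 : (2 <= n)%N.
Hypothesis B_repr :
  forall r, (r <= lambda_size n k)%N -> lexdeg_repr (@Snr R n k r) (B r).

Definition all_repr : set P := \bigcup_(r in [set r | (r <= lambda_size n k)%N]) B r.

(** The leading exponent thus determines [r], so that representatives taken for different values of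
    [r] have different lexdegs. *)
Lemma Snr_mexp r u m : Snr k r u -> is_lead m u ->
  (\sum_(1 <= s < n.+1) mexp m n s)%N = r.
Proof.
move=> [alpha [_ <- ->]] [um _]; apply: last_homog_mexp um.
exact: last_homog_Sprod.
Qed.

Lemma Snr_size r u : Snr k r u -> (r <= lambda_size n k)%N.
Proof.
move=> [alpha [adm <- _]]; rewrite lambda_size_wt /wt !big_nat leq_sum // => j jn.
apply: leq_trans (adm j jn); rewrite [leqRHS](bigD1_seq n) ?iota_uniq //=.
  exact: leq_addr.
by rewrite mem_index_iota leqnn andbT; case/andP: jn.
Qed.

Lemma all_repr_Snr u : all_repr u -> exists2 r, (r <= lambda_size n k)%N & B r u /\ Snr k r u.
Proof. by move=> [r /= rl Bu]; exists r => //; split=> //; apply: (B_repr rl).1. Qed.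

Lemma all_repr_neq0 u : all_repr u -> u != 0.
Proof. by move=> /all_repr_Snr[r _ [_ [alpha [_ _ ->]]]]; apply: Sprod_neq0. Qed.

Lemma all_repr_Vn u : all_repr u -> Vn k u.
Proof. by move=> /all_repr_Snr[r _ [_ [alpha [adm _ ->]]]]; apply: Sprod_Vn. Qed.

Lemma all_repr_inj u v : all_repr u -> all_repr v -> lexdeg u = lexdeg v -> u = v.
Proof.
move=> Bu Bv uv; have [m um um'] := lexdeg_lead (all_repr_neq0 Bu).
have vm : is_lead m v by apply: lexdeg_is_lead (all_repr_neq0 Bv) _; rewrite -uv.
have [r rl [Bru Su]] := all_repr_Snr Bu; have [r' rl' [Brv Sv]] := all_repr_Snr Bv.
have rr' : r = r' by rewrite -(Snr_mexp Su um) -(Snr_mexp Sv vm).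
rewrite -rr' in Brv; have [w [_ w_uniq]] := (B_repr rl).2 u Su.
by rewrite -(w_uniq u) // -(w_uniq v).
Qed.

Lemma all_repr_ex m : gt_exp k m -> exists2 u, all_repr u & is_lead m u.
Proof.
move=> gt_m; have [f [alpha fE adm] fm] := @gt_exp_products R n k m gt_m.
pose r := (\sum_(1 <= j < n.+1) \sum_(Theta in @JJ R n n j) alpha n j Theta)%N.
have Sf : Snr k r f by exists alpha.
have rl := Snr_size Sf; have [v [[Bv fv] _]] := (B_repr rl).2 f Sf.
have av : all_repr v by exists r.
by exists v => //; apply: lexdeg_is_lead (all_repr_neq0 av) _; rewrite -fv; apply: is_lead_lexdeg.
Qed.

Lemma all_repr_free : lin_indep all_repr.
Proof.
move=> s c us sB sum0 u us'; apply: contrapT => /eqP cu.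
pose s' := [seq v <- s | c v != 0].
have : s' != [::] by rewrite -has_filter; apply/hasP; exists u.
(* Among the terms with a nonzero coefficient, [v] has the largest lexdeg, attained only once by
   [all_repr_inj]; its leading monomial cannot cancel. *)
move=> /(seq_max (@lexdeg R n))[v]; rewrite mem_filter => /andP[cv vs] v_max.
have [m vm lv] := lexdeg_lead (all_repr_neq0 (sB v vs)).
have := congr1 (mcoeff m) sum0; rewrite mcoeff0 raddf_sum /= (bigD1_seq v) //=.
rewrite mcoeffZ big_seq_cond big1 ?addr0 => [/eqP|w /andP[ws wv]].
  by rewrite mulf_eq0 (negbTE cv) /=; have := vm.1; rewrite mcoeff_msupp => /negbTE ->.
rewrite mcoeffZ; have [->|cw] := eqVneq (c w) 0; first by rewrite mul0r.
have ws' : w \in s' by rewrite mem_filter cw.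
have [m' /is_leadP[_ lw] lw'] := lexdeg_lead (all_repr_neq0 (sB w ws)).
rewrite memN_msupp_eq0 ?mulr0 //; apply/negP => /lw; rewrite -lw' -lv => le_vw.
have E : lexdeg w = lexdeg v by apply/eqP; rewrite eq_le v_max.
by rewrite (all_repr_inj (sB w ws) (sB v vs) E) eqxx in wv.
Qed.

Lemma all_repr_lead f : Vn k f -> f != 0 ->
  exists u m, [/\ all_repr u, is_lead m u & is_lead m f].
Proof.
move=> Vf f0; have [m fm _] := lexdeg_lead f0.
have Lf : liftable (kap n k) f by apply/liftable_Vn.
by have [u Bu um] := all_repr_ex (lead_gt_exp Lf fm); exists u, m.
Qed.

(* Number of exponents below m among those with all the entries at most wt n;
   it bounds the number of reductions of a polynomial with leading exponent m. *)
Definition lex_rank m : nat :=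
  #|[set t : N.-tuple 'I_(wt n k n).+1 |
     (map_tuple val t < lex_tuple m :> N.-tuplelexi nat)%O]%SET|.

(** By [row_sum_le] the entries of [m] are at most [wt n k n], so [m] itself is counted in the rank
    of [m'] but not in its own. *)
Lemma lex_rank_lt m m' : gt_exp k m -> (lex_tuple m < lex_tuple m')%O ->
  (lex_rank m < lex_rank m')%N.
Proof.
move=> gt_m lt_m; apply: proper_card; apply/properP; split.
  by apply/fintype.subsetP => t; rewrite !inE => /lt_trans; apply.
have m_le (p : 'I_N) : (m p < (wt n k n).+1)%N.
  have [i [j [ij lein pE]]] := var_index_surj p.
  rewrite ltnS; apply: leq_trans (leq_wt k lein).
  apply: leq_trans (row_sum_le gt_m lein (leqnn i)).
  have -> : m p = mexp m i j by rewrite /mexp pE.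
  by rewrite (bigD1_seq j) ?iota_uniq ?mem_index_iota //= leq_addr.
have E : map_tuple val [tuple Ordinal (m_le p) | p < N] = lex_tuple m :> N.-tuplelexi nat.
  apply: eq_from_tnth => p.
  by rewrite tnth_map tnth_mktuple /= /fun_of_multinom.
by exists [tuple Ordinal (m_le p) | p < N]; rewrite inE E ?ltxx.
Qed.

Lemma all_repr_span f : Vn k f -> lin_span all_repr f.
Proof.
(* Leading terms are removed one after the other. The bound on the lexdegs ensures that the next
   representative is not yet in the list, so that its coefficient can be set freely. *)
suff H : forall s f, Vn k f -> (forall m, is_lead m f -> (lex_rank m < s)%N) ->
    exists t c, [/\ uniq t, forall u, u \in t -> all_repr u /\ (lexdeg u <= lexdeg f)%O
      & f = \sum_(u <- t) c u *: u].
  move=> Vf; have [f0|f0] := eqVneq f 0.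
    by exists [::], (fun=> 0); split=> //; rewrite big_nil.
  have [m fm _] := lexdeg_lead f0.
  have [|t [c [_ tB ->]]] := H (lex_rank m).+1 f Vf.
    move=> m' fm'; have := is_lead_lexdeg fm'; rewrite (is_lead_lexdeg fm).
    by move=> /lex_tuple_inj ->.
  by exists t, c; split=> // u /tB[].
elim=> [|s IH] {}f Vf rank_f.
  have [f0|f0] := eqVneq f 0; last by have [m /rank_f] := lexdeg_lead f0.
  by exists [::], (fun=> 0); split=> //; rewrite big_nil.
have [f0|f0] := eqVneq f 0.
  by exists [::], (fun=> 0); split=> //; rewrite big_nil.
have [u [m [Bu um fm]]] := all_repr_lead Vf f0.
pose a := f@_m / u@_m; pose g := f - a *: u.
have um0 : u@_m != 0 by have := um.1; rewrite mcoeff_msupp.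
have gm : g@_m = 0 by rewrite mcoeffB mcoeffZ divfK // subrr.
have Vg : Vn k g.
  have Lf : liftable (kap n k) f by apply/liftable_Vn.
  have Lu : liftable (kap n k) u by apply/liftable_Vn/all_repr_Vn.
  apply/liftable_Vn => //; case: Lf Lu => [f' f'w fE] [u' u'w uE].
  exists (f' - a *: u'); first exact/invariantB/invariantZ.
  by rewrite projB projZ fE uE.
have g_lt m' : m' \in msupp g -> (lex_tuple m' < lex_tuple m)%O.
  have /is_leadP[_ lf] := fm; have /is_leadP[_ lu] := um => m'g.
  rewrite lt_neqAle; apply/andP; split.
    by apply: contraTneq m'g => /lex_tuple_inj ->; rewrite mcoeff_msupp gm eqxx.
  move: m'g => /msuppB_le; rewrite mem_cat => /orP[/lf //|/msuppZ_le /lu //].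
have lead_lt m' : is_lead m' g -> (lex_rank m' < s)%N.
  move=> gm'; have Lg : liftable (kap n k) g by apply/liftable_Vn.
  rewrite -ltnS; apply: leq_trans (rank_f m fm).
  by rewrite ltnS; apply: lex_rank_lt (lead_gt_exp Lg gm') (g_lt _ gm'.1).
have fu : lexdeg u = lexdeg f by rewrite (is_lead_lexdeg um) (is_lead_lexdeg fm).
have [t [c [ut tB gE]]] : exists t c, [/\ uniq t,
    forall w, w \in t -> all_repr w /\ (lexdeg w < lexdeg f)%O
    & g = \sum_(w <- t) c w *: w].
  have [g0|g0] := eqVneq g 0.
    by exists [::], (fun=> 0); split=> //; rewrite big_nil.
  have [t [c [ut tB gE]]] := IH g Vg lead_lt.
  exists t, c; split=> // w wt; have [Bw wg] := tB w wt; split=> //.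
  apply: le_lt_trans wg _; have [m' gm' ->] := lexdeg_lead g0.
  by rewrite (is_lead_lexdeg fm) g_lt ?gm'.1.
have ut' : u \notin t by apply/negP => /tB[_]; rewrite fu ltxx.
exists (u :: t), (fun w => if w == u then a else c w); split.
- by rewrite /= ut'.
- move=> w; rewrite inE => /predU1P[->|wt]; first by rewrite fu.
  by have [Bw wf] := tB w wt; split=> //; apply: ltW.
rewrite big_cons eqxx -[LHS](subrK (a *: u)) addrC; congr (_ + _).
rewrite -/g gE !big_seq; apply: eq_bigr => w wt.
by rewrite ifN //; apply: contraNneq ut' => <-.
Qed.

End Basis.

(** * Gelfand-Tsetlin patterns *)

Section Patterns.
Context {R : realType} {n : nat}.
Variables (k : nat -> nat) (t : 'I_n.+1 -> (R[i])%C).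
Hypothesis t_weight : gl_weight k t.
Local Notation C := (R[i])%C.
Local Notation N := (nvars n).
Local Notation wt := (wt n k).
Implicit Types (m : 'X_{1..N}).

Lemma gl_weight_wt i (j : 'I_n.+1) : (j + i)%N = n -> t j = t ord_max + (wt i)%:R.
Proof.
elim: i j => [|i IH] j ji.
  by rewrite /wt big_geq // addr0; congr t; apply: val_inj => /=; lia.
have jn : (j < n)%N by lia.
have jE : widen_ord (leqnSn n) (Ordinal jn) = j by apply: val_inj.
have := t_weight (Ordinal jn); rewrite jE.
move=> /(canRL (subrK _)) ->; rewrite (IH (lift ord0 (Ordinal jn))); last first.
  by rewrite lift0 /=; lia.
rewrite addrC -addrA -natrD; congr (_ + _%:R); rewrite wtS /kap; congr (_ + k _)%N.
by rewrite /=; lia.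
Qed.

(** The column [q] of the pattern records the row n-q of the tableau: its entry in the row [p]
    counts the tableau entries larger than n-p, shifted by the last entry of the top row. *)
Definition pattern_of m : 'M[C]_n.+1 :=
  \matrix_(p, q) if (q <= p)%N then t ord_max + (gt_entry k m (n - q) (n - p))%:R else 0.

Lemma pattern_of_gt m : gt_exp k m -> gt_patterns t (pattern_of m).
Proof.
move=> gt_m; split=> [|j|i j ji /=].
- by apply/is_trig_mxP => i j ij; rewrite mxE leqNgt ij.
- rewrite mxE /= leq_ord subnn gt_entry0; apply/esym/gl_weight_wt.
  by rewrite subnKC // -ltnS.
have iN := ltn_ord i; have jN := ltn_ord j.
split.
  exists (mexp m (n - j) (n - i)); rewrite !mxE /= /bump /= add1n (leq_trans ji) // ji.
  have -> : (n - i = (n - i.+1).+1)%N by lia.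
  rewrite [gt_entry _ _ _ (n - i.+1)]gt_entryS //; try lia.
  by rewrite opprD addrACA subrr add0r natrD addrC addKr.
exists (gt_entry k m (n - j) (n - i) - gt_entry k m (n - j.+1) (n - i.+1))%N.
have le_entry : (gt_entry k m (n - j.+1) (n - i.+1) <= gt_entry k m (n - j) (n - i))%N.
  have -> : (n - j = (n - j.+1).+1)%N by lia.
  have -> : (n - i = (n - i.+1).+1)%N by lia.
  by apply: gt_entry_diag => //; lia.
by rewrite !mxE /= /bump /= !add1n ltnS ji opprD addrACA subrr add0r (natrB _ le_entry).
Qed.

Lemma pattern_of_inj m m' : gt_exp k m -> gt_exp k m' ->
  pattern_of m = pattern_of m' -> m = m'.
Proof.
move=> gt_m gt_m' E.
have entryE l c : (c <= l)%N -> (l <= n)%N -> gt_entry k m l c = gt_entry k m' l c.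
  move=> cl ln; have pq : (n - l <= n - c)%N by lia.
  have := congr1 (fun M : 'M[C]_n.+1 => M (inord (n - c)) (inord (n - l))) E.
  rewrite !mxE !inordK ?ltnS ?leq_subr // pq !subKn //; last by lia.
  by move/addrI/eqP; rewrite eqr_nat => /eqP.
apply: mexpP => l [//|c] /andP[_ cl] ln.
apply/eqP; rewrite -(eqn_add2l (gt_entry k m l c.+1)) -gt_entryS // !entryE // ?(ltnW cl) //.
by rewrite -gt_entryS.
Qed.

(** The exponent of x_{l,c} is the difference of two consecutive entries in the column n-l of [T].
    The top row fixes the remaining constants, and the diagonal interlacing conditions become
    [gt_exp]. *)
Lemma pattern_of_surj T : gt_patterns t T -> exists2 m, gt_exp k m & pattern_of m = T.
Proof.
move=> [/is_trig_mxP T0 T_top T_step].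
have ex_a (p : 'I_N) : exists a : nat, forall l c, (l <= n)%N -> var_index n l c = Some p ->
    T (inord (n - c.-1)) (inord (n - l)) - T (inord (n - c)) (inord (n - l)) = a%:R.
  have [l [c [/andP[c1 cl] ln lcp]]] := var_index_surj p.
  have i_lt : (n - c < n)%N by lia.
  have j_lt : (n - l < n)%N by lia.
  have [[a aE] _] := T_step (Ordinal i_lt) (Ordinal j_lt) (leq_sub2l n cl).
  exists a => l' c' _ lcp'; have [-> ->] := var_index_inj lcp' lcp; rewrite -aE.
  congr (T _ _ - T _ _); apply: val_inj; rewrite /= ?inordK /bump //=; lia.
have [a aP] := choice ex_a; pose m : 'X_{1..N} := [multinom a p | p < N].
have T_mexp l c : (1 <= c <= l)%N -> (l <= n)%N ->
    T (inord (n - c.-1)) (inord (n - l)) - T (inord (n - c)) (inord (n - l))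
    = (mexp m l c)%:R.
  move=> cl ln; have [p pE _] := var_indexP cl ln.
  by rewrite (aP p _ _ ln pE) /mexp pE mnmE.
pose S l c : nat := (\sum_(1 <= d < c.+1) mexp m l d)%N.
have TE l c : (c <= l)%N -> (l <= n)%N ->
    T (inord (n - c)) (inord (n - l)) = t ord_max + (wt l)%:R - (S l c)%:R.
  elim: c => [|c IH] cl ln.
    rewrite /S big_geq // subr0 subn0 (_ : inord n = ord_max); last first.
      by apply: val_inj; rewrite /= inordK.
    by rewrite T_top; apply: gl_weight_wt; rewrite inordK; lia.
  have := T_mexp l c.+1 cl ln; rewrite /= => /(canRL (subrK _)).
  have SS : S l c.+1 = (S l c + mexp m l c.+1)%N by rewrite /S big_nat_recr.
  rewrite (IH (ltnW cl) ln) SS natrD => E.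
  by rewrite opprD addrA E [RHS]addrC addKr.
have gt_m : gt_exp k m.
  move=> l i ln il.
  have i_lt : (n - i.+1 < n)%N by lia.
  have j_lt : (n - l.+1 < n)%N by lia.
  have ij : (n - l.+1 <= n - i.+1)%N by lia.
  have [_ [b]] := T_step (Ordinal i_lt) (Ordinal j_lt) ij.
  have -> : widen_ord (leqnSn n) (Ordinal i_lt) = inord (n - i.+1) by apply: val_inj; rewrite /= inordK //; lia.
  have -> : widen_ord (leqnSn n) (Ordinal j_lt) = inord (n - l.+1) by apply: val_inj; rewrite /= inordK //; lia.
  have -> : lift ord0 (Ordinal i_lt) = inord (n - i).
    by apply: val_inj; rewrite /= inordK /bump //=; lia.
  have -> : lift ord0 (Ordinal j_lt) = inord (n - l).
    by apply: val_inj; rewrite /= inordK /bump //=; lia.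
  rewrite !TE //; try lia.
  rewrite wtS natrD => E; rewrite -/(S l.+1 i.+1) -/(S l i).
  suff -> : (kap n k l.+1 + S l i = S l.+1 i.+1 + b)%N by apply: leq_addr.
  by apply/eqP; rewrite -(eqr_nat C) !natrD -E; apply/eqP; ring.
exists m => //; apply/matrixP => p q; rewrite mxE.
have pn : (p <= n)%N by rewrite -ltnS.
have qn : (q <= n)%N by rewrite -ltnS.
case: leqP => qp; last by rewrite T0.
have cl : (n - p <= n - q)%N by lia.
have ln : (n - q <= n)%N by apply: leq_subr.
have := TE _ _ cl ln; rewrite !subKn // !inord_val => ->.
by rewrite /gt_entry natrB ?addrA // row_sum_le.
Qed.

End Patterns.

Theorem theorem3p1 (R : realType) (n : nat) (k : nat -> nat)
    (B : nat -> set {mpoly (R[i])%C[nvars n]}) :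
  (2 <= n)%N ->
  (forall r, (r <= lambda_size n k)%N -> lexdeg_repr (@Snr R n k r) (B r)) ->
  let Blambda := \bigcup_(r in [set r | (r <= lambda_size n k)%N]) B r in
  is_basis Blambda (@Vn R n k) /\
  forall t : 'I_n.+1 -> (R[i])%C, gl_weight k t ->
    exists f : {mpoly (R[i])%C[nvars n]} -> 'M[(R[i])%C]_n.+1,
      set_bij Blambda (gt_patterns t) f.
Proof.
move=> n2 B_repr Blambda; split.
  split; [exact: all_repr_Vn | exact: all_repr_free | exact: all_repr_span].
move=> t t_weight.
(* The tuple [lexdeg u] is read back as an exponent; both sides of the bijection are parametrized by
   the exponents satisfying [gt_exp]. *)
pose lead_exp (u : {mpoly (R[i])%C[nvars n]}) : 'X_{1..nvars n} := [multinom lexdeg u].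
have leadE u m : is_lead m u -> lead_exp u = m.
  by move=> um; apply: val_inj; apply: is_lead_lexdeg um.
have gt_lead u : Blambda u -> gt_exp k (lead_exp u).
  move=> Bu; have [m um _] := lexdeg_lead (all_repr_neq0 B_repr Bu).
  rewrite (leadE u m um); apply: lead_gt_exp um.
  exact/liftable_Vn/(all_repr_Vn n2 B_repr).
exists (fun u => pattern_of k t (lead_exp u)); split.
- by move=> u Bu; apply: pattern_of_gt => //; apply: gt_lead.
- move=> u v /set_mem Bu /set_mem Bv uv; apply: (all_repr_inj B_repr Bu Bv).
  by have /(congr1 (@multinom_val _)) := pattern_of_inj (gt_lead u Bu) (gt_lead v Bv) uv.
move=> T /(pattern_of_surj t_weight)[m gt_m <-].
by have [u Bu um] := all_repr_ex B_repr gt_m; exists u => //; rewrite (leadE u m um).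
Qed.
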